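(* Let $\mathcal{X}\subseteq\mathbb{R}^m$, and for $k=1,\dots,K$ let $A_k(x)\in\mathbb{S}^n$, $b_k(x)\in\mathbb{R}^n$, $c_k(x)\in\mathbb{R}$ depend affinely on $x\in\mathbb{R}^m$. Let $\mu\in\mathbb{R}^n$, $\Sigma\in\mathbb{S}^n$ and $$\mathcal{P} := \left\{\mathbb{P}\in\mathcal{P}([0,1]^n) : \mathbb{E}_{\mathbb{P}}[\tilde\xi]=\mu,\ \mathbb{E}_{\mathbb{P}}[\mathrm{diag}(\tilde\xi\tilde\xi^T)]=\mathrm{diag}(\Sigma),\ \mathbb{E}_{\mathbb{P}}[\tilde\xi\tilde\xi^T]\ge\Sigma\right\}.$$ Suppose: (a) $\mathcal{X}$ is semidefinite representable; (b) $-A_k(x)$ is submodular for each $x\in\mathcal{X}$ and each $k=1,\dots,K$. Then the optimal value of the distributionally robust optimization problem $$\inf_{x\in\mathcal{X}}\ \sup_{\mathbb{P}\in\mathcal{P}}\ \mathbb{E}_{\mathbb{P}}\left[\max_{k=1,\dots,K}\left(\tilde\xi^TA_k(x)\tilde\xi+b_k(x)^T\tilde\xi+c_k(x)\right)\right]$$ is bounded above, in polynomial time, by the optimal value of the semidefinite program $$\begin{array}{rll} \inf & y_0+\mu^Ty+\Sigma\bullet Y\\ \text{s.t.} & x\in\mathcal{X},\\ & Y\text{ submodular},\\ & Z_k\ge 0 & \forall\,k=1,\dots,K,\\ & \begin{pmatrix} y_0 & (y^T-e^TZ_k)/2\\ (y-Z_k^Te)/2 & Y+(Z_k+Z_k^T)/2\end{pmatrix}\succeq\begin{pmatrix}c_k(x)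 & b_k(x)^T/2\\ b_k(x)/2 & A_k(x)\end{pmatrix} & \forall\,k=1,\dots,K, \end{array}$$ with decision variables $x\in\mathbb{R}^m$, $(y_0,y,Y)\in\mathbb{R}\times\mathbb{R}^n\times\mathbb{S}^n$, and $Z_k\in\mathbb{R}^{n\times n}$ for $k=1,\dots,K$. Equality of the two optimal values holds for $n=3$.
   Context: $\mathbb{S}^n$ is the space of symmetric real $n\times n$ matrices; $\mathcal{P}([0,1]^n)$ is the set of probability distributions with support contained in $[0,1]^n$, and $\tilde\xi$ is the random vector with distribution $\mathbb{P}$; $e$ is the all-ones vector; $A\bullet B=\mathrm{trace}(A^TB)$; $\mathrm{diag}(A)$ is the vector of diagonal entries of $A$; matrix inequalities $\ge$ are entrywise; $A\succeq B$ means $A-B$ is positive semidefinite. A symmetric matrix is called submodular if all its off-diagonal entries are nonpositive. A set is semidefinite representable if it is the projection of the solution set of a linear matrix inequality; ''in polynomial time'' refers to the bound being given by a semidefinite program of size polynomial in the data. *)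

(* Defs.v *)
From HB Require Import structures.
From mathcomp Require Export all_boot all_order all_algebra.
From mathcomp Require Export all_classical all_reals all_analysis.
Set Implicit Arguments.
Unset Strict Implicit.
Unset Printing Implicit Defensive.
Import Order.TTheory GRing.Theory Num.Theory.
Import numFieldNormedType.Exports.

Local Open Scope classical_set_scope.
Local Open Scope ring_scope.

Section Matrices.
Variable R : realType.

Definition symmx n (A : 'M[R]_n) : Prop := A^T = A.

Definition psd n (A : 'M[R]_n) : Prop :=
  symmx A /\ forall v : 'cV[R]_n, 0 <= (v^T *m A *m v) 0 0.

Definition submodular n (A : 'M[R]_n) : Prop :=
  symmx A /\ forall i j : 'I_n, i != j -> A i j <= 0.

Definition mxdot m n (A B : 'M[R]_(m, n)) : R := \tr (A^T *m B).

Definition diagv n (A : 'M[R]_n) : 'cV[R]_n := \col_i A i i.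

Definition ones n : 'cV[R]_n := const_mx 1.

(* The symmetric (1 + n) x (1 + n) matrix of the quadratic function
   c + b^T v + v^T A v in the homogenized variable (1, v). *)
Definition quad_mx n (c : R) (b : 'cV[R]_n) (A : 'M[R]_n) : 'M[R]_(1 + n) :=
  block_mx c%:M (2^-1 *: b^T) (2^-1 *: b) A.

End Matrices.

Section SemidefiniteRepresentability.
Variable R : realType.

Definition affine_map (V W : lmodType R) (f : V -> W) : Prop :=
  exists (L : {linear V -> W}) (w : W), forall v, f v = L v + w.

(* [S] is the projection on [V] of the solution set of a linear matrix
   inequality [F (v, u) >= 0] of order [p], with [q] lifting variables [u].
   The size of the representation is the total number of scalar variables
   plus the order of the inequality; [s] is an upper bound on it. *)
Definition semidefinite_representable (V : vectType R) (s : nat) (S : set V)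
    : Prop :=
  exists (q p : nat) (F : (V * 'cV[R]_q)%type -> 'M[R]_p),
    [/\ affine_map F, (forall z, symmx (F z)),
        S = [set v | exists u, psd (F (v, u))]
      & (\dim {:V} + q + p <= s)%N].

End SemidefiniteRepresentability.

Section Distributions.
Variables (R : realType) (n : nat).

Definition borel_vec := g_sigma_algebraType (@open 'cV[R]_n).

Definition msupport (P : probability borel_vec R) : set 'cV[R]_n :=
  [set x | forall U : set 'cV[R]_n, open U -> U x -> (0 < P U)%E].

Definition unit_box : set 'cV[R]_n := [set x | forall i, 0 <= x i 0 <= 1].

(* Entrywise expectation of a random matrix, in the extended reals; all the
   functions integrated below are bounded on the support of [P]. *)
Definition mean (P : probability borel_vec R) p q
    (F : 'cV[R]_n -> 'M[R]_(p, q)) : 'M[\bar R]_(p, q) :=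
  \matrix_(i, j) ('E_P[(fun xi : borel_vec => F xi i j)%R])%E.

Definition ambiguity_set (mu : 'cV[R]_n) (Sigma : 'M[R]_n) :
    set (probability borel_vec R) :=
  [set P | [/\ msupport P `<=` unit_box,
    mean P id = map_mx EFin mu,
    mean P (fun xi => diagv (xi *m xi^T)) = map_mx EFin (diagv Sigma)
  & forall i j, ((Sigma i j)%:E <= mean P (fun xi => (xi *m xi^T)%R) i j)%E]].

End Distributions.

(* The index k ranges over 'I_K.+1, so that the maximum is over a nonempty
   set; K.+1 plays the role of the number of quadratic pieces. *)
Section Programs.
Variables (R : realType) (m n K : nat).
Variable X : set 'cV[R]_m.
Variable A : 'I_K.+1 -> 'cV[R]_m -> 'M[R]_n.
Variable b : 'I_K.+1 -> 'cV[R]_m -> 'cV[R]_n.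
Variable c : 'I_K.+1 -> 'cV[R]_m -> R^o.
Variables (mu : 'cV[R]_n) (Sigma : 'M[R]_n).

Definition piece (x : 'cV[R]_m) (xi : 'cV[R]_n) (k : 'I_K.+1) : R :=
  (xi^T *m A k x *m xi) 0 0 + ((b k x)^T *m xi) 0 0 + c k x.

Definition max_piece (x : 'cV[R]_m) (xi : 'cV[R]_n) : R :=
  \big[Num.max/piece x xi ord0]_(k < K.+1) piece x xi k.

Definition dro_value : \bar R :=
  ereal_inf [set ereal_sup [set ('E_P[max_piece x : borel_vec R n -> R])%E
                           | P in ambiguity_set mu Sigma] | x in X].

Definition sdp_objective (y0 : R) (y : 'cV[R]_n) (Y : 'M[R]_n) : R :=
  y0 + (mu^T *m y) 0 0 + mxdot Sigma Y.

(* The symmetry of [Y] is part of [submodular Y]. *)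
Definition sdp_constraints (x : 'cV[R]_m) (y0 : R) (y : 'cV[R]_n)
    (Y : 'M[R]_n) (Z : 'I_K.+1 -> 'M[R]_n) : Prop :=
  [/\ X x, submodular Y, (forall k i j, 0 <= Z k i j)
    & forall k, psd (quad_mx y0 (y - (Z k)^T *m ones R n)
                       (Y + 2^-1 *: (Z k + (Z k)^T))
                     - quad_mx (c k x) (b k x) (A k x))].

(* The space of the decision variables (x, y0, y, Y, Z). *)
Definition sdp_var : vectType R :=
  ('cV[R]_m * R^o * 'cV[R]_n * 'M[R]_n * {ffun 'I_K.+1 -> 'M[R]_n})%type.

Definition sdp_feasible : set sdp_var :=
  [set v : sdp_var |
    let: (x, y0, y, Y, Z) := v in sdp_constraints x y0 y Y Z].

Definition sdp_value : \bar R :=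
  ereal_inf [set let: (x, y0, y, Y, Z) := v in (sdp_objective y0 y Y)%:E
            | v in sdp_feasible].

End Programs.

(* Main.v *)
(** Weak duality: on the box, [Z i j * (1 - v i) * v j >= 0], so a feasible
    (y0, y, Y, Z) majorizes every piece pointwise, and the submodularity of Y
    turns the bound on the second moments into a bound on the expectation.

    Exactness for n = 3: separating the (slightly shifted) constraint set of
    the SDP from the origin yields, for every piece k, a positive semidefinite
    moment matrix with entries [M i j <= min (x i) (x j)], and such that the
    piecewise objective is within [O(eta)] of the SDP value.  It remains to
    show that such a 4 x 4 moment matrix is dominated by the moments of a
    finitely supported measure on the cube with the same means and variances:
    the covariances f, e, d may be raised until they form a Pareto maximum.
    There, either every pair is at its Frechet bound and the measure is found
    by successive Schur complements, or the covariance matrix is singular and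
    the measure lives on a monotone line, or on a plane in which one pair of
    coordinates is at its Frechet bound and so follows an L-shaped path. *)
From HB Require Import structures.
Require Import Defs.
From mathcomp Require Import measurable_realfun ring lra zify.
Set Implicit Arguments.
Unset Strict Implicit.
Unset Printing Implicit Defensive.
Import Order.TTheory GRing.Theory Num.Theory.
Import numFieldNormedType.Exports.
Local Open Scope classical_set_scope.
Local Open Scope ring_scope.

(** * Finitely supported measures on the cube *)

Section Atoms.
Variable R : realFieldType.

(** The ambiguity set bounds the cross moments only from below, and every [A k x] has nonnegative
    off-diagonal entries for feasible x. A measure may therefore have larger covariances than the
    moment matrix it replaces, while its means and variances must match exactly. This is what allows
    the passage to a Pareto maximum. The gain there is rigidity: a covariance below both of its
    Frechet bounds can be raised until the determinant vanishes, so at a maximum it is tight or the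
    covariance matrix is singular, and each resulting geometry admits explicit atoms. On the dual
    side the functional splits into one block per piece. The blocks are read as unnormalized
    measures; gluing their atoms gives a mixture on whose k-th component the maximum is at least
    piece k. The multiplier [Z k i j] prices the moment of (1 - xi_i) xi_j, and its sign yields the
    Frechet bounds. Attainment and Slater points may fail, hence an approximation for every eta in
    place of exact duality. *)

Definition atom_ok (u : R * (R * R * R)) : bool :=
  [&& 0 <= u.1, 0 <= u.2.1.1 <= 1, 0 <= u.2.1.2 <= 1 & 0 <= u.2.2 <= 1].

(* Means [x1 x2 x3], variances [a b c]; [f], [e], [d] are lower bounds on the
   covariances of the coordinates (1, 2), (1, 3) and (2, 3). *)
Definition dominated (x1 x2 x3 a b c f e d : R) : Prop :=
  exists s : seq (R * (R * R * R)),
  [/\ all atom_ok s, \sum_(u <- s) u.1 = 1,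
    [/\ \sum_(u <- s) u.1 * u.2.1.1 = x1, \sum_(u <- s) u.1 * u.2.1.2 = x2
      & \sum_(u <- s) u.1 * u.2.2 = x3],
    [/\ \sum_(u <- s) u.1 * u.2.1.1 ^+ 2 = a + x1 ^+ 2,
        \sum_(u <- s) u.1 * u.2.1.2 ^+ 2 = b + x2 ^+ 2
      & \sum_(u <- s) u.1 * u.2.2 ^+ 2 = c + x3 ^+ 2]
  & [/\ f + x1 * x2 <= \sum_(u <- s) u.1 * (u.2.1.1 * u.2.1.2),
        e + x1 * x3 <= \sum_(u <- s) u.1 * (u.2.1.1 * u.2.2)
      & d + x2 * x3 <= \sum_(u <- s) u.1 * (u.2.1.2 * u.2.2)]].

Lemma dominated_swap12 (x1 x2 x3 a b c f e d : R) :
  dominated x1 x2 x3 a b c f e d -> dominated x2 x1 x3 b a c f d e.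
Proof.
move=> [s [oks s1 [m1 m2 m3] [v1 v2 v3] [c1 c2 c3]]].
exists [seq (u.1, (u.2.1.2, u.2.1.1, u.2.2)) | u <- s].
rewrite !big_map /=; split=> //; last first.
- split=> //; rewrite [x2 * _]mulrC.
  by under eq_bigr do rewrite [_.2.1.2 * _]mulrC.
- rewrite all_map; apply: sub_all oks => u /and4P[? ? ? ?]; exact/and4P.
Qed.

Lemma dominated_swap23 (x1 x2 x3 a b c f e d : R) :
  dominated x1 x2 x3 a b c f e d -> dominated x1 x3 x2 a c b e f d.
Proof.
move=> [s [oks s1 [m1 m2 m3] [v1 v2 v3] [c1 c2 c3]]].
exists [seq (u.1, (u.2.1.1, u.2.2, u.2.1.2)) | u <- s].
rewrite !big_map /=; split=> //; last first.
- split=> //; rewrite [x3 * _]mulrC.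
  by under eq_bigr do rewrite [_.2.2 * _]mulrC.
- rewrite all_map; apply: sub_all oks => u /and4P[? ? ? ?]; exact/and4P.
Qed.

Lemma dominated_le (x1 x2 x3 a b c f e d f' e' d' : R) :
  f <= f' -> e <= e' -> d <= d' ->
  dominated x1 x2 x3 a b c f' e' d' -> dominated x1 x2 x3 a b c f e d.
Proof.
move=> ff ee dd [s [oks s1 ms vs [c1 c2 c3]]].
exists s; split=> //; split; [apply: le_trans c1|apply: le_trans c2|
  apply: le_trans c3]; by rewrite lerD2r.
Qed.

(* Two points of a line, at parameters [- t] and [1 / t]: every centred pair
   of atoms with unit variance has this form. *)
Lemma dominated_line_at (t x1 x2 x3 d1 d2 d3 : R) : 0 < t ->
  0 <= x1 - t * d1 <= 1 -> 0 <= x1 + d1 / t <= 1 ->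
  0 <= x2 - t * d2 <= 1 -> 0 <= x2 + d2 / t <= 1 ->
  0 <= x3 - t * d3 <= 1 -> 0 <= x3 + d3 / t <= 1 ->
  dominated x1 x2 x3 (d1 ^+ 2) (d2 ^+ 2) (d3 ^+ 2) (d1 * d2) (d1 * d3) (d2 * d3).
Proof.
move=> t0 ? ? ? ? ? ?.
have tn0 : t != 0 by rewrite gt_eqF.
have q0 : 0 < 1 + t ^+ 2 by rewrite ltr_pwDl// sqr_ge0.
have qn0 : 1 + t ^+ 2 != 0 by rewrite gt_eqF.
exists [:: ((1 + t ^+ 2)^-1, (x1 - t * d1, x2 - t * d2, x3 - t * d3));
           (t ^+ 2 / (1 + t ^+ 2), (x1 + d1 / t, x2 + d2 / t, x3 + d3 / t))].
rewrite !big_cons !big_nil /=; split.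
- apply/and3P; split=> //; apply/and4P; split=> //=.
    by rewrite invr_ge0 ltW.
  by rewrite divr_ge0 ?sqr_ge0// ltW.
- by field.
- by split; field; rewrite tn0 qn0.
- by split; field; rewrite tn0 qn0.
- by split; rewrite le_eqVlt; apply/orP; left; apply/eqP; field; rewrite tn0 qn0.
Qed.

(** Take t = x1 / d1, which puts the lower atom on the face xi1 = 0. No other coordinate of it is
    negative, because [m2] and [m3] make x1 / d1 the least of the ratios; the upper atom stays below
    1 exactly by the Frechet bounds [h1], [h2], [h3]. *)
Lemma dominated_line_min (x1 x2 x3 d1 d2 d3 : R) : 0 < d1 -> 0 <= d2 -> 0 <= d3 ->
  0 <= x1 <= 1 -> 0 <= x2 <= 1 -> 0 <= x3 <= 1 ->
  x1 * d2 <= x2 * d1 -> x1 * d3 <= x3 * d1 ->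
  d1 * d1 <= x1 * (1 - x1) -> d1 * d2 <= x1 * (1 - x2) ->
  d1 * d3 <= x1 * (1 - x3) ->
  dominated x1 x2 x3 (d1 ^+ 2) (d2 ^+ 2) (d3 ^+ 2) (d1 * d2) (d1 * d3) (d2 * d3).
Proof.
move=> d10 d20 d30 x1b x2b x3b m2 m3 h1 h2 h3.
have x10 : 0 < x1.
  rewrite lt_neqAle; apply/andP; split; last by case/andP: x1b.
  apply/eqP => x1E; move: h1; rewrite -x1E mul0r leNgt mulr_gt0//.
have low x d' : 0 <= d' -> x1 * d' <= x * d1 -> 0 <= x <= 1 ->
    0 <= x - x1 / d1 * d' <= 1.
  move=> d'0 xd /andP[? x_le1]; apply/andP; split.
    by rewrite subr_ge0 mulrAC ler_pdivrMr.
  rewrite lerBlDr (le_trans x_le1)// lerDl mulr_ge0// divr_ge0// ltW//.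
have up x d' : 0 <= d' -> d1 * d' <= x1 * (1 - x) -> 0 <= x <= 1 ->
    0 <= x + d' / (x1 / d1) <= 1.
  move=> d'0 xd /andP[x_ge0 ?]; apply/andP; split.
    by rewrite addr_ge0// divr_ge0// divr_ge0// ltW.
  rewrite addrC -lerBrDr invf_div mulrA ler_pdivrMr// [d' * _]mulrC.
  by rewrite [leRHS]mulrC.
apply: (@dominated_line_at (x1 / d1)).
- exact: divr_gt0.
- by apply: low => //; exact: ltW.
- by apply: up => //; exact: ltW.
- exact: low.
- exact: up.
- exact: low.
- exact: up.
Qed.

(** The coordinate with the least ratio x / d among those with d > 0 takes the place of the first
    one. If every d vanishes, both atoms collapse to the mean. *)
Lemma dominated_line (x1 x2 x3 d1 d2 d3 : R) : 0 <= d1 -> 0 <= d2 -> 0 <= d3 ->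
  0 <= x1 <= 1 -> 0 <= x2 <= 1 -> 0 <= x3 <= 1 ->
  d1 * d1 <= x1 * (1 - x1) -> d2 * d2 <= x2 * (1 - x2) ->
  d3 * d3 <= x3 * (1 - x3) ->
  d1 * d2 <= x1 * (1 - x2) -> d1 * d2 <= x2 * (1 - x1) ->
  d1 * d3 <= x1 * (1 - x3) -> d1 * d3 <= x3 * (1 - x1) ->
  d2 * d3 <= x2 * (1 - x3) -> d2 * d3 <= x3 * (1 - x2) ->
  dominated x1 x2 x3 (d1 ^+ 2) (d2 ^+ 2) (d3 ^+ 2) (d1 * d2) (d1 * d3) (d2 * d3).
Proof.
move=> d10 d20 d30 x1b x2b x3b h11 h22 h33 h12 h21 h13 h31 h23 h32.
have [x10 x20 x30] : [/\ 0 <= x1, 0 <= x2 & 0 <= x3].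
  by case/andP: x1b; case/andP: x2b; case/andP: x3b.
have case1 : 0 < d1 -> x1 * d2 <= x2 * d1 -> x1 * d3 <= x3 * d1 -> _ :=
  fun p q r => dominated_line_min p d20 d30 x1b x2b x3b q r h11 h12 h13.
have case2 : 0 < d2 -> x2 * d1 <= x1 * d2 -> x2 * d3 <= x3 * d2 ->
    dominated x1 x2 x3 (d1 ^+ 2) (d2 ^+ 2) (d3 ^+ 2) (d1 * d2) (d1 * d3) (d2 * d3).
  move=> p q r; apply: dominated_swap12; rewrite [d1 * d2]mulrC.
  by apply: dominated_line_min => //; rewrite mulrC.
have case3 : 0 < d3 -> x3 * d1 <= x1 * d3 -> x3 * d2 <= x2 * d3 ->
    dominated x1 x2 x3 (d1 ^+ 2) (d2 ^+ 2) (d3 ^+ 2) (d1 * d2) (d1 * d3) (d2 * d3).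
  move=> p q r; apply: dominated_swap23; apply: dominated_swap12.
  rewrite [d1 * d3]mulrC [d2 * d3]mulrC.
  by apply: dominated_line_min => //; rewrite mulrC.
have [e1|d1p] := eqVneq d1 0; have [e2|d2p] := eqVneq d2 0;
  have [e3|d3p] := eqVneq d3 0.
- subst; apply: (@dominated_line_at 1) => //;
  by rewrite ?mulr0 ?mul0r ?subr0 ?addr0.
- have d3g : 0 < d3 by rewrite lt_neqAle eq_sym d3p.
  by apply: case3; rewrite // ?e1 ?e2 mulr0 mulr_ge0.
- have d2g : 0 < d2 by rewrite lt_neqAle eq_sym d2p.
  by apply: case2; rewrite // ?e1 ?e3 mulr0 mulr_ge0.
- have d2g : 0 < d2 by rewrite lt_neqAle eq_sym d2p.
  have d3g : 0 < d3 by rewrite lt_neqAle eq_sym d3p.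
  have [l|/ltW l] := leP (x2 * d3) (x3 * d2).
    by apply: case2; rewrite // ?e1 mulr0 mulr_ge0.
  by apply: case3; rewrite // ?e1 mulr0 mulr_ge0.
- have d1g : 0 < d1 by rewrite lt_neqAle eq_sym d1p.
  by apply: case1; rewrite // ?e2 ?e3 mulr0 mulr_ge0.
- have d1g : 0 < d1 by rewrite lt_neqAle eq_sym d1p.
  have d3g : 0 < d3 by rewrite lt_neqAle eq_sym d3p.
  have [l|/ltW l] := leP (x1 * d3) (x3 * d1).
    by apply: case1; rewrite // ?e2 mulr0 mulr_ge0.
  by apply: case3; rewrite // ?e2 mulr0 mulr_ge0.
- have d1g : 0 < d1 by rewrite lt_neqAle eq_sym d1p.
  have d2g : 0 < d2 by rewrite lt_neqAle eq_sym d2p.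
  have [l|/ltW l] := leP (x1 * d2) (x2 * d1).
    by apply: case1; rewrite // ?e3 mulr0 mulr_ge0.
  by apply: case2; rewrite // ?e3 mulr0 mulr_ge0.
- have d1g : 0 < d1 by rewrite lt_neqAle eq_sym d1p.
  have d2g : 0 < d2 by rewrite lt_neqAle eq_sym d2p.
  have d3g : 0 < d3 by rewrite lt_neqAle eq_sym d3p.
  (* Transitivity of the comparison of ratios u / v, with denominators cleared. *)
  have tr u1 u2 u3 v1 v2 v3 : 0 < v1 -> 0 < v2 -> 0 < v3 ->
      u1 * v2 <= u2 * v1 -> u2 * v3 <= u3 * v2 -> u1 * v3 <= u3 * v1 :> R.
    move=> v10 v20 v30 p q; rewrite -(ler_pM2r v20).
    have := ler_wpM2r (ltW v30) p; have := ler_wpM2r (ltW v10) q; lra.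
  have [l12|/ltW l12] := leP (x1 * d2) (x2 * d1).
    have [l|/ltW l] := leP (x1 * d3) (x3 * d1); first exact: case1.
    apply: case3 => //; exact: (tr _ x1 _ _ d1 _).
  have [l|/ltW l] := leP (x2 * d3) (x3 * d2); first exact: case2.
  apply: case3 => //; exact: (tr _ x2 _ _ d2 _).
Qed.

(* When [f] is at its Frechet bound, [xi1 > 0] forces [xi2 = 1].  One atom
   carries [xi1 > 0]; what remains is carried by the edge [xi1 = 0], along which
   xi3 is affine in xi2. *)
Lemma dominated_tight (x1 x2 x3 a b c f e d al be : R) : 0 < a -> 0 < b ->
  0 <= al -> 0 <= be -> 0 <= x1 <= 1 -> 0 <= x2 <= 1 -> 0 <= x3 <= 1 ->
  f = x1 * (1 - x2) -> f ^+ 2 <= a * b -> 0 <= e ->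
  e = al * a + be * f -> d = al * f + be * b -> c = al * e + be * d ->
  a <= x1 * (1 - x1) -> b <= x2 * (1 - x2) ->
  e <= x1 * (1 - x3) -> d <= x3 * (1 - x2) ->
  dominated x1 x2 x3 a b c f e d.
Proof.
move=> a0 b0 al0 be0 x1b x2b x3b fE fab e0 eE dE cE h1 h2 h13 h32.
have [[x1g x1l] [x2g x2l] [x3g x3l]] :
    [/\ 0 <= x1 /\ x1 <= 1, 0 <= x2 /\ x2 <= 1 & 0 <= x3 /\ x3 <= 1].
  by split; apply/andP.
have x1p : 0 < x1.
  rewrite lt_neqAle x1g andbT; apply/eqP => z; move: h1.
  by rewrite -z mul0r leNgt a0.
have y2p : 0 < 1 - x2.
  rewrite lt_neqAle subr_ge0 x2l andbT; apply/eqP => z; move: h2.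
  by rewrite -z mulr0 leNgt b0.
have Ap : 0 < a + x1 ^+ 2 by rewrite ltr_wpDr ?sqr_ge0.
have Dp : 0 < b + (1 - x2) ^+ 2 by rewrite ltr_wpDr ?sqr_ge0.
(* The support lies on the plane xi3 = al xi1 + be xi2 + ga, above the path formed by the edges xi2
   = 1 and xi1 = 0. A mass [w] at xi1 = [r] reproduces the first two moments of xi1; [w0] and [t0]
   do the same for 1 - xi2. *)
pose ga := x3 - al * x1 - be * x2.
pose w := x1 ^+ 2 / (a + x1 ^+ 2).
pose w0 := (1 - x2) ^+ 2 / (b + (1 - x2) ^+ 2).
pose r := (a + x1 ^+ 2) / x1.
pose rho := (e + x1 * x3) / x1.
pose t0 := (x2 - (b + x2 ^+ 2)) / (1 - x2).
have x1n : x1 != 0 by rewrite gt_eqF.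
have y2n : 1 - x2 != 0 by rewrite gt_eqF.
have An : a + x1 ^+ 2 != 0 by rewrite gt_eqF.
have Dn : b + (1 - x2) ^+ 2 != 0 by rewrite gt_eqF.
have rg : 0 <= r by rewrite divr_ge0// ltW.
have rl : r <= 1 by rewrite ler_pdivrMr//; lra.
have rhoE : rho = al * r + be + ga.
  by rewrite /rho /r /ga eE fE; field.
have rhog : 0 <= rho by rewrite divr_ge0// addr_ge0// mulr_ge0.
have rhol : rho <= 1 by rewrite ler_pdivrMr//; lra.
have t0g : 0 <= t0 by rewrite divr_ge0//; lra.
have t0l : t0 <= 1 by rewrite ler_pdivrMr//; move: (sqr_ge0 (1 - x2)); lra.
have low : 0 <= be * t0 + ga.
  have -> : be * t0 + ga = (x3 * (1 - x2) - d) / (1 - x2).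
    by rewrite /t0 /ga dE fE; field.
  by rewrite divr_ge0// ?subr_ge0// ltW.
have up : be + ga <= 1.
  by apply: le_trans rhol; rewrite rhoE -addrA lerDr mulr_ge0.
have bt : be * t0 <= be by rewrite ler_piMr.
have w0g : 0 <= w0 by rewrite divr_ge0 ?sqr_ge0// ltW.
have wg : 0 <= w by rewrite divr_ge0 ?sqr_ge0// ltW.
(* The corner xi1 = 0, xi2 = 1 gets the remaining mass, which is nonnegative by the Cauchy-Schwarz
   bound [fab]. *)
have wwg : 0 <= 1 - w - w0.
  have -> : 1 - w - w0 =
      (a * b - f ^+ 2) / ((a + x1 ^+ 2) * (b + (1 - x2) ^+ 2)).
    by rewrite /w /w0 fE; field; rewrite Dn An.
  by rewrite divr_ge0 ?subr_ge0// mulr_ge0// ltW.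
have bg0 : 0 <= be + ga by lra.
have bt1 : be * t0 + ga <= 1 by lra.
exists [:: (w, (r, 1, rho)); (1 - w - w0, (0, 1, be + ga));
           (w0, (0, t0, be * t0 + ga))].
rewrite !big_cons !big_nil /=; split.
- by rewrite /atom_ok /= wg rg rl rhog rhol wwg bg0 up w0g t0g t0l low bt1 !lexx ler01.
- by ring.
- by split; rewrite ?rhoE /r /w /w0 /t0 /ga; field; rewrite ?Dn ?An ?x1n ?y2n.
- by split; rewrite ?cE ?dE ?eE ?fE ?rhoE /r /w /w0 /t0 /ga; field;
    rewrite ?Dn ?An ?x1n ?y2n.
- by split; rewrite le_eqVlt; apply/orP; left; apply/eqP;
    rewrite ?cE ?dE ?eE ?fE ?rhoE /r /w /w0 /t0 /ga; field;
    rewrite ?Dn ?An ?x1n ?y2n.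
Qed.

(* All pairs are at their Frechet bounds; the atoms are read off the successive
   Schur complements of the moment matrix. *)
Lemma dominated_comonotone (x1 x2 x3 a b c f e d : R) : 0 < a -> 0 <= b ->
  0 <= x1 -> x1 <= x2 -> x2 <= x3 -> x3 <= 1 ->
  f = x1 * (1 - x2) -> e = x1 * (1 - x3) -> d = x2 * (1 - x3) ->
  f ^+ 2 < a * b ->
  0 < a * b * c + 2 * d * e * f - a * d ^+ 2 - b * e ^+ 2 - c * f ^+ 2 ->
  a <= x1 * (1 - x1) -> b <= x2 * (1 - x2) -> c <= x3 * (1 - x3) ->
  dominated x1 x2 x3 a b c f e d.
Proof.
move=> a0 b0 x1g x12 x23 x3l fE eE dE fab det0 h1 h2 h3.
have x1p : 0 < x1.
  rewrite lt_neqAle x1g andbT; apply/eqP => z; move: h1.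
  by rewrite -z mul0r leNgt a0.
have x1n : x1 != 0 by rewrite gt_eqF.
have Ap : 0 < a + x1 ^+ 2 by rewrite ltr_wpDr ?sqr_ge0.
have An : a + x1 ^+ 2 != 0 by rewrite gt_eqF.
(* One atom with xi2 = xi3 = 1 reproduces both moments of xi1. [P] and [Q] are the second and first
   moments of xi2 that remain once it is removed; the next atom matches these in the same way. *)
pose w := x1 ^+ 2 / (a + x1 ^+ 2).
pose r := (a + x1 ^+ 2) / x1.
pose P := b + x2 ^+ 2 - w.
pose Q := x2 - w.
have aP : a * P = (a + x1 ^+ 2) * Q ^+ 2 + (a * b - f ^+ 2).
  by rewrite /P /Q /w fE; field.
have Pp : 0 < P.
  rewrite -(pmulr_rgt0 _ a0) aP ltr_wpDl ?subr_gt0// mulr_ge0 ?sqr_ge0//.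
  exact: ltW.
have Pn : P != 0 by rewrite gt_eqF.
have PQ : P <= Q by rewrite /P /Q; lra.
have Qp : 0 < Q by exact: lt_le_trans PQ.
have Qn : Q != 0 by rewrite gt_eqF.
pose w2 := Q ^+ 2 / P.
pose r2 := P / Q.
pose m := 1 - w - w2.
have mP : m = (a * b - f ^+ 2) / ((a + x1 ^+ 2) * P).
  apply: (mulIf Pn); rewrite invfM mulrA mulfVK//.
  rewrite /m /w2 mulrBl mulfVK// /P /Q /w fE; field.
  by rewrite An.
have mp : 0 < m by rewrite mP divr_gt0 ?subr_gt0// mulr_gt0.
(* First and second moments of xi3 left after two atoms with xi3 = 1. The last Schur complement
   [m * V - U ^+ 2] is the determinant divided by positive pivots, which makes the mass left for the
   origin nonnegative. *)
pose U := x3 - w - w2.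
pose V := c + x3 ^+ 2 - w - w2.
have UV : V <= U by rewrite /U /V; lra.
have mVU : m * V - U ^+ 2 =
    (a * b * c + 2 * d * e * f - a * d ^+ 2 - b * e ^+ 2 - c * f ^+ 2)
    / ((a + x1 ^+ 2) * P).
  apply: (mulIf Pn); rewrite invfM mulrA mulfVK//.
  have -> : (m * V - U ^+ 2) * P =
     ((1 - w) * P - Q ^+ 2) * (c + x3 ^+ 2 - w)
     - (x3 - w) ^+ 2 * P + 2 * (x3 - w) * Q ^+ 2 - (1 - w) * Q ^+ 2.
    by rewrite /m /V /U /w2; field.
  by rewrite /P /Q /w dE eE fE; field.
have mVUp : 0 < m * V - U ^+ 2 by rewrite mVU divr_gt0// mulr_gt0.
have Vp : 0 < V.
  rewrite -(pmulr_rgt0 _ mp); move: mVUp; rewrite subr_gt0; apply: le_lt_trans.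
  exact: sqr_ge0.
have Up : 0 < U by exact: lt_le_trans UV.
have [Un Vn] : U != 0 /\ V != 0 by rewrite !gt_eqF.
have wg : 0 <= w by rewrite divr_ge0 ?sqr_ge0// ltW.
have w2g : 0 <= w2 by rewrite divr_ge0 ?sqr_ge0// ltW.
have w3g : 0 <= U ^+ 2 / V by rewrite divr_ge0 ?sqr_ge0// ltW.
have w4g : 0 <= m - U ^+ 2 / V.
  by rewrite subr_ge0 ler_pdivrMr// -subr_ge0 ltW.
have rg : 0 <= r by rewrite divr_ge0// ltW.
have rl : r <= 1 by rewrite ler_pdivrMr//; lra.
have r2g : 0 <= r2 by rewrite divr_ge0// ltW.
have r2l : r2 <= 1 by rewrite ler_pdivrMr// mul1r.
have r3g : 0 <= V / U by rewrite divr_ge0// ltW.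
have r3l : V / U <= 1 by rewrite ler_pdivrMr// mul1r.
exists [:: (w, (r, 1, 1)); (w2, (0, r2, 1)); (U ^+ 2 / V, (0, 0, V / U));
           (m - U ^+ 2 / V, (0, 0, 0))].
have wr : w * r = x1 by rewrite /w /r; field; rewrite ?x1n ?An.
have wr2 : w * r ^+ 2 = a + x1 ^+ 2 by rewrite /w /r; field; rewrite x1n An.
have w2r : w2 * r2 = Q by rewrite /w2 /r2; field; rewrite ?Pn ?Qn.
have w2r2 : w2 * r2 ^+ 2 = P by rewrite /w2 /r2; field; rewrite ?Pn ?Qn.
have w3r : U ^+ 2 / V * (V / U) = U by field; rewrite ?Un ?Vn.
have w3r2 : U ^+ 2 / V * (V / U) ^+ 2 = V by field; rewrite ?Un ?Vn.
rewrite !big_cons !big_nil /= !expr0n !expr1n /= !mul0r ?mulr0 ?mul1r ?mulr1.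
rewrite !addr0 ?add0r; split.
- by rewrite /atom_ok /= wg rg rl w2g r2g r2l w3g r3g r3l w4g !lexx ler01.
- by rewrite /m; ring.
- by rewrite wr w2r w3r /U /Q; split; ring.
- by rewrite wr2 w2r2 w3r2 /P /V; split; ring.
- by rewrite wr w2r /Q fE eE dE; split; lra.
Qed.

End Atoms.

(** * Pareto maximal covariances *)

Section Admissible.
Variable R : rcfType.

Definition det3 (a b c f e d : R) : R :=
  a * b * c + 2 * d * e * f - a * d ^+ 2 - b * e ^+ 2 - c * f ^+ 2.

(** Positive semidefiniteness of the covariance matrix is expressed by its principal minors: all
    conditions are weak polynomial inequalities, so they are closed and survive permutations of the
    coordinates. *)
Record admissible (x1 x2 x3 a b c f e d : R) : Prop := Admissible {
  adm_x1 : 0 <= x1 <= 1; adm_x2 : 0 <= x2 <= 1; adm_x3 : 0 <= x3 <= 1;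
  adm_a0 : 0 <= a; adm_b0 : 0 <= b; adm_c0 : 0 <= c;
  adm_a : a <= x1 * (1 - x1); adm_b : b <= x2 * (1 - x2);
  adm_c : c <= x3 * (1 - x3);
  adm_f12 : f <= x1 * (1 - x2); adm_f21 : f <= x2 * (1 - x1);
  adm_e13 : e <= x1 * (1 - x3); adm_e31 : e <= x3 * (1 - x1);
  adm_d23 : d <= x2 * (1 - x3); adm_d32 : d <= x3 * (1 - x2);
  adm_ab : f ^+ 2 <= a * b; adm_ac : e ^+ 2 <= a * c; adm_bc : d ^+ 2 <= b * c;
  adm_det : 0 <= det3 a b c f e d }.

(** Maximality is tested on the sum, so a maximizer of the sum over a compact set qualifies at
    once. *)
Definition maximal (x1 x2 x3 a b c f e d : R) : Prop :=
  admissible x1 x2 x3 a b c f e d /\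
  forall f' e' d', f <= f' -> e <= e' -> d <= d' ->
    admissible x1 x2 x3 a b c f' e' d' -> f' + e' + d' <= f + e + d.

Lemma admissible_swap12 (x1 x2 x3 a b c f e d : R) :
  admissible x1 x2 x3 a b c f e d -> admissible x2 x1 x3 b a c f d e.
Proof.
case=> *; split=> //; first by rewrite mulrC.
have -> : det3 b a c f d e = det3 a b c f e d by rewrite /det3; ring.
by [].
Qed.

Lemma admissible_swap23 (x1 x2 x3 a b c f e d : R) :
  admissible x1 x2 x3 a b c f e d -> admissible x1 x3 x2 a c b e f d.
Proof.
case=> *; split=> //; first by rewrite mulrC.
have -> : det3 a c b e f d = det3 a b c f e d by rewrite /det3; ring.
by [].
Qed.

Lemma maximal_swap12 (x1 x2 x3 a b c f e d : R) :
  maximal x1 x2 x3 a b c f e d -> maximal x2 x1 x3 b a c f d e.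
Proof.
case=> adm mx; split; first exact: admissible_swap12.
move=> f' e' d' ff ee dd /admissible_swap12 adm'.
by have := mx _ _ _ ff dd ee adm'; lra.
Qed.

Lemma maximal_swap23 (x1 x2 x3 a b c f e d : R) :
  maximal x1 x2 x3 a b c f e d -> maximal x1 x3 x2 a c b e f d.
Proof.
case=> adm mx; split; first exact: admissible_swap23.
move=> f' e' d' ff ee dd /admissible_swap23 adm'.
by have := mx _ _ _ ee ff dd adm'; lra.
Qed.

Lemma det3_schur (a b c f e d : R) :
  c * det3 a b c f e d = (a * c - e ^+ 2) * (b * c - d ^+ 2) - (f * c - e * d) ^+ 2.
Proof. by rewrite /det3; ring. Qed.

(** If a c > e^2, use (a c - e^2)(a b - f^2) = a det + (a d - e f)^2. If a c = e^2, [det3_schur]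
    forces f c = e d, and the bound on f follows from the one on d. *)
Lemma minor_of_det3 (a b c f e d : R) : 0 <= a -> 0 < c -> e ^+ 2 <= a * c ->
  d ^+ 2 <= b * c -> 0 <= det3 a b c f e d -> f ^+ 2 <= a * b.
Proof.
move=> a0 c0 ac bc D0.
have [acp|acp] := ltP (e ^+ 2) (a * c).
  rewrite -subr_ge0 -(pmulr_rge0 (x := a * c - e ^+ 2)) ?subr_gt0//.
  have -> : (a * c - e ^+ 2) * (a * b - f ^+ 2) =
     a * det3 a b c f e d + (a * d - e * f) ^+ 2 by rewrite /det3; ring.
  by rewrite addr_ge0 ?sqr_ge0// mulr_ge0.
have acE : a * c = e ^+ 2 by apply/le_anti; rewrite ac acp.
have : (f * c - e * d) ^+ 2 <= 0.
  by have := det3_schur a b c f e d; have := mulr_ge0 (ltW c0) D0; rewrite acE; lra.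
rewrite -[X in X <= 0]addr0 => h.
have /eqP : (f * c - e * d) ^+ 2 == 0.
  by rewrite eq_le sqr_ge0 andbT; move: h; rewrite addr0.
move/eqP; rewrite expf_eq0 /= subr_eq0 => /eqP fc.
have c2 : 0 < c ^+ 2 by rewrite exprn_gt0.
rewrite -(ler_pM2r c2) -exprMn fc exprMn -acE.
have := ler_wpM2l (mulr_ge0 a0 (ltW c0)) bc; lra.
Qed.

(* [c * det3 = (a c - e^2) (b c - d^2) - (f c - e d)^2]: f can be raised until
   [f c - e d] is the square root of the first product. *)
Lemma raise_entry (a b c f e d F : R) : 0 <= a -> 0 < c -> e ^+ 2 <= a * c ->
  d ^+ 2 <= b * c -> 0 <= det3 a b c f e d -> f < F ->
  ~ (0 <= f * c - e * d /\ det3 a b c f e d = 0) ->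
  exists f', [/\ f < f', f' <= F, f' ^+ 2 <= a * b & 0 <= det3 a b c f' e d].
Proof.
move=> a0 c0 ac bc D0 fF nblocked.
pose S := Num.sqrt ((a * c - e ^+ 2) * (b * c - d ^+ 2)).
have P0 : 0 <= (a * c - e ^+ 2) * (b * c - d ^+ 2).
  by rewrite mulr_ge0// subr_ge0.
have S0 : 0 <= S by exact: sqrtr_ge0.
have S2 : S ^+ 2 = (a * c - e ^+ 2) * (b * c - d ^+ 2) by rewrite sqr_sqrtr.
have fS : (f * c - e * d) ^+ 2 <= S ^+ 2.
  by rewrite S2 -subr_ge0 -det3_schur mulr_ge0// ltW.
have {fS} : `|f * c - e * d| <= S.
  by rewrite -ler_sqr ?nnegrE// -normrX ger0_norm ?sqr_ge0.
rewrite ler_norml => /andP[lo up].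
have fS : f * c - e * d < S.
  rewrite lt_neqAle up andbT; apply/eqP => fSE; apply: nblocked; split.
    by rewrite fSE.
  apply: (mulfI (lt0r_neq0 c0)).
  by rewrite mulr0 det3_schur fSE S2 subrr.
pose f' := Num.min F ((S + e * d) / c).
have ff' : f < f'.
  by rewrite lt_min fF ltr_pdivlMr//; lra.
have f'S : f' * c - e * d <= S.
  have : f' <= (S + e * d) / c by rewrite ge_min lexx orbT.
  by rewrite ler_pdivlMr//; lra.
have f'lo : - S <= f' * c - e * d.
  by apply: le_trans lo _; rewrite lerD2r ler_pM2r// ltW.
have D'0 : 0 <= det3 a b c f' e d.
  rewrite -(pmulr_rge0 _ c0) det3_schur -S2 subr_ge0.
  rewrite -[leLHS]ger0_norm ?sqr_ge0// normrX ler_sqr ?nnegrE//.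
  by rewrite ler_norml f'lo f'S.
exists f'; split=> //; first by rewrite ge_min lexx.
exact: minor_of_det3 D'0.
Qed.

(** Otherwise [raise_entry] increases f alone, keeping all conditions, against maximality. *)
Lemma maximal_blocked (x1 x2 x3 a b c f e d : R) :
  maximal x1 x2 x3 a b c f e d -> 0 < c ->
  f < x1 * (1 - x2) -> f < x2 * (1 - x1) ->
  0 <= f * c - e * d /\ det3 a b c f e d = 0.
Proof.
move=> [adm mx] c0 f12 f21.
have fF : f < Num.min (x1 * (1 - x2)) (x2 * (1 - x1)) by rewrite lt_min f12.
have [//|nb] := pselect (0 <= f * c - e * d /\ det3 a b c f e d = 0).
case: adm (adm) => *.
have [||||f' [ff' f'F ab' D']] :=  @raise_entry a b c f e d _ _ c0 _ _ _ fF nb => //.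
move: f'F; rewrite le_min => /andP[f'12 f'21].
have := mx f' e d (ltW ff') (lexx _) (lexx _).
have adm' : admissible x1 x2 x3 a b c f' e d by split.
by move=> /(_ adm'); lra.
Qed.

(* If f is negative then so is e or d, and both can be raised to zero. *)
Lemma maximal_ge0 (x1 x2 x3 a b c f e d : R) :
  maximal x1 x2 x3 a b c f e d -> 0 < b -> 0 < c -> 0 <= f.
Proof.
move=> mx b0 c0; rewrite leNgt; apply/negP => f0.
have [adm mx'] := mx.
have [[x1g x1l] [x2g x2l] [x3g x3l]] :
    [/\ 0 <= x1 /\ x1 <= 1, 0 <= x2 /\ x2 <= 1 & 0 <= x3 /\ x3 <= 1].
  by case: adm => *; split; apply/andP.
have q12 : 0 <= x1 * (1 - x2) by rewrite mulr_ge0// subr_ge0.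
have q21 : 0 <= x2 * (1 - x1) by rewrite mulr_ge0// subr_ge0.
have q13 : 0 <= x1 * (1 - x3) by rewrite mulr_ge0// subr_ge0.
have q31 : 0 <= x3 * (1 - x1) by rewrite mulr_ge0// subr_ge0.
have q23 : 0 <= x2 * (1 - x3) by rewrite mulr_ge0// subr_ge0.
have q32 : 0 <= x3 * (1 - x2) by rewrite mulr_ge0// subr_ge0.
have [fc _] := maximal_blocked mx c0 (lt_le_trans f0 q12) (lt_le_trans f0 q21).
have fc0 : f * c < 0 by rewrite pmulr_llt0.
have ed0 : e * d < 0 by lra.
case: adm => ? ? ? a0 ? ? ? ? ? ? ? ? ? ? ? ab ac bc D0.
have abp : 0 <= a * b by rewrite mulr_ge0// ltW.
have acp : 0 <= a * c by rewrite mulr_ge0// ltW.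
have [e0|e0] := ltP e 0.
  have d0 : 0 < d by rewrite -(nmulr_rlt0 _ e0).
  suff adm' : admissible x1 x2 x3 a b c 0 0 d.
    by have := mx' _ _ _ (ltW f0) (ltW e0) (lexx d) adm'; lra.
  split=> //; rewrite ?expr0n //=.
  have -> : det3 a b c 0 0 d = a * (b * c - d ^+ 2) by rewrite /det3; ring.
  by rewrite mulr_ge0// subr_ge0.
have d0 : d < 0.
  by rewrite ltNge; apply/negP => d0; move: ed0; rewrite ltNge mulr_ge0.
suff adm' : admissible x1 x2 x3 a b c 0 e 0.
  by have := mx' _ _ _ (ltW f0) (lexx e) (ltW d0) adm'; lra.
split=> //; rewrite ?expr0n //=; first by rewrite mulr_ge0 ?ltW.
have -> : det3 a b c 0 e 0 = b * (a * c - e ^+ 2) by rewrite /det3; ring.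
by rewrite mulr_ge0 ?subr_ge0 // ltW.
Qed.

(** The three equations put (al, be, -1) in the kernel of the covariance matrix: xi3 is affine in
    xi1 and xi2. Whichever Frechet bound on f is attained, exchanging the first two coordinates, and
    with them al and be, reduces to [dominated_tight]. *)
Lemma dominated_dependent (x1 x2 x3 a b c f e d al be : R) :
  admissible x1 x2 x3 a b c f e d -> 0 < a -> 0 < b ->
  x1 * (1 - x2) <= f \/ x2 * (1 - x1) <= f -> 0 <= e -> 0 <= d ->
  0 <= al -> 0 <= be ->
  e = al * a + be * f -> d = al * f + be * b -> c = al * e + be * d ->
  dominated x1 x2 x3 a b c f e d.
Proof.
move=> adm; have [] := adm.
move=> ? ? ? ? ? ? ? ? ? f12 f21 ? ? ? ? ab *.
have [tight|tight] : x1 * (1 - x2) <= f \/ x2 * (1 - x1) <= f by [].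
  apply: (@dominated_tight _ _ _ _ _ _ _ _ _ _ al be) => //.
  by apply/le_anti; rewrite f12.
apply: dominated_swap12.
apply: (@dominated_tight _ _ _ _ _ _ _ _ _ _ be al) => //; last 3 first.
- by rewrite addrC.
- by rewrite addrC.
- by rewrite addrC.
- by apply/le_anti; rewrite f21.
- by rewrite mulrC.
Qed.

(** A nonzero determinant blocks nothing, so every covariance reaches a Frechet bound; for ordered
    means the smaller bound of a pair i < j is x_i (1 - x_j). *)
Lemma maximal_comonotone (x1 x2 x3 a b c f e d : R) :
  maximal x1 x2 x3 a b c f e d -> 0 < a -> 0 < b -> 0 < c ->
  det3 a b c f e d != 0 -> x1 <= x2 -> x2 <= x3 ->
  dominated x1 x2 x3 a b c f e d.
Proof.
move=> mx a0 b0 c0 Dn0 x12 x23.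
have fE : f = x1 * (1 - x2).
  apply/eqP; rewrite eq_le; have [adm _] := mx.
  rewrite (adm_f12 adm) /= leNgt; apply/negP => f12.
  have f21 : f < x2 * (1 - x1) by lra.
  by have [_ D0] := maximal_blocked mx c0 f12 f21; rewrite D0 eqxx in Dn0.
have eE : e = x1 * (1 - x3).
  have mx' := maximal_swap23 mx; apply/eqP; rewrite eq_le; have [adm _] := mx.
  rewrite (adm_e13 adm) /= leNgt; apply/negP => e13.
  have e31 : e < x3 * (1 - x1) by lra.
  have [_ D0] := maximal_blocked mx' b0 e13 e31.
  by move: Dn0; rewrite -D0 /det3; apply/negP; rewrite negbK; apply/eqP; ring.
have dE : d = x2 * (1 - x3).
  have mx' := maximal_swap23 (maximal_swap12 mx).
  apply/eqP; rewrite eq_le; have [adm _] := mx.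
  rewrite (adm_d23 adm) /= leNgt; apply/negP => d23.
  have d32 : d < x3 * (1 - x2) by lra.
  have [_ D0] := maximal_blocked mx' a0 d23 d32.
  by move: Dn0; rewrite -D0 /det3; apply/negP; rewrite negbK; apply/eqP; ring.
have [adm _] := mx; have Dp : 0 < det3 a b c f e d.
  by rewrite lt_neqAle eq_sym Dn0 (adm_det adm).
apply: dominated_comonotone => //.
- exact: ltW.
- by case/andP: (adm_x1 adm).
- by case/andP: (adm_x3 adm).
- have acp : 0 < a * c - e ^+ 2.
    rewrite lt_neqAle subr_ge0 (adm_ac adm) andbT; apply/eqP => ac.
    have := det3_schur a b c f e d; have := mulr_gt0 c0 Dp.
    by have := sqr_ge0 (f * c - e * d); rewrite -ac mul0r; lra.
  rewrite -subr_gt0 -(pmulr_rgt0 _ acp).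
  have -> : (a * c - e ^+ 2) * (a * b - f ^+ 2) =
     a * det3 a b c f e d + (a * d - e * f) ^+ 2 by rewrite /det3; ring.
  by rewrite ltr_wpDr ?sqr_ge0// mulr_gt0.
- exact: adm_a adm.
- exact: adm_b adm.
- exact: adm_c adm.
Qed.

Lemma det3_swap12 (a b c f e d : R) : det3 b a c f d e = det3 a b c f e d.
Proof. by rewrite /det3; ring. Qed.

Lemma det3_swap23 (a b c f e d : R) : det3 a c b e f d = det3 a b c f e d.
Proof. by rewrite /det3; ring. Qed.

Lemma maximal_nonsingular (x1 x2 x3 a b c f e d : R) :
  maximal x1 x2 x3 a b c f e d -> 0 < a -> 0 < b -> 0 < c ->
  det3 a b c f e d != 0 -> dominated x1 x2 x3 a b c f e d.
Proof.
wlog x12 : x1 x2 x3 a b c f e d / x1 <= x2.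
  move=> H mx a0 b0 c0 Dn; have [l|/ltW l] := leP x1 x2; first exact: H.
  apply: dominated_swap12; apply: H => //; first exact: maximal_swap12.
  by rewrite det3_swap12.
move=> mx a0 b0 c0 Dn; have [x23|/ltW x32] := leP x2 x3.
  exact: maximal_comonotone.
apply: dominated_swap23; have mx' := maximal_swap23 mx.
rewrite -det3_swap23 in Dn.
have [x13|/ltW x31] := leP x1 x3; first exact: maximal_comonotone.
apply: dominated_swap12; apply: maximal_comonotone => //.
  exact: maximal_swap12.
by rewrite det3_swap12.
Qed.

End Admissible.

(** * Maximal covariances with a singular or degenerate matrix *)

Section Singular.
Variable R : rcfType.

Lemma maximal_ge0s (x1 x2 x3 a b c f e d : R) :
  maximal x1 x2 x3 a b c f e d -> 0 < a -> 0 < b -> 0 < c ->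
  [/\ 0 <= f, 0 <= e & 0 <= d].
Proof.
move=> mx a0 b0 c0; split; first exact: maximal_ge0 mx b0 c0.
  exact: maximal_ge0 (maximal_swap23 mx) c0 b0.
exact: maximal_ge0 (maximal_swap23 (maximal_swap12 mx)) c0 a0.
Qed.

(* The kernel of the covariance matrix has sign pattern (+, +, -), so xi3 is a
   nondecreasing affine function of xi1 and xi2. *)
Lemma maximal_neg_cofactor (x1 x2 x3 a b c f e d : R) :
  maximal x1 x2 x3 a b c f e d -> 0 < a -> 0 < b -> 0 < c ->
  det3 a b c f e d = 0 -> f * c - e * d < 0 ->
  dominated x1 x2 x3 a b c f e d.
Proof.
move=> mx a0 b0 c0 D0 g12.
have [f0 e0 d0] := maximal_ge0s mx a0 b0 c0.
have [adm _] := mx.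
(* [maximal_blocked] needs a nonnegative f c - e d, so here only a Frechet bound can stop f. *)
have tight : x1 * (1 - x2) <= f \/ x2 * (1 - x1) <= f.
  have [|f12] := leP (x1 * (1 - x2)) f; first by left.
  have [|f21] := leP (x2 * (1 - x1)) f; first by right.
  by have [] := maximal_blocked mx c0 f12 f21; lra.
have gg : 0 < (f * c - e * d) ^+ 2 by rewrite exprn_even_gt0//= lt_eqF.
have A12 : (a * c - e ^+ 2) * (b * c - d ^+ 2) = (f * c - e * d) ^+ 2.
  by apply/eqP; rewrite -subr_eq0 -det3_schur D0 mulr0.
have A1 : 0 < b * c - d ^+ 2.
  rewrite lt_neqAle subr_ge0 (adm_bc adm) andbT; apply/eqP => z.
  by move: gg; rewrite -A12 -z mulr0 ltxx.
have A2 : 0 < a * c - e ^+ 2.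
  rewrite lt_neqAle subr_ge0 (adm_ac adm) andbT; apply/eqP => z.
  by move: gg; rewrite -A12 -z mul0r ltxx.
have fg : f * (f * c - e * d) <= 0 by rewrite mulr_ge0_le0// ltW.
(* Expansion of the vanishing determinant: a (b c - d^2) is positive and equals f (f c - e d) + e (e
   b - f d), whose first term is nonpositive. The next step expands along the second row. *)
have g13 : 0 < e * b - f * d.
  have : 0 < e * (e * b - f * d).
    have : a * (b * c - d ^+ 2) =
        det3 a b c f e d + f * (f * c - e * d) + e * (e * b - f * d).
      by rewrite /det3; ring.
    by have := mulr_gt0 a0 A1; rewrite D0; lra.
  by move=> h; rewrite ltNge; apply/negP => n; move: h; rewrite ltNge mulr_ge0_le0.
have g23 : 0 < d * a - f * e.
  have : 0 < d * (d * a - f * e).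
    have : b * (a * c - e ^+ 2) =
        det3 a b c f e d + f * (f * c - e * d) + d * (d * a - f * e).
      by rewrite /det3; ring.
    by have := mulr_gt0 b0 A2; rewrite D0; lra.
  by move=> h; rewrite ltNge; apply/negP => n; move: h; rewrite ltNge mulr_ge0_le0.
have A3 : 0 < a * b - f ^+ 2.
  rewrite -(pmulr_rgt0 _ A1).
  have -> : (b * c - d ^+ 2) * (a * b - f ^+ 2) =
     b * det3 a b c f e d + (e * b - f * d) ^+ 2 by rewrite /det3; ring.
  by rewrite D0 mulr0 add0r exprn_even_gt0//= gt_eqF.
have A3n : a * b - f ^+ 2 != 0 by rewrite gt_eqF.
apply: (@dominated_dependent _ _ _ _ _ _ _ _ _ _
   ((e * b - f * d) / (a * b - f ^+ 2)) ((d * a - f * e) / (a * b - f ^+ 2)) adm) => //.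
- by rewrite divr_ge0// ltW.
- by rewrite divr_ge0// ltW.
- by field.
- by field.
- apply: (mulIf A3n).
  have -> : c * (a * b - f ^+ 2) = det3 a b c f e d +
     ((e * b - f * d) * e + (d * a - f * e) * d) by rewrite /det3; ring.
  by rewrite D0; field.
Qed.

(* Here xi2 is an increasing affine function of xi1, so that e and d can be
   raised together. *)
Lemma maximal_collinear (x1 x2 x3 a b c f e d : R) :
  maximal x1 x2 x3 a b c f e d -> 0 < a -> 0 < b -> 0 < c ->
  det3 a b c f e d = 0 -> 0 < f * c - e * d -> 0 <= e * b - f * d ->
  0 <= d * a - f * e -> 0 < b * c - d ^+ 2 ->
  dominated x1 x2 x3 a b c f e d.
Proof.
move=> mx a0 b0 c0 D0 g12 g13 g23 A1.
have [f0 e0 d0] := maximal_ge0s mx a0 b0 c0.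
have [adm mx'] := mx.
have an : a != 0 by rewrite gt_eqF.
(* A relation between cofactors of a singular matrix: two nonnegative products add up to d times the
   determinant, that is to 0. *)
have g13E : e * b - f * d = 0.
  apply/le_anti; rewrite g13 andbT leNgt; apply/negP => g13p.
  have : (f * c - e * d) * (e * b - f * d) + (b * c - d ^+ 2) * (d * a - f * e)
      = d * det3 a b c f e d by rewrite /det3; ring.
  have := mulr_gt0 g12 g13p; have := mulr_ge0 (ltW A1) g23.
  by rewrite D0 mulr0; lra.
have abE : f ^+ 2 = a * b.
  apply/esym/eqP; rewrite -subr_eq0 -(mulrI_eq0 _ (mulfI (lt0r_neq0 A1))).
  have -> : (b * c - d ^+ 2) * (a * b - f ^+ 2) =
     b * det3 a b c f e d + (e * b - f * d) ^+ 2 by rewrite /det3; ring.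
  by rewrite D0 g13E mulr0 expr0n addr0.
have fp : 0 < f.
  rewrite lt_neqAle f0 andbT; apply/eqP => z; have := mulr_gt0 a0 b0.
  by rewrite -abE -z expr0n ltxx.
have fn : f != 0 by rewrite gt_eqF.
have bn : b != 0 by rewrite gt_eqF.
have dE : d = f / a * e.
  apply: (mulIf fn); apply: (mulIf an).
  have -> : f / a * e * f * a = f ^+ 2 * e by field.
  by rewrite abE; move/eqP: g13E; rewrite subr_eq0 => /eqP gE; rewrite [d * f]mulrC -gE; ring.
have bE : b = f / a * f.
  by apply: (mulIf an); rewrite mulrC -abE; field.
have aE : a = f / b * f.
  by apply: (mulIf bn); rewrite -abE; field.
have al0 : 0 <= f / a by rewrite divr_ge0// ltW.
have be0 : 0 <= f / b by rewrite divr_ge0// ltW.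
have eE : e = f / b * d.
  by apply: (mulIf bn); rewrite mulrAC mulfVK//; lra.
(* Coordinate 2 is the dependent one, with slope f / a in xi1; the pair (1, 3) runs along the
   L-shaped path. *)
have tight13 : x1 * (1 - x3) <= e \/ x3 * (1 - x1) <= e ->
    dominated x1 x2 x3 a b c f e d.
  move=> t; apply: dominated_swap23.
  apply: (@dominated_dependent _ _ _ _ _ _ _ _ _ _ (f / a) 0
    (admissible_swap23 adm)) => //; rewrite mul0r addr0//.
  by rewrite mulfVK.
have tight23 : x2 * (1 - x3) <= d \/ x3 * (1 - x2) <= d ->
    dominated x1 x2 x3 a b c f e d.
  move=> t; apply: dominated_swap12; apply: dominated_swap23.
  apply: (@dominated_dependent _ _ _ _ _ _ _ _ _ _ (f / b) 0
    (admissible_swap23 (admissible_swap12 adm))) => //; rewrite mul0r addr0//.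
  by rewrite mulfVK.
have [?|e13] := leP (x1 * (1 - x3)) e; first by apply: tight13; left.
have [?|e31] := leP (x3 * (1 - x1)) e; first by apply: tight13; right.
have [?|d23] := leP (x2 * (1 - x3)) d; first by apply: tight23; left.
have [?|d32] := leP (x3 * (1 - x2)) d; first by apply: tight23; right.
exfalso.
have A2 : 0 < a * c - e ^+ 2.
  rewrite -(pmulr_rgt0 _ A1) mulrC.
  have -> : (a * c - e ^+ 2) * (b * c - d ^+ 2) = (f * c - e * d) ^+ 2.
    by apply/eqP; rewrite -subr_eq0 -det3_schur D0 mulr0.
  by rewrite exprn_even_gt0//= gt_eqF.
have ac0 : 0 <= a * c by rewrite mulr_ge0// ltW.
have es : e < Num.sqrt (a * c).
  rewrite -ltr_sqr ?nnegrE ?sqrtr_ge0// sqr_sqrtr//.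
  by rewrite -subr_gt0.
(* The largest e allowed by its own Frechet bounds, by its minor, and by the Frechet bounds on d,
   when d moves along as [f / a * e]. The determinant stays 0 along this motion since f^2 = a b, so
   a strict increase contradicts maximality. *)
pose e' := Num.min (Num.min (x1 * (1 - x3)) (x3 * (1 - x1)))
  (Num.min (Num.sqrt (a * c))
     (Num.min (x2 * (1 - x3) / (f / a)) (x3 * (1 - x2) / (f / a)))).
have fap : 0 < f / a by rewrite divr_gt0.
have ee' : e < e'.
  rewrite !lt_min e13 e31 es /= (ltr_pdivlMr _ _ fap) (ltr_pdivlMr _ _ fap).
  by rewrite [e * _]mulrC -dE d23 d32.
have [h1 [h2 [h3 [h4 h5]]]] : e' <= x1 * (1 - x3) /\ e' <= x3 * (1 - x1) /\
   e' <= Num.sqrt (a * c) /\ f / a * e' <= x2 * (1 - x3) /\ f / a * e' <= x3 * (1 - x2).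
  have : e' <= e' by [].
  rewrite {2}/e' !le_min !(ler_pdivlMr _ _ fap) [e' * _]mulrC.
  by move=> /andP[/andP[-> ->]] /andP[-> /andP[-> ->]].
have e'0 : 0 <= e' by rewrite ltW// (le_lt_trans e0).
have e'2 : e' ^+ 2 <= a * c by rewrite -(sqr_sqrtr ac0) ler_sqr ?nnegrE ?sqrtr_ge0.
have dd' : d <= f / a * e' by rewrite dE ler_wpM2l// ltW.
suff adm' : admissible x1 x2 x3 a b c f e' (f / a * e').
  by have := mx' _ _ _ (lexx f) (ltW ee') dd' adm'; lra.
case: adm => *; split=> //.
  have -> : (f / a * e') ^+ 2 = f ^+ 2 * e' ^+ 2 / a ^+ 2 by field.
  rewrite abE ler_pdivrMr ?exprn_gt0//.
  by have := ler_wpM2l (mulr_ge0 (ltW a0) (ltW b0)) e'2; lra.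
have -> : det3 a b c f e' (f / a * e') =
   (a * b - f ^+ 2) * c - (a * b - f ^+ 2) * e' ^+ 2 / a.
  by rewrite /det3; field.
by rewrite abE subrr !mul0r subrr.
Qed.

(** The cases follow the signs of the three off-diagonal cofactors. A negative one gives a monotone
    plane. If all are nonnegative, either some 2 x 2 principal minor is positive, which leads to two
    collinear coordinates, or the covariance matrix has rank one. *)
Lemma maximal_singular (x1 x2 x3 a b c f e d : R) :
  maximal x1 x2 x3 a b c f e d -> 0 < a -> 0 < b -> 0 < c ->
  det3 a b c f e d = 0 -> dominated x1 x2 x3 a b c f e d.
Proof.
move=> mx a0 b0 c0 D0.
have [g12|g12] := ltP (f * c - e * d) 0; first exact: maximal_neg_cofactor.
have [g13|g13] := ltP (e * b - f * d) 0.
  apply: dominated_swap23; apply: maximal_neg_cofactor => //.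
    exact: maximal_swap23.
  by rewrite det3_swap23.
have [g23|g23] := ltP (d * a - f * e) 0.
  apply: dominated_swap12; apply: dominated_swap23; apply: maximal_neg_cofactor => //.
    exact/maximal_swap23/maximal_swap12.
  by rewrite det3_swap23 det3_swap12.
have case1 (y1 y2 y3 a' b' c' f' e' d' : R) :
    maximal y1 y2 y3 a' b' c' f' e' d' -> 0 < a' -> 0 < b' -> 0 < c' ->
    det3 a' b' c' f' e' d' = 0 -> 0 <= f' * c' - e' * d' ->
    0 <= e' * b' - f' * d' -> 0 <= d' * a' - f' * e' -> 0 < b' * c' - d' ^+ 2 ->
    dominated y1 y2 y3 a' b' c' f' e' d'.
  move=> mx' a'0 b'0 c'0 D'0 g12' g13' g23' A1.
  have [f0 e0 d0] := maximal_ge0s mx' a'0 b'0 c'0.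
  have [g12p|g12n] := ltP 0 (f' * c' - e' * d'); first exact: maximal_collinear.
  (* By the expansion of a' (b' c' - d'^2), which is positive, the two cofactors of the first row
     cannot both vanish; exchanging coordinates 2 and 3 swaps them. *)
  have g13p : 0 < e' * b' - f' * d'.
    rewrite lt_neqAle g13' andbT; apply/eqP => z.
    have : a' * (b' * c' - d' ^+ 2) = det3 a' b' c' f' e' d'
        + f' * (f' * c' - e' * d') + e' * (e' * b' - f' * d').
      by rewrite /det3; ring.
    rewrite D'0 -z (le_anti (introT andP (conj g12n g12'))) !mulr0 !addr0.
    by move/eqP; rewrite gt_eqF// mulr_gt0.
  rewrite -det3_swap23 in D'0; rewrite [f' * e']mulrC in g23'.
  rewrite [b' * c']mulrC in A1.
  apply: dominated_swap23.
  exact: maximal_collinear (maximal_swap23 mx') a'0 c'0 b'0 D'0 g13p g12' g23' A1.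
have [adm _] := mx; have [f0 e0 d0] := maximal_ge0s mx a0 b0 c0.
have [A1|A1] := ltP 0 (b * c - d ^+ 2); first exact: case1.
have [A2|A2] := ltP 0 (a * c - e ^+ 2).
  rewrite -det3_swap12 in D0; rewrite [e * d]mulrC in g12.
  apply: dominated_swap12.
  exact: case1 (maximal_swap12 mx) b0 a0 c0 D0 g12 g23 g13 A2.
have [A3|A3] := ltP 0 (a * b - f ^+ 2).
  rewrite -det3_swap23 -det3_swap12 in D0; rewrite [f * e]mulrC in g23.
  rewrite [f * d]mulrC in g13.
  apply: dominated_swap23; apply: dominated_swap12.
  exact: case1 (maximal_swap12 (maximal_swap23 mx)) c0 a0 b0 D0 g13 g23 g12 A3.
(* Rank one: the square roots of the variances give the direction of the line carrying the
   measure. *)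
have bcE : d ^+ 2 = b * c by have := adm_bc adm; lra.
have acE : e ^+ 2 = a * c by have := adm_ac adm; lra.
have abE : f ^+ 2 = a * b by have := adm_ab adm; lra.
have sE (u v w : R) : 0 <= u -> 0 <= v -> 0 <= w -> w ^+ 2 = u * v ->
    w = Num.sqrt u * Num.sqrt v.
  move=> u0 v0 w0 wE; rewrite -sqrtrM// -wE sqrtr_sqr ger0_norm//.
have fE := sE _ _ _ (ltW a0) (ltW b0) f0 abE.
have eE := sE _ _ _ (ltW a0) (ltW c0) e0 acE.
have dE := sE _ _ _ (ltW b0) (ltW c0) d0 bcE.
have := @dominated_line R x1 x2 x3 (Num.sqrt a) (Num.sqrt b) (Num.sqrt c).
rewrite -!expr2 (sqr_sqrtr (ltW a0)) (sqr_sqrtr (ltW b0)) (sqr_sqrtr (ltW c0)).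
rewrite -fE -eE -dE.
by move=> H; case: adm => *; apply: H => //; exact: sqrtr_ge0.
Qed.

(** Zero variance makes xi1 constant and its covariances 0, so only d is left to raise. It stops
    either at a Frechet bound, where xi1 is the dependent coordinate with zero slopes, or at sqrt (b
    c), where the measure lives on a line. *)
Lemma admissible_degenerate (x1 x2 x3 a b c f e d : R) :
  admissible x1 x2 x3 a b c f e d -> a = 0 -> dominated x1 x2 x3 a b c f e d.
Proof.
move=> adm aE; subst a.
have fE : f = 0.
  have := adm_ab adm; rewrite mul0r => h; apply/eqP.
  by rewrite -(sqrf_eq0 f) eq_le h sqr_ge0.
have eE : e = 0.
  have := adm_ac adm; rewrite mul0r => h; apply/eqP.
  by rewrite -(sqrf_eq0 e) eq_le h sqr_ge0.
subst f e.
have bc0 : 0 <= b * c by rewrite mulr_ge0// ?(adm_b0 adm)// (adm_c0 adm).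
pose d' := Num.min (Num.min (x2 * (1 - x3)) (x3 * (1 - x2))) (Num.sqrt (b * c)).
have dd' : d <= d'.
  rewrite !le_min (adm_d23 adm) (adm_d32 adm) /=.
  rewrite (le_trans (ler_norm d))// -sqrtr_sqr ler_wsqrtr//.
  exact: adm_bc adm.
have [h1 [h2 h3]] : d' <= x2 * (1 - x3) /\ d' <= x3 * (1 - x2) /\
   d' <= Num.sqrt (b * c).
  have : d' <= d' by [].
  by rewrite {2}/d' !le_min => /andP[/andP[-> ->] ->].
have d'0 : 0 <= d'.
  rewrite !le_min sqrtr_ge0 andbT; case: adm => _ /andP[? ?] /andP[? ?] *.
  by rewrite !mulr_ge0// subr_ge0.
have d'2 : d' ^+ 2 <= b * c by rewrite -(sqr_sqrtr bc0) ler_sqr ?nnegrE ?sqrtr_ge0.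
apply: (dominated_le (lexx _) (lexx _) dd').
have adm' : admissible x1 x2 x3 0 b c 0 0 d'.
  have := adm; case=> *; split; rewrite ?expr0n ?mul0r //=.
  have -> : det3 0 b c 0 0 d' = 0 by rewrite /det3; ring.
  exact: lexx.
have [lt|ge] := ltP d' (Num.sqrt (b * c)).
  have bcp : 0 < b * c by rewrite -sqrtr_gt0 (le_lt_trans d'0).
  have bn : b != 0 by apply/eqP => z; move: bcp; rewrite z mul0r ltxx.
  have cn : c != 0 by apply/eqP => z; move: bcp; rewrite z mulr0 ltxx.
  have bp : 0 < b by rewrite lt_neqAle eq_sym bn (adm_b0 adm).
  have cp : 0 < c by rewrite lt_neqAle eq_sym cn (adm_c0 adm).
  apply: dominated_swap12; apply: dominated_swap23.
  apply: (@dominated_dependent _ _ _ _ _ _ _ _ _ _ 0 0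
    (admissible_swap23 (admissible_swap12 adm'))); rewrite ?mul0r ?addr0 //.
  have : Num.min (x2 * (1 - x3)) (x3 * (1 - x2)) <= d'.
    rewrite leNgt; apply/negP => lt'.
    have : d' < d' by rewrite {2}/d' lt_min lt' lt.
    by rewrite ltxx.
  by rewrite ge_min => /orP[]; [left|right].
have d'E : d' = Num.sqrt b * Num.sqrt c.
  by rewrite -sqrtrM ?(adm_b0 adm)//; apply/le_anti; rewrite h3.
have := @dominated_line R x1 x2 x3 0 (Num.sqrt b) (Num.sqrt c).
rewrite -!expr2 !sqr_sqrtr ?(adm_b0 adm)// ?(adm_c0 adm)// -d'E !mul0r expr0n /=.
by move=> H; case: adm' => *; apply: H => //; exact: sqrtr_ge0.
Qed.

Lemma dominated_maximal (x1 x2 x3 a b c f e d : R) :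
  maximal x1 x2 x3 a b c f e d -> dominated x1 x2 x3 a b c f e d.
Proof.
move=> mx; have [adm _] := mx.
have [a0|an] := eqVneq a 0; first exact: admissible_degenerate.
have [b0|bn] := eqVneq b 0.
  apply: dominated_swap12; apply: admissible_degenerate => //.
  exact: admissible_swap12.
have [c0|cn] := eqVneq c 0.
  apply: dominated_swap23; apply: dominated_swap12.
  apply: admissible_degenerate => //; exact/admissible_swap12/admissible_swap23.
have [ap bp cp] : [/\ 0 < a, 0 < b & 0 < c].
  by rewrite !lt_neqAle ![0 == _]eq_sym an bn cn; case: adm.
have [D0|Dn] := eqVneq (det3 a b c f e d) 0; first exact: maximal_singular.
exact: maximal_nonsingular.
Qed.

End Singular.

(** * Continuity, closedness and the existence of a Pareto maximum *)

Section ContinuousReal.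
Variables (R : realType) (T : topologicalType).
Implicit Types f g : T -> R.

Lemma continuousD f g : continuous f -> continuous g ->
  continuous (fun z => f z + g z).
Proof. by move=> cf cg z; apply: cvgD; [exact: cf|exact: cg]. Qed.

Lemma continuousN f : continuous f -> continuous (fun z => - f z).
Proof. by move=> cf z; apply: cvgN; exact: cf. Qed.

Lemma continuousM f g : continuous f -> continuous g ->
  continuous (fun z => f z * g z).
Proof. by move=> cf cg z; apply: cvgM; [exact: cf|exact: cg]. Qed.

Lemma continuous_norm f : continuous f -> continuous (fun z => `|f z|).
Proof. by move=> cf z; apply: cvg_norm; exact: cf. Qed.

Lemma continuous_sum (I : Type) (s : seq I) (F : I -> T -> R) :
  (forall i, continuous (F i)) -> continuous (fun v => \sum_(i <- s) F i v).
Proof.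
move=> cF; elim: s => [|i s IH].
  under eq_fun do rewrite big_nil.
  exact: cst_continuous.
under eq_fun do rewrite big_cons.
exact: continuousD.
Qed.

Lemma continuous_maxr (f g : T -> R) : continuous f -> continuous g ->
  continuous (fun z => Num.max (f z) (g z)).
Proof. by move=> cf cg z; apply: continuous_max; [exact: cf|exact: cg]. Qed.

Lemma continuous_bigmax (I : Type) (s : seq I) (h : T -> R) (F : I -> T -> R) :
  continuous h -> (forall i, continuous (F i)) ->
  continuous (fun v => \big[Num.max/h v]_(i <- s) F i v).
Proof.
move=> ch cF; elim: s => [|i s IH].
  by under eq_fun do rewrite big_nil.
under eq_fun do rewrite big_cons.
exact: continuous_maxr.
Qed.

End ContinuousReal.

Lemma closed_ge_comp (R : realType) (T : topologicalType) (g : T -> R) :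
  continuous g -> closed [set z | 0 <= g z].
Proof.
by move=> cg; apply: (@preimage_closed T R g [set y | 0 <= y]) => [z _|];
  [exact: cg|exact: closed_ge].
Qed.

(** The admissible triples above (f, e, d) form a closed set, and the Frechet bounds enclose it in a
    product of segments. The sum attains its maximum there, and domination passes back down by
    [dominated_le]. *)
Lemma dominated_admissible (R : realType) (x1 x2 x3 a b c f e d : R) :
  admissible x1 x2 x3 a b c f e d -> dominated x1 x2 x3 a b c f e d.
Proof.
move=> adm.
pose S := [set z : R * R * R | [/\ f <= z.1.1, e <= z.1.2, d <= z.2
  & admissible x1 x2 x3 a b c z.1.1 z.1.2 z.2]].
have c1 : continuous (fun z : R * R * R => z.1.1).
  by move=> z; apply: (@continuous_comp _ _ _ fst fst); exact: cvg_fst.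
have c2 : continuous (fun z : R * R * R => z.1.2).
  by move=> z; apply: (@continuous_comp _ _ _ fst snd); [exact: cvg_fst|exact: cvg_snd].
have c3 : continuous (fun z : R * R * R => z.2) by move=> z; exact: cvg_snd.
have cst (k : R) : continuous (fun z : R * R * R => k) by move=> z; exact: cvg_cst.
have cD := @continuousD R (R * R * R)%type.
have cN := @continuousN R (R * R * R)%type.
have cM := @continuousM R (R * R * R)%type.
have clS : closed S.
  have cle (g h : R * R * R -> R) : continuous g -> continuous h ->
      closed [set z | g z <= h z].
    move=> cg ch; have := @closed_ge_comp R _ (fun z => h z + - g z) (cD _ _ ch (cN _ cg)).
    by congr closed; apply/funext => z /=; rewrite subr_ge0.
  have -> : S = [set z | f <= z.1.1] `&` [set z | e <= z.1.2] `&` [set z | d <= z.2]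
     `&` [set z | z.1.1 <= x1 * (1 - x2)] `&` [set z | z.1.1 <= x2 * (1 - x1)]
     `&` [set z | z.1.2 <= x1 * (1 - x3)] `&` [set z | z.1.2 <= x3 * (1 - x1)]
     `&` [set z | z.2 <= x2 * (1 - x3)] `&` [set z | z.2 <= x3 * (1 - x2)]
     `&` [set z | z.1.1 * z.1.1 <= a * b] `&` [set z | z.1.2 * z.1.2 <= a * c]
     `&` [set z | z.2 * z.2 <= b * c]
     `&` [set z | 0 <= a * b * c + 2 * z.2 * z.1.2 * z.1.1 + - (a * (z.2 * z.2))
              + - (b * (z.1.2 * z.1.2)) + - (c * (z.1.1 * z.1.1))].
    apply/seteqP; split=> z /=.
      by case=> ? ? ? []; rewrite /det3 ?expr2 => *; do !split.
    rewrite -!expr2; do 12! case; move=> *.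
    by split=> //; case: adm => *; split.
  have cq (k : R) (g : R * R * R -> R) : continuous g ->
      continuous (fun z : R * R * R => - (k * (g z * g z))).
    by move=> cg; exact: cN _ (cM _ _ (cst k) (cM _ _ cg cg)).
  have cdet := cD _ _ (cD _ _ (cD _ _ (cD _ _ (cst (a * b * c))
    (cM _ _ (cM _ _ (cM _ _ (cst 2) c3) c2) c1)) (cq a _ c3)) (cq b _ c2)) (cq c _ c1).
  have cl (k : R) g : continuous g -> closed [set z : R * R * R | g z <= k].
    by move=> cg; exact: (cle _ _ cg (cst k)).
  have cg (k : R) g : continuous g -> closed [set z : R * R * R | k <= g z].
    by move=> cg; exact: (cle _ _ (cst k) cg).
  do 12! (apply: closedI; last by [apply: cg|apply: cl => //; exact: cM]).
  exact: cg.
pose T := `[f, x1 * (1 - x2)] `*` `[e, x1 * (1 - x3)] `*` `[d, x2 * (1 - x3)].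
have cT : compact T.
  by do 2?apply: compact_setX; exact: segment_compact.
have ST : S `<=` T.
  move=> z [? ? ? []] *; rewrite /T /setX /=; split; [split|]; by rewrite in_itv; apply/andP.
have cS := subclosed_compact clS cT ST.
have S0 : S !=set0 by exists (f, e, d).
have [[[f' e'] d'] /set_mem[/= ff ee dd adm'] mx] :=
  compact_EVT_max S0 cS (continuous_subspaceT (cD _ _ (cD _ _ c1 c2) c3)).
apply: (dominated_le ff ee dd); apply: dominated_maximal; split=> //.
move=> f2 e2 d2 h1 h2 h3 adm2; apply: (mx (f2, e2, d2)); apply/mem_set.
by split=> //=; [exact: le_trans h1|exact: le_trans h2|exact: le_trans h3].
Qed.

(** * Expectations over the box *)

Section BorelVec.
Variables (R : realType) (n : nat).
Implicit Types (f g : 'cV[R]_n -> R).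

Lemma open_measurable_vec (U : set 'cV[R]_n) :
  open U -> measurable (U : set (borel_vec R n)).
Proof. by move=> oU; exact: sub_sigma_algebra. Qed.

Lemma closed_measurable_vec (U : set 'cV[R]_n) :
  closed U -> measurable (U : set (borel_vec R n)).
Proof.
move=> cU; rewrite -(setCK U); apply: measurableC.
by apply: open_measurable_vec; exact: closed_openC.
Qed.

Lemma continuous_measurable_vec f :
  continuous f -> measurable_fun setT (f : borel_vec R n -> R).
Proof.
move=> /continuousP cf.
apply: (measurability _ (RGenOpens.measurableE R)) => _ [_ [a [b ->] <-]].
by rewrite setTI; apply: open_measurable_vec; apply: cf; exact: interval_open.
Qed.

Lemma trmx_continuous : continuous (fun v : 'rV[R]_n => v^T : 'cV[R]_n).
Proof.
move=> v S /nbhs_ballP[e e0 eS]; apply/nbhs_ballP; exists e => //= w [? vw].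
by apply: eS; split=> // i j; rewrite !mxE.
Qed.

Lemma cV_compact (A : 'I_n -> set R) : (forall i, compact (A i)) ->
  compact [set v : 'cV[R]_n | forall i, A i (v i 0)].
Proof.
move=> cA; have := continuous_compact (continuous_subspaceT trmx_continuous) (rV_compact cA).
congr compact; apply/seteqP; split=> [_ [v Av <-] i|v Av]; first by rewrite mxE.
by exists v^T; rewrite ?trmxK// => i; rewrite mxE.
Qed.

Lemma unit_box_compact : compact (@unit_box R n).
Proof.
have := @cV_compact (fun=> `[0, 1]%classic) (fun=> @segment_compact _ 0 1).
by congr compact; apply/seteqP; split=> v /= vb i; have := vb i; rewrite in_itv.
Qed.

(* Vanishes exactly on the box. *)
Definition gap (v : 'cV[R]_n) : R := \sum_i (`|v i 0| + `|1 - v i 0| - 1).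

Lemma gap_term_ge0 (v : 'cV[R]_n) i : 0 <= `|v i 0| + `|1 - v i 0| - 1.
Proof.
by rewrite subr_ge0 (le_trans _ (ler_normD _ _))// addrC subrK normr1.
Qed.

Lemma gap_continuous : continuous gap.
Proof.
apply: continuous_sum => i; apply: continuousD; last exact: cst_continuous.
apply: continuousD; apply: continuous_norm; first exact: coord_continuous.
apply: continuousD; first exact: cst_continuous.
by apply: continuousN; exact: coord_continuous.
Qed.

Lemma gap_box (v : 'cV[R]_n) : gap v <= 0 -> unit_box v.
Proof.
move=> gv i; have : `|v i 0| + `|1 - v i 0| - 1 <= 0.
  apply: le_trans gv; rewrite /gap (bigD1 i)//= lerDl sumr_ge0// => j _.
  exact: gap_term_ge0.
rewrite subr_le0 => h; apply/andP; split.
  have := ler_norm (1 - v i 0); have := ler_norm (- v i 0); rewrite normrN.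
  by move: h; case: (ler0P (v i 0)) => *; lra.
have := ler_norm (v i 0); have := normr_ge0 (1 - v i 0).
by have := ler_norm (v i 0 - 1); rewrite distrC; lra.
Qed.

(* The complement of the box is a countable union of compact sets, each
   covered by finitely many null open sets. *)
Lemma msupport_unit_box_null (P : probability (borel_vec R n) R) :
  msupport P `<=` @unit_box R n -> P (~` @unit_box R n) = 0%E.
Proof.
move=> sP; apply: measure_negligible.
  apply: measurableC; apply: closed_measurable_vec.
  apply: compact_closed; last exact: unit_box_compact.
  exact: norm_hausdorff.
pose C (k : nat) := [set v : 'cV[R]_n | forall i, v i 0 \in `[- k%:R, k%:R]]
   `&` [set v | k.+1%:R^-1 <= gap v].
have cC k : compact (C k).
  apply: compact_closedI.
    exact: (@cV_compact (fun=> `[- k%:R, k%:R]%classic) (fun=> @segment_compact _ _ _)).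
  apply: (@preimage_closed _ _ gap [set y | k.+1%:R^-1 <= y]).
    by move=> ? _; exact: gap_continuous.
  exact: closed_ge.
have nC k : (forall v, C k v -> ~ unit_box v) -> P.-negligible (C k).
  move=> Cbox; have := cC k; rewrite compact_cover.
  move=> /(_ (set 'cV[R]_n) [set V | open V /\ P V = 0%E] id)[].
  - by move=> V [].
  - move=> v Cv; have : ~ msupport P v by move=> /sP; exact: Cbox.
    move=> /existsNP[U /not_implyP[oU /not_implyP[Uv /negP]]].
    rewrite -leNgt => PU; exists U => //; split=> //.
    by apply/le_anti; rewrite PU measure_ge0.
  move=> D' D'0 CD'; apply: (@negligibleS _ (borel_vec R n) _ P _ _ CD').
  rewrite /cover bigcup_fset big_seq; elim/big_ind : _ => //.
  - exact: negligible_set0.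
  - by move=> *; exact: negligibleU.
  - move=> V VD; have := D'0 V VD; rewrite inE => -[oV PV].
    by exists V; split=> //; exact: open_measurable_vec.
apply: (@negligibleS _ (borel_vec R n) _ P (\bigcup_k C k)); last first.
  apply: negligible_bigcup => k; apply: nC => v [_ /= gv] bv.
  have : gap v = 0.
    rewrite /gap big1// => i _; have /andP[v0 v1] := bv i.
    by rewrite !ger0_norm ?subr_ge0//; ring.
  by move=> g0; move: gv; rewrite g0 leNgt invr_gt0 ltr0n.
move=> v nbv.
have gv : 0 < gap v by rewrite ltNge; apply/negP => /gap_box.
pose M := \sum_i `|v i 0|.
have M0 : 0 <= M by rewrite sumr_ge0.
exists (Num.bound (Num.max M (gap v)^-1)) => //.
have : Num.max M (gap v)^-1 < (Num.bound (Num.max M (gap v)^-1))%:R.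
  by apply: archi_boundP; rewrite le_max M0.
set k := Num.bound _; rewrite gt_max => /andP[Mk gk].
split=> [i|] /=.
  rewrite in_itv /= -ler_norml (le_trans _ (ltW Mk))// /M (bigD1 i)//= lerDl sumr_ge0//.
rewrite -[leRHS]invrK lef_pV2 ?posrE ?invr_gt0// (le_trans (ltW gk))//.
by rewrite ler_nat.
Qed.

End BorelVec.

Section Expectation.
Variables (R : realType) (n : nat) (P : probability (borel_vec R n) R).
Hypothesis sP : msupport P `<=` @unit_box R n.
Implicit Types f g : 'cV[R]_n -> R.

Let box := (@unit_box R n : set (borel_vec R n)).

Lemma measurable_unit_box : measurable (@unit_box R n : set (borel_vec R n)).
Proof.
apply: closed_measurable_vec; apply: compact_closed; last exact: unit_box_compact.
exact: norm_hausdorff.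
Qed.

Lemma integrable_box f : continuous f -> P.-integrable box (EFin \o f).
Proof.
move=> cf; apply: measurable_bounded_integrable.
- exact: measurable_unit_box.
- by rewrite (le_lt_trans (probability_le1 P measurable_unit_box)) ?ltry.
- apply: (measurable_funS measurableT) => //; exact: continuous_measurable_vec.
- have : compact (f @` @unit_box R n).
    by apply: continuous_compact; [exact: continuous_subspaceT|exact: unit_box_compact].
  move=> /compact_bounded[M [Mr MP]]; exists M; split=> // x /MP{}MP v bv.
  by apply: MP; exists v.
Qed.

(** A continuous function may be unbounded off the box, but that region is null. *)
Lemma integrable_continuous f : continuous f -> P.-integrable setT (EFin \o f).
Proof.
move=> cf; apply/(@negligible_integrable _ _ _ _ _ (~` box)) => //.
- by apply: measurableC; exact: measurable_unit_box.
- by apply/measurable_EFinP; exact: continuous_measurable_vec.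
- exact: msupport_unit_box_null.
- by rewrite setTD setCK; exact: integrable_box.
Qed.

Lemma Rintegral_box f : continuous f ->
  (\int[P]_x f x = \int[P]_(x in box) f x)%R.
Proof.
move=> cf; rewrite /Rintegral (@negligible_integral _ _ _ _ _ (~` box))//.
- by rewrite setTD setCK.
- by apply: measurableC; exact: measurable_unit_box.
- exact: integrable_continuous.
- exact: msupport_unit_box_null.
Qed.

Lemma expectation_continuous f : continuous f ->
  ('E_P[f : borel_vec R n -> R] = (\int[P]_x f x)%R%:E)%E.
Proof.
by move=> cf; rewrite unlock /Rintegral fineK//; apply: integrable_fin_num => //;
  exact: integrable_continuous.
Qed.

Lemma le_Rintegral_box f g : continuous f -> continuous g ->
  (forall v, unit_box v -> f v <= g v) ->
  (\int[P]_x f x <= \int[P]_x g x)%R.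
Proof.
move=> cf cg fg; rewrite !Rintegral_box//; apply: le_Rintegral => //.
- exact: measurable_unit_box.
- exact: integrable_box.
- exact: integrable_box.
Qed.

Lemma Rintegral_sum (I : Type) (s : seq I) (F : I -> 'cV[R]_n -> R) :
  (forall i, continuous (F i)) ->
  (\int[P]_x (\sum_(i <- s) F i x) = \sum_(i <- s) \int[P]_x F i x)%R.
Proof.
move=> cF; elim: s => [|i s IH].
  rewrite big_nil; under eq_Rintegral do rewrite big_nil.
  by rewrite Rintegral_cst// mul0r.
rewrite big_cons -IH; under eq_Rintegral do rewrite big_cons.
rewrite RintegralD//; first exact: integrable_continuous.
by apply: integrable_continuous; exact: continuous_sum.
Qed.

End Expectation.

(** * Finitely supported probability measures *)

Section DiscreteProbability.
Variables (R : realType) (n : nat).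

(** The absolute value supplies a nonnegative scalar for an arbitrary list; it disappears once the
    weights are known to be nonnegative. *)
Let wdirac (s : seq (R * 'cV[R]_n)) (i : nat) :
    {measure set (borel_vec R n) -> \bar R} :=
  mscale (NngNum (normr_ge0 (nth 0 s i).1))
    (dirac ((nth 0 s i).2 : borel_vec R n)).

Lemma discrete_probability (s : seq (R * 'cV[R]_n)) :
  all (fun a => 0 <= a.1) s -> \sum_(a <- s) a.1 = 1 ->
  exists P : probability (borel_vec R n) R,
    [/\ (forall U : set (borel_vec R n), measurable U ->
          (forall a, a \in s -> ~ U a.2) -> P U = 0%E)
      & forall f : 'cV[R]_n -> R, continuous f ->
          ('E_P[f : borel_vec R n -> R] = (\sum_(a <- s) a.1 * f a.2)%R%:E)%E].
Proof.
move=> s0 s1.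
have wdE i U : wdirac s i U =
    (`|(nth 0%R s i).1|%R%:E * \d_((nth 0%R s i).2%R : borel_vec R n) U)%E by [].
have wE i : (i < size s)%N -> `|(nth 0 s i).1| = (nth 0 s i).1.
  by move=> si; rewrite ger0_norm//; apply: (allP s0); exact: mem_nth.
pose m : {measure set (borel_vec R n) -> \bar R} := msum (wdirac s) (size s).
have mT : m setT = 1%E.
  have -> : m setT = (\sum_(i < size s) wdirac s i setT)%E by [].
  under eq_bigr => i _ do rewrite wdE diracT mule1 wE//.
  by rewrite sumEFin -[in RHS]s1 (big_nth 0) big_mkord.
pose P : probability (borel_vec R n) R :=
  HB.pack (m : set (borel_vec R n) -> \bar R) m (Measure_isProbability.Build _ _ _ m mT).
exists P; split.
  move=> U mU sU.
  have -> : P U = (\sum_(i < size s) wdirac s i U)%E by [].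
  rewrite big1// => i _; rewrite wdE diracE memNset ?mule0//.
  by apply: sU; exact: mem_nth.
move=> f cf; have mf : measurable_fun setT (EFin \o (f : borel_vec R n -> R)).
  by apply/measurable_EFinP; exact: continuous_measurable_vec.
(* Integration against a sum of measures is first computed for nonnegative functions. The
   expectation then follows from positive and negative parts, as max(t, 0) - max(- t, 0) = t. *)
have pos (g : borel_vec R n -> \bar R) : measurable_fun setT g ->
    (forall x, 0 <= g x)%E ->
    (\int[P]_x g x = \sum_(i < size s) (nth 0%R s i).1%:E * g (nth 0%R s i).2)%E.
  move=> mg g0; rewrite [LHS](@ge0_integral_measure_sum _ _ _ (wdirac s) setT)//.
  apply: eq_bigr => i _; rewrite ge0_integral_mscale// integral_dirac//.
  by rewrite diracT mul1e /= wE.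
rewrite unlock integralE (pos _ (measurable_funepos mf))//.
rewrite (pos _ (measurable_funeneg mf))//.
rewrite (big_nth 0) big_mkord -sumEFin.
have -> : (\sum_(i < size s) (nth 0%R s i).1%:E * (EFin \o f)^\- (nth 0%R s i).2)%E =
  (\sum_(i < size s) (nth 0 s i).1 * Num.max (- f (nth 0 s i).2) 0)%:E.
  by rewrite -sumEFin; apply: eq_bigr => i _; rewrite EFinM EFin_max funenegE.
have -> : (\sum_(i < size s) (nth 0%R s i).1%:E * (EFin \o f)^\+ (nth 0%R s i).2)%E =
  (\sum_(i < size s) (nth 0 s i).1 * Num.max (f (nth 0 s i).2) 0)%:E.
  by rewrite -sumEFin; apply: eq_bigr => i _; rewrite EFinM EFin_max funeposE.
rewrite -EFinB -sumrB sumEFin; congr EFin; apply: eq_bigr => i _.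
rewrite -mulrBr; congr (_ * _).
set t := f _; rewrite !maxEle oppr_le0.
by case: (lerP t 0) => t0; case: (lerP 0 t) => t1; lra.
Qed.

End DiscreteProbability.

(** * Quadratic functions and their homogenized matrices *)

Section Forms.
Variables (R : realType) (n : nat).
Implicit Types (A Y Z : 'M[R]_n) (b v mu : 'cV[R]_n) (c : R).

Lemma qformE A v :
  (v^T *m A *m v) 0 0 = \sum_i \sum_j A i j * (v i 0 * v j 0).
Proof.
rewrite mxE exchange_big /=; apply: eq_bigr => j _.
rewrite mxE big_distrl /=; apply: eq_bigr => i _.
by rewrite !mxE; ring.
Qed.

Lemma dotE b v : (b^T *m v) 0 0 = \sum_i b i 0 * v i 0.
Proof. by rewrite mxE; apply: eq_bigr => i _; rewrite mxE. Qed.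

Lemma outerE v i j : (v *m v^T) i j = v i 0 * v j 0.
Proof. by rewrite mxE big_ord1 mxE. Qed.

Lemma mxdotE (A Y : 'M[R]_n) : mxdot A Y = \sum_i \sum_j Y i j * A i j.
Proof.
rewrite /mxdot /mxtrace exchange_big /=; apply: eq_bigr => j _.
by rewrite mxE; apply: eq_bigr => i _; rewrite mxE mulrC.
Qed.

Definition quadratic c b A v : R :=
  c + \sum_i b i 0 * v i 0 + \sum_i \sum_j A i j * (v i 0 * v j 0).

Definition homog v : 'cV[R]_(1 + n) := col_mx 1%:M v.

Lemma quadraticE c b A v :
  ((homog v)^T *m quad_mx c b A *m homog v) 0 0 = quadratic c b A v.
Proof.
rewrite /homog /quad_mx tr_col_mx mul_row_block mul_row_col trmx1 !mul1mx !mulmx1.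
rewrite mulmxDl -!scalemxAr -scalemxAl mxE [X in X + _]mxE [X in _ + X]mxE.
rewrite qformE /quadratic addrA; congr (_ + _).
rewrite !mxE eqxx mulr1n -addrA; congr (_ + _).
have -> : \sum_j v^T 0 j * b j 0 = \sum_i b i 0 * v i 0.
  by apply: eq_bigr => i _; rewrite mxE mulrC.
have -> : \sum_j b^T 0 j * v j 0 = \sum_i b i 0 * v i 0.
  by apply: eq_bigr => i _; rewrite mxE.
by rewrite -mulrDl -mulr2n; field.
Qed.

Lemma psd_quadratic_le c b A c' b' A' v :
  psd (quad_mx c b A - quad_mx c' b' A') ->
  quadratic c' b' A' v <= quadratic c b A v.
Proof.
move=> [_ /(_ (homog v))]; rewrite mulmxBr mulmxBl mxE [X in _ + X]mxE.
by rewrite !quadraticE subr_ge0.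
Qed.

Lemma quadratic_continuous c b A : continuous (quadratic c b A).
Proof.
apply: continuousD; [apply: continuousD|].
- exact: cst_continuous.
- apply: continuous_sum => i; apply: continuousM; first exact: cst_continuous.
  exact: coord_continuous.
- apply: continuous_sum => i; apply: continuous_sum => j.
  apply: continuousM; first exact: cst_continuous.
  by apply: continuousM; exact: coord_continuous.
Qed.

(* On the box the bilinear terms [Z i j * (1 - v i) * v j] are nonnegative. *)
Lemma quadratic_multiplier_le c b A Z v : (forall i j, 0 <= Z i j) ->
  unit_box v ->
  quadratic c (b - Z^T *m ones R n) (A + 2^-1 *: (Z + Z^T)) v <= quadratic c b A v.
Proof.
move=> Z0 bv; have -> : quadratic c (b - Z^T *m ones R n)
    (A + 2^-1 *: (Z + Z^T)) v = quadratic c b A v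
    - \sum_i \sum_j Z i j * ((1 - v i 0) * v j 0).
  rewrite /quadratic.
  have -> : \sum_i (b - Z^T *m ones R n) i 0 * v i 0 =
      \sum_i b i 0 * v i 0 - \sum_i \sum_j Z i j * v j 0.
    rewrite [in RHS]exchange_big /= -sumrB; apply: eq_bigr => j _.
    rewrite 3!mxE mulrBl; congr (_ - _).
    by rewrite big_distrl /=; apply: eq_bigr => i _; rewrite !mxE mulr1.
  have -> : \sum_i \sum_j (A + 2^-1 *: (Z + Z^T)) i j * (v i 0 * v j 0) =
     \sum_i \sum_j A i j * (v i 0 * v j 0) + \sum_i \sum_j Z i j * (v i 0 * v j 0).
    transitivity (\sum_i \sum_j A i j * (v i 0 * v j 0) +
      2^-1 * (\sum_i \sum_j Z i j * (v i 0 * v j 0)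
              + \sum_i \sum_j Z j i * (v i 0 * v j 0))).
      rewrite -big_split /= big_distrr -big_split /=; apply: eq_bigr => i _.
      rewrite -big_split /= big_distrr -big_split /=; apply: eq_bigr => j _.
      by rewrite !mxE; ring.
    congr (_ + _); rewrite [X in _ + X]exchange_big /=.
    have -> : \sum_j \sum_i Z j i * (v i 0 * v j 0) =
      \sum_i \sum_j Z i j * (v i 0 * v j 0).
      by apply: eq_bigr => i _; apply: eq_bigr => j _; ring.
    by field.
  have -> : \sum_i \sum_j Z i j * ((1 - v i 0) * v j 0) =
      \sum_i \sum_j Z i j * v j 0 - \sum_i \sum_j Z i j * (v i 0 * v j 0).
    rewrite -sumrB; apply: eq_bigr => i _; rewrite -sumrB.
    by apply: eq_bigr => j _; ring.
  by ring.
rewrite gerBl; apply: sumr_ge0 => i _; apply: sumr_ge0 => j _.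
have /andP[? ?] := bv i; have /andP[? ?] := bv j.
by rewrite !mulr_ge0// subr_ge0.
Qed.

End Forms.

(** * Weak duality *)

Section UpperBound.
Variables (R : realType) (m n K : nat) (X : set 'cV[R]_m).
Variable A : 'I_K.+1 -> 'cV[R]_m -> 'M[R]_n.
Variable b : 'I_K.+1 -> 'cV[R]_m -> 'cV[R]_n.
Variable c : 'I_K.+1 -> 'cV[R]_m -> R^o.
Variables (mu : 'cV[R]_n) (Sigma : 'M[R]_n).

Lemma pieceE x xi k : piece A b c x xi k = quadratic (c k x) (b k x) (A k x) xi.
Proof. by rewrite /piece qformE dotE /quadratic; ring. Qed.

Lemma max_piece_continuous x : continuous (max_piece A b c x).
Proof.
apply: (@continuous_bigmax _ _ _ _ (fun v => piece A b c x v ord0)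
  (fun k v => piece A b c x v k)) => [|k];
  by under eq_fun do rewrite pieceE; exact: quadratic_continuous.
Qed.

Lemma max_piece_le x xi t : (forall k, piece A b c x xi k <= t) ->
  max_piece A b c x xi <= t.
Proof. by move=> h; apply/bigmax_leP; split=> [|k _]. Qed.

Lemma ambiguity_moments (P : probability (borel_vec R n) R) :
  ambiguity_set mu Sigma P ->
  [/\ forall i, (\int[P]_v (v i 0) = mu i 0)%R,
      forall i, (\int[P]_v (v i 0 * v i 0) = Sigma i i)%R
    & forall i j, (Sigma i j <= \int[P]_v (v i 0 * v j 0))%R].
Proof.
move=> [sP /matrixP m1 /matrixP m2 m3].
have c1 i : continuous (fun v : 'cV[R]_n => v i 0) by exact: coord_continuous.
have c2 i j : continuous (fun v : 'cV[R]_n => v i 0 * v j 0).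
  by apply: continuousM; exact: coord_continuous.
split=> [i|i|i j].
- have := m1 i 0; rewrite !mxE (expectation_continuous sP (c1 i)).
  by move=> [].
- have := m2 i 0; rewrite !mxE.
  under [X in expectation _ X]eq_fun do rewrite mxE outerE.
  by rewrite (expectation_continuous sP (c2 i i)) => -[].
- have := m3 i j; rewrite !mxE.
  under [X in expectation _ X]eq_fun do rewrite outerE.
  by rewrite (expectation_continuous sP (c2 i j)) lee_fin.
Qed.

Lemma expectation_le_objective (P : probability (borel_vec R n) R) x y0 y Y Z :
  ambiguity_set mu Sigma P -> sdp_constraints X A b c x y0 y Y Z ->
  ('E_P[max_piece A b c x : borel_vec R n -> R]
     <= (sdp_objective mu Sigma y0 y Y)%:E)%E.
Proof.
move=> aP [_ subY Z0 psdk]; have [sP _ _ _] := aP.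
have [m1 m2 m3] := ambiguity_moments aP.
rewrite expectation_continuous//; last exact: max_piece_continuous.
rewrite lee_fin; apply: (@le_trans _ _ (\int[P]_v quadratic y0 y Y v)%R).
  apply: le_Rintegral_box => //; [exact: max_piece_continuous|exact: quadratic_continuous|].
  move=> v bv; apply: max_piece_le => k; rewrite pieceE.
  apply: le_trans (quadratic_multiplier_le _ _ _ (Z0 k) bv).
  exact: psd_quadratic_le.
have c1 i : continuous (fun v : 'cV[R]_n => y i 0 * v i 0).
  by apply: continuousM; [exact: cst_continuous|exact: coord_continuous].
have c2 i j : continuous (fun v : 'cV[R]_n => v i 0 * v j 0).
  by apply: continuousM; exact: coord_continuous.
have c3 i j : continuous (fun v : 'cV[R]_n => Y i j * (v i 0 * v j 0)).
  by apply: continuousM => //; exact: cst_continuous.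
rewrite /quadratic /sdp_objective dotE mxdotE.
rewrite RintegralD//; last 2 first.
- apply: integrable_continuous => //; apply: continuousD; first exact: cst_continuous.
  exact: continuous_sum.
- by apply: integrable_continuous => //; do 2 apply: continuous_sum => ?.
rewrite RintegralD//; last 2 first.
- by apply: integrable_continuous => //; exact: cst_continuous.
- by apply: integrable_continuous => //; exact: continuous_sum.
have PT : fine (P setT) = 1 by rewrite (@probability_setT _ _ _ P).
rewrite Rintegral_cst// PT mulr1 -!addrA lerD2l.
apply: lerD.
  rewrite Rintegral_sum//; apply: ler_sum => i _.
  rewrite RintegralZl// ?m1 1?mulrC//; apply: integrable_continuous => //.
  exact: coord_continuous.
rewrite Rintegral_sum//; last by move=> i; exact: continuous_sum.
apply: ler_sum => i _; rewrite Rintegral_sum//; apply: ler_sum => j _.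
rewrite RintegralZl//; last exact: integrable_continuous.
(* Diagonal entries of Y have no prescribed sign, but the second moments are fixed there; off the
   diagonal the sign of Y reverses the inequality on the moments. *)
have [<-|ij] := eqVneq i j; first by rewrite m2.
by rewrite ler_wnM2l//; apply: subY.2.
Qed.

Lemma dro_le_sdp : (dro_value X A b c mu Sigma <= sdp_value X A b c mu Sigma)%E.
Proof.
apply: le_ereal_inf_tmp => _ [[[[[x y0] y] Y] Z] feas <-].
have [Xx _ _ _] := feas.
apply: ge_ereal_inf; exists (ereal_sup [set ('E_P[max_piece A b c x : borel_vec R n -> R])%E
                           | P in ambiguity_set mu Sigma]); first by exists x.
apply: ge_ereal_sup => _ [P aP <-].
exact: expectation_le_objective feas.
Qed.

End UpperBound.

(** * Duality *)

Lemma combination_continuous (R : realType) (V : normedModType R) (t : R) (u : V) :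
  continuous (fun w : V => (1 - t) *: w + t *: u).
Proof.
by move=> w; apply: cvgD; [apply: cvgZr|exact: cvg_cst].
Qed.

(** * Separation of a convex set from the origin *)

Section Separation.
Variables (R : realType) (N : nat).

Definition dotr (u v : 'rV[R]_N) : R := \sum_i u 0 i * v 0 i.

Lemma dotrC u v : dotr u v = dotr v u.
Proof. by apply: eq_bigr => i _; rewrite mulrC. Qed.

Lemma dotrDr u v w : dotr u (v + w) = dotr u v + dotr u w.
Proof. by rewrite /dotr -big_split; apply: eq_bigr => i _; rewrite mxE mulrDr. Qed.

Lemma dotrZr u (t : R) v : dotr u (t *: v) = t * dotr u v.
Proof. by rewrite /dotr big_distrr; apply: eq_bigr => i _; rewrite mxE mulrCA. Qed.

Lemma dotr_ge0 (u : 'rV[R]_N) : 0 <= dotr u u.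
Proof. by apply: sumr_ge0 => i _; rewrite -expr2 sqr_ge0. Qed.

Lemma dotr_continuous : continuous (fun u => dotr u u).
Proof.
by apply: continuous_sum => i; apply: continuousM; exact: coord_continuous.
Qed.

(** z is the point of least norm in the closure of C, and the projection inequality gives <z, u> >=
    <z, z> >= e. The margin e is what makes the separation strict although C is not assumed
    closed. *)
Lemma convex_separation (C : set 'rV[R]_N) (e : R) :
  (forall t u v, C u -> C v -> 0 <= t <= 1 -> C ((1 - t) *: u + t *: v)) ->
  0 < e -> (forall u, C u -> e <= dotr u u) ->
  exists z, forall u, C u -> 0 < dotr z u.
Proof.
move=> convC e0 Ce; have [[c0 Cc0]|C0] := pselect (C !=set0); last first.
  by exists 0 => u Cu; case: C0; exists u.
have clC (u : 'rV[R]_N) : closure C u -> e <= dotr u u.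
  have cle : closed [set u : 'rV[R]_N | e <= dotr u u].
    apply: (@preimage_closed _ _ (fun u => dotr u u) [set y | e <= y]).
      by move=> ? _; exact: dotr_continuous.
    exact: closed_ge.
  by move=> /(closure_subset Ce) /cle.
pose D := closure C `&` [set u | dotr u u <= dotr c0 c0].
have cD : compact D.
  apply: bounded_closed_compact.
    exists (1 + dotr c0 c0); split=> [|M M1 u [_ /= uc]]; first exact: num_real.
    have -> : `|u| = mx_norm u by [].
    rewrite mx_normrE; apply/bigmax_leP; split=> [|[j i] _ /=].
      by rewrite ltW// (le_lt_trans _ M1)// addr_ge0// dotr_ge0.
    rewrite ord1; apply: le_trans (ltW M1); apply: (@le_trans _ _ (1 + dotr u u)).
      have : u 0 i * u 0 i <= dotr u u.
        rewrite /dotr (bigD1 i)//= lerDl sumr_ge0// => k _.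
        by rewrite -expr2 sqr_ge0.
      have := sqr_ge0 (`|u 0 i| - 1); rewrite sqrrB1.
      by rewrite real_normK ?num_real// -expr2 => *; have := normr_ge0 (u 0 i); lra.
    by rewrite lerD2l.
  apply: closedI; first exact: closed_closure.
  apply: (@preimage_closed _ _ (fun u => dotr u u) [set y | y <= dotr c0 c0]).
    by move=> ? _; exact: dotr_continuous.
  exact: closed_le.
have D0 : D !=set0 by exists c0; split=> //=; exact: subset_closure.
have [z zD zmin] := EVT_min_rV D0 cD (continuous_subspaceT dotr_continuous).
have [zC zc] : D z by exact: set_mem.
have minC y : closure C y -> dotr z z <= dotr y y.
  move=> yC; have [yc|/ltW yc] := leP (dotr y y) (dotr c0 c0).
    by apply: zmin; apply/mem_set.
  exact: le_trans yc.
exists z => u Cu; apply: (lt_le_trans e0); apply: (le_trans (clC z zC)).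
rewrite -subr_ge0 leNgt; apply/negP => neg.
pose q := dotr u u - 2 * dotr z u + dotr z z.
have q0 : 0 <= q.
  have -> : q = dotr (u + (-1) *: z) (u + (-1) *: z).
    rewrite dotrDr ![dotr (u + _) _]dotrC !(dotrDr, dotrZr).
    by rewrite ![dotr (_ *: _) _]dotrC !(dotrZr, dotrDr) (dotrC u z) /q; ring.
  exact: dotr_ge0.
set b := dotr z u - dotr z z in neg.
(* The squared norm on the segment from z to u is <z, z> + t (2 b + t q), with q = |u - z|^2. In
   place of the minimizer - b / q, the denominator q - b is positive even when q = 0 and keeps t at
   most 1. *)
pose t := - b / (q - b).
have qb : 0 < q - b by lra.
have t0 : 0 < t by rewrite divr_gt0// oppr_gt0.
have t1 : t <= 1 by rewrite ler_pdivrMr//; lra.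
have : closure C ((1 - t) *: z + t *: u).
  move=> B /(@combination_continuous _ _ t u z) Bz.
  have [w [Cw Bw]] := zC _ Bz.
  by exists ((1 - t) *: w + t *: u); split=> //; apply: convC => //; rewrite ltW.
move=> /minC.
have -> : dotr ((1 - t) *: z + t *: u) ((1 - t) *: z + t *: u) =
  dotr z z + t * (2 * b + t * q).
  rewrite dotrDr ![dotr (_ + _) _]dotrC !(dotrDr, dotrZr).
  by rewrite ![dotr (_ *: _) _]dotrC !(dotrZr, dotrDr) (dotrC u z) /q /b; ring.
rewrite lerDl pmulr_rge0//; apply/negP; rewrite -ltNge.
have -> : t * q = - b + t * b.
  by rewrite /t; field; rewrite gt_eqF.
have : t * b <= 0 by rewrite mulr_ge0_le0// ltW.
by lra.
Qed.

End Separation.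

Section SeparationFamily.
Variables (R : realType) (K N : nat).
(** All entries of a family of K matrices plus one scalar, as coordinates of a single row vector. *)
Let I : finType := (('I_K * ('I_N * 'I_N)) + unit)%type.

Let entry (G : 'I_K -> 'M[R]_N) (r : R) (a : I) : R :=
  match a with inl (k, (i, j)) => G k i j | inr _ => r end.

Let row_of G r : 'rV[R]_#|I| := \row_a entry G r (enum_val a).

Let sum_row (F : I -> R) : \sum_(a < #|I|) F (enum_val a) =
  \sum_k \sum_i \sum_j F (inl (k, (i, j))) + F (inr tt).
Proof.
rewrite -big_enum_val big_sumType /=; congr (_ + _).
  rewrite (eq_bigr (fun p => F (inl (p.1, (p.2.1, p.2.2))))); last by case=> k [].
  rewrite -(pair_bigA _ (fun k q => F (inl (k, (q.1, q.2))))) /=.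
  by apply: eq_bigr => k _; rewrite -(pair_bigA _ (fun i j => F (inl (k, (i, j))))).
by rewrite (big_pred1 tt)// => -[].
Qed.

Lemma matrix_separation (C : set (('I_K -> 'M[R]_N) * R)) (e : R) :
  (forall t u v, C u -> C v -> 0 <= t <= 1 ->
    C (fun k => (1 - t) *: u.1 k + t *: v.1 k, (1 - t) * u.2 + t * v.2)) ->
  0 < e ->
  (forall u, C u -> e <= `|u.2| \/ exists k i j, e <= `|u.1 k i j|) ->
  exists (L : 'I_K -> 'M[R]_N) (l : R), forall u, C u ->
    0 < \sum_k \sum_i \sum_j L k i j * u.1 k i j + l * u.2.
Proof.
move=> convC e0 Ce.
pose D := [set w | exists2 u, C u & w = row_of u.1 u.2].
have [z hz] : exists z, forall u, D u -> 0 < dotr z u.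
  apply: (@convex_separation _ _ D (e ^+ 2)).
  - move=> t _ _ [u Cu ->] [v Cv ->] t01.
    exists (fun k => (1 - t) *: u.1 k + t *: v.1 k, (1 - t) * u.2 + t * v.2).
      exact: convC.
    apply/rowP => a; rewrite !mxE /entry /=.
    by case: (enum_val a) => [[k [i j]]|_]; rewrite ?mxE.
  - by rewrite exprn_gt0.
  - move=> _ [u Cu ->]; rewrite /dotr.
    have sq (a : I) : e <= `|entry u.1 u.2 a| ->
        e ^+ 2 <= \sum_i row_of u.1 u.2 0 i * row_of u.1 u.2 0 i.
      move=> ea; rewrite (bigD1 (enum_rank a))//= /row_of mxE enum_rankK.
      rewrite ler_wpDr//; first by apply: sumr_ge0 => ? _; rewrite -expr2 sqr_ge0.
      by rewrite -expr2 -(real_normK (num_real (entry _ _ _))) ler_sqr ?nnegrE// ltW.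
    by have [eu|[k [i [j eu]]]] := Ce u Cu; [apply: (sq (inr tt))|apply: (sq (inl (k, (i, j))))].
exists (fun k => \matrix_(i, j) z 0 (enum_rank (inl (k, (i, j)) : I))).
exists (z 0 (enum_rank (inr tt : I))).
move=> u Cu; have := hz (row_of u.1 u.2) (ex_intro2 _ _ u Cu erefl); rewrite /dotr.
have -> : \sum_i z 0 i * row_of u.1 u.2 0 i =
   \sum_(a < #|I|) (fun b => z 0 (enum_rank b) * entry u.1 u.2 b) (enum_val a).
  by apply: eq_bigr => a _; rewrite enum_valK mxE.
rewrite (sum_row (fun b => z 0 (enum_rank b) * entry u.1 u.2 b)) /=; congr (_ < _ + _).
by apply: eq_bigr => k _; apply: eq_bigr => i _; apply: eq_bigr => j _; rewrite mxE.
Qed.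

End SeparationFamily.

(** * Convexity and perturbation of the semidefinite and submodular cones *)

Section ConvexityFacts.
Variables (R : realType) (n : nat).

Lemma qform_combination (t s : R) (A B : 'M[R]_n) (v : 'cV[R]_n) :
  (v^T *m (t *: A + s *: B) *m v) 0 0 =
  t * (v^T *m A *m v) 0 0 + s * (v^T *m B *m v) 0 0.
Proof.
by rewrite mulmxDr mulmxDl -!scalemxAr -!scalemxAl mxE [X in X + _ = _]mxE [X in _ + X = _]mxE.
Qed.

Lemma psd_combination (t s : R) (A B : 'M[R]_n) : 0 <= t -> 0 <= s ->
  psd A -> psd B -> psd (t *: A + s *: B).
Proof.
move=> t0 s0 [sA pA] [sB pB]; split.
  by rewrite /symmx linearD !linearZ /= sA sB.
by move=> v; rewrite qform_combination addr_ge0// mulr_ge0.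
Qed.

Lemma psd0 : psd (0 : 'M[R]_n).
Proof. by split=> [|v]; rewrite ?/symmx ?trmx0// mulmx0 mul0mx mxE. Qed.

Lemma psd_rank1 (t : R) (w : 'cV[R]_n) : 0 <= t -> psd (t *: (w *m w^T)).
Proof.
move=> t0; split; first by rewrite /symmx linearZ /= trmx_mul trmxK.
move=> v; rewrite -scalemxAr -scalemxAl mxE mulr_ge0//.
have -> : v^T *m (w *m w^T) *m v = (v^T *m w) *m (w^T *m v) by rewrite !mulmxA.
rewrite mxE big_ord1.
have -> : (v^T *m w) 0 0 = (w^T *m v) 0 0.
  by rewrite !dotE; apply: eq_bigr => i _; rewrite mulrC.
by rewrite -expr2 sqr_ge0.
Qed.

Lemma submodular_combination (t s : R) (A B : 'M[R]_n) : 0 <= t -> 0 <= s ->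
  submodular A -> submodular B -> submodular (t *: A + s *: B).
Proof.
move=> t0 s0 [sA pA] [sB pB]; split.
  by rewrite /symmx linearD !linearZ /= sA sB.
move=> i j ij; rewrite !mxE -oppr_ge0 opprD -!mulrN addr_ge0// mulr_ge0// oppr_ge0.
  exact: pA.
exact: pB.
Qed.

Lemma submodular0 : submodular (0 : 'M[R]_n).
Proof. by split=> [|i j _]; rewrite ?/symmx ?trmx0// mxE. Qed.

Lemma quad_mx_combination (t s c c' : R) (b b' : 'cV[R]_n) (A A' : 'M[R]_n) :
  quad_mx (t * c + s * c') (t *: b + s *: b') (t *: A + s *: A') =
  t *: quad_mx c b A + s *: quad_mx c' b' A'.
Proof.
rewrite /quad_mx !scale_block_mx add_block_mx; congr block_mx.
- by rewrite !scale_scalar_mx -rmorphD.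
- by rewrite linearD !linearZ /= scalerDr !scalerA ![2^-1 * _]mulrC.
- by rewrite scalerDr !scalerA ![2^-1 * _]mulrC.
Qed.

Lemma symmx_quad_mx (c : R) (b : 'cV[R]_n) (A : 'M[R]_n) :
  symmx A -> symmx (quad_mx c b A).
Proof.
move=> sA; rewrite /symmx /quad_mx tr_block_mx tr_scalar_mx sA.
by rewrite !linearZ /= trmxK.
Qed.

(** A matrix with entries bounded by e has a quadratic form bounded by n e |v|^2, since |v_i v_j| <=
    (v_i^2 + v_j^2) / 2; the multiple of the identity absorbs it. *)
Lemma psd_perturbation (e : R) (Q S : 'M[R]_n) : 0 <= e -> symmx Q -> psd S ->
  (forall i j, `|(Q - S - (n%:R * e)%:M) i j| <= e) -> psd Q.
Proof.
move=> e0 sQ [_ pS] small; split=> // v.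
set E := Q - S - (n%:R * e)%:M in small.
have -> : Q = 1 *: S + 1 *: ((n%:R * e)%:M + E).
  by rewrite !scale1r /E addrC addrA -addrA; apply/matrixP=> i j; rewrite !mxE; ring.
rewrite qform_combination !mul1r addr_ge0//.
have -> : (n%:R * e)%:M + E = 1 *: (n%:R * e)%:M + 1 *: E by rewrite !scale1r.
rewrite qform_combination !mul1r.
have -> : (v^T *m (n%:R * e)%:M *m v) 0 0 =
    \sum_i \sum_j e * (2^-1 * (v i 0 ^+ 2 + v j 0 ^+ 2)).
  rewrite mul_mx_scalar -scalemxAl mxE dotE.
  transitivity (e * (2^-1 * (\sum_i \sum_(j < n) v i 0 ^+ 2 + \sum_(i < n) \sum_j v j 0 ^+ 2))).
    have -> : \sum_(i < n) \sum_j v j 0 ^+ 2 = n%:R * (\sum_i v i 0 * v i 0).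
      by rewrite sumr_const card_ord -[LHS]mulr_natl; congr (_ * _); apply: eq_bigr.
    have -> : \sum_i \sum_(j < n) v i 0 ^+ 2 = n%:R * (\sum_i v i 0 * v i 0).
      rewrite big_distrr; apply: eq_bigr => i _.
      by rewrite sumr_const card_ord -[LHS]mulr_natl /= expr2.
    by field.
  rewrite -big_split !big_distrr; apply: eq_bigr => i _ /=.
  by rewrite -big_split !big_distrr.
rewrite qformE -big_split sumr_ge0//= => i _; rewrite -big_split sumr_ge0//= => j _.
have h : `|E i j * (v i 0 * v j 0)| <= e * (2^-1 * (v i 0 ^+ 2 + v j 0 ^+ 2)).
  rewrite normrM ler_pM//.
  rewrite normrM -(real_normK (num_real (v i 0))) -(real_normK (num_real (v j 0))).
  by have := sqr_ge0 (`|v i 0| - `|v j 0|); rewrite sqrrB; lra.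
by have := ler_norm (- (E i j * (v i 0 * v j 0))); rewrite normrN; lra.
Qed.

End ConvexityFacts.

(** * Moments read off a linear functional on matrices *)

Section Pairing.
Variables (R : realType) (n : nat) (L : 'M[R]_(1 + n)).

(* The mass, mean and second moment carried by the functional [- L]. *)
Definition dmass : R := - L (lshift n 0) (lshift n 0).
Definition dmean (i : 'I_n) : R :=
  - (2^-1 * (L (lshift n 0) (rshift 1 i) + L (rshift 1 i) (lshift n 0))).
Definition dmoment (i j : 'I_n) : R :=
  - (2^-1 * (L (rshift 1 i) (rshift 1 j) + L (rshift 1 j) (rshift 1 i))).

(** The integral of [quadratic c b A] against these moments. *)
Definition dquad (c : R) (b : 'cV[R]_n) (A : 'M[R]_n) : R :=
  c * dmass + \sum_i b i 0 * dmean i + \sum_i \sum_j A i j * dmoment i j.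

Lemma dmomentC i j : dmoment i j = dmoment j i.
Proof. by rewrite /dmoment addrC. Qed.

Lemma pairing_quad_mx c b (A : 'M[R]_n) : symmx A ->
  \sum_i \sum_j L i j * (quad_mx c b A) i j = - dquad c b A.
Proof.
move=> sA; rewrite big_split_ord /= big_ord1 big_split_ord /= big_ord1.
under [X in _ + X]eq_bigr do rewrite big_split_ord /= big_ord1.
rewrite /quad_mx block_mxEul big_split /= mxE eqxx mulr1n.
under [X in _ + X + _]eq_bigr do rewrite block_mxEur !mxE.
under [X in _ + (X + _)]eq_bigr do rewrite block_mxEdl !mxE.
under [X in _ + (_ + X)]eq_bigr do under eq_bigr do rewrite block_mxEdr.
have -> : \sum_i \sum_j L (rshift 1 i) (rshift 1 j) * A i j =
    - \sum_i \sum_j A i j * dmoment i j.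
  transitivity (2^-1 * (\sum_i \sum_j L (rshift 1 i) (rshift 1 j) * A i j +
     \sum_i \sum_j L (rshift 1 j) (rshift 1 i) * A i j)).
    rewrite [X in 2^-1 * (_ + X)]exchange_big /=.
    have -> : \sum_j \sum_i L (rshift 1 j) (rshift 1 i) * A i j =
        \sum_i \sum_j L (rshift 1 i) (rshift 1 j) * A i j.
      apply: eq_bigr => i _; apply: eq_bigr => j _.
      by rewrite -[in LHS]sA mxE.
    by field.
  rewrite -big_split big_distrr -sumrN; apply: eq_bigr => i _ /=.
  rewrite -big_split big_distrr -sumrN; apply: eq_bigr => j _ /=.
  by rewrite /dmoment; ring.
rewrite /dquad !opprD addrA; congr (_ + _).
rewrite -addrA; congr (_ + _); first by rewrite /dmass; ring.
rewrite -big_split -sumrN; apply: eq_bigr => i _ /=.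
by rewrite /dmean; ring.
Qed.

Lemma pairing_scalar (a : R) :
  \sum_i \sum_j L i j * (a%:M : 'M[R]_(1 + n)) i j =
  - (a * (dmass + \sum_i dmoment i i)).
Proof.
transitivity (\sum_i L i i * a).
  apply: eq_bigr => i _; rewrite (bigD1 i)//= mxE eqxx mulr1n big1 ?addr0// => j ji.
  by rewrite mxE eq_sym (negbTE ji) mulr0.
rewrite big_split_ord /= big_ord1 mulrDr opprD big_distrr -sumrN.
congr (_ + _); first by rewrite /dmass; ring.
by apply: eq_bigr => i _; rewrite /dmoment /=; field.
Qed.

Lemma pairing_rank1 (t s : R) (u : 'cV[R]_n) :
  let w := col_mx s%:M u in
  \sum_i \sum_j L i j * (t *: (w *m w^T)) i j =
  - (t * (s ^+ 2 * dmass + 2 * s * \sum_i u i 0 * dmean i +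
          \sum_i \sum_j u i 0 * u j 0 * dmoment i j)).
Proof.
move=> w.
have -> : t *: (w *m w^T) = quad_mx (t * s ^+ 2) ((2 * t * s) *: u) (t *: (u *m u^T)).
  rewrite /w tr_col_mx mul_col_row scale_block_mx /quad_mx tr_scalar_mx.
  rewrite -scalar_mxM scale_scalar_mx -expr2 mul_scalar_mx mul_mx_scalar.
  have tE : t * s = 2^-1 * (2 * t * s) by field.
  by rewrite linearZ [(_ *: u)^T]linearZ /= !scalerA [s * t]mulrC tE.
rewrite pairing_quad_mx; last by rewrite /symmx linearZ /= trmx_mul trmxK.
congr (- _); rewrite /dquad !mulrDr; congr (_ + _ + _).
- by ring.
- rewrite !big_distrr; apply: eq_bigr => i _; rewrite /= mxE; ring.
- rewrite big_distrr; apply: eq_bigr => i _; rewrite /= big_distrr.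
  by apply: eq_bigr => j _; rewrite /= mxE outerE; ring.
Qed.

End Pairing.

(** Serves to extract each dual constraint: one primal variable is scaled by t while the separating
    inequality stays positive. For a < 0 it fails at t = |b| / - a. *)
Lemma affine_gt0_slope_ge0 (R : realFieldType) (a b : R) :
  (forall t, 0 <= t -> 0 < b + t * a) -> 0 <= a.
Proof.
move=> h; rewrite leNgt; apply/negP => a0.
have /h : 0 <= `|b| / - a by rewrite divr_ge0// oppr_ge0 ltW.
have -> : b + `|b| / - a * a = b - `|b| by field; rewrite lt_eqF.
by rewrite subr_gt0 ltNge ler_norm.
Qed.

Lemma sum_col_delta (R : pzRingType) n (i : 'I_n) (t : R) (al : 'I_n -> R) :
  \sum_j (t *: delta_mx i 0 : 'cV[R]_n) j 0 * al j = t * al i.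
Proof.
rewrite (bigD1 i)//= !mxE !eqxx mulr1 big1 ?addr0// => j ji.
by rewrite !mxE (negbTE ji) /= mulr0 mul0r.
Qed.

Lemma sum_mx_delta (R : pzRingType) n (i j : 'I_n) (al : 'I_n -> 'I_n -> R) :
  \sum_k \sum_l (delta_mx i j : 'M[R]_n) k l * al k l = al i j.
Proof.
rewrite (bigD1 i)//= (bigD1 j)//= mxE !eqxx mul1r big1 => [|l lj].
  rewrite addr0 big1 ?addr0// => k ki; rewrite big1// => l _.
  by rewrite mxE (negbTE ki) mul0r.
by rewrite mxE (negbTE lj) andbF mul0r.
Qed.

Section Pair.
Variables (R : realType) (N : nat).
Definition pairing (L G : 'M[R]_N) : R := \sum_i \sum_j L i j * G i j.

Lemma pairingB L G H : pairing L (G - H) = pairing L G - pairing L H.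
Proof.
rewrite /pairing -sumrB; apply: eq_bigr => i _.
by rewrite -sumrB; apply: eq_bigr => j _; rewrite !mxE mulrBr.
Qed.

Lemma pairing0 L : pairing L 0 = 0.
Proof. by rewrite /pairing big1// => i _; rewrite big1// => j _; rewrite mxE mulr0. Qed.

End Pair.

(** The integrated form of the identity behind [quadratic_multiplier_le]: [Z i j] meets the moment
    of (1 - xi_i) xi_j. *)
Lemma dquad_multiplier (R : realType) n (L : 'M[R]_(1 + n)) y0 y (Y Z : 'M[R]_n) :
  dquad L y0 (y - Z^T *m ones R n) (Y + 2^-1 *: (Z + Z^T)) =
  y0 * dmass L + \sum_i y i 0 * dmean L i + \sum_i \sum_j Y i j * dmoment L i j
  - \sum_i \sum_j Z i j * (dmean L j - dmoment L i j).
Proof.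
rewrite /dquad.
have -> : \sum_i (y - Z^T *m ones R n) i 0 * dmean L i =
    \sum_i y i 0 * dmean L i - \sum_i \sum_j Z i j * dmean L j.
  rewrite [in RHS]exchange_big /= -sumrB; apply: eq_bigr => j _.
  rewrite 3!mxE mulrBl; congr (_ - _).
  by rewrite big_distrl /=; apply: eq_bigr => i _; rewrite !mxE mulr1.
have -> : \sum_i \sum_j (Y + 2^-1 *: (Z + Z^T)) i j * dmoment L i j =
   \sum_i \sum_j Y i j * dmoment L i j + \sum_i \sum_j Z i j * dmoment L i j.
  transitivity (\sum_i \sum_j Y i j * dmoment L i j +
    2^-1 * (\sum_i \sum_j Z i j * dmoment L i j
            + \sum_i \sum_j Z j i * dmoment L i j)).
    rewrite -big_split /= big_distrr -big_split /=; apply: eq_bigr => i _.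
    rewrite -big_split /= big_distrr -big_split /=; apply: eq_bigr => j _.
    by rewrite !mxE; ring.
  congr (_ + _); rewrite [X in _ + X]exchange_big /=.
  have -> : \sum_j \sum_i Z j i * dmoment L i j =
    \sum_i \sum_j Z i j * dmoment L i j.
    by apply: eq_bigr => i _; apply: eq_bigr => j _; rewrite dmomentC.
  by field.
have -> : \sum_i \sum_j Z i j * (dmean L j - dmoment L i j) =
    \sum_i \sum_j Z i j * dmean L j - \sum_i \sum_j Z i j * dmoment L i j.
  rewrite -sumrB; apply: eq_bigr => i _; rewrite -sumrB.
  by apply: eq_bigr => j _; ring.
by ring.
Qed.

Section Duality.
Variables (R : realType) (K n : nat).
Variables (A : 'I_K.+1 -> 'M[R]_n) (b : 'I_K.+1 -> 'cV[R]_n) (c : 'I_K.+1 -> R).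
Variables (mu : 'cV[R]_n) (Sigma : 'M[R]_n).
Hypothesis symA : forall k, symmx (A k).
Hypothesis symS : symmx Sigma.

Definition slack k y0 y Y (Z : 'M[R]_n) : 'M[R]_(1 + n) :=
  quad_mx y0 (y - Z^T *m ones R n) (Y + 2^-1 *: (Z + Z^T))
  - quad_mx (c k) (b k) (A k).

(* The shift by [eta] keeps this set at a positive distance from the origin, so
   that no closedness of the cone of constraints is needed. *)
Definition perturbed (v eta : R) : set (('I_K.+1 -> 'M[R]_(1 + n)) * R) :=
  [set u | exists (y0 : R) (y : 'cV[R]_n) (Y : 'M[R]_n)
      (Z : 'I_K.+1 -> 'M[R]_n) (S : 'I_K.+1 -> 'M[R]_(1 + n)) (r : R),
    [/\ submodular Y, (forall k i j, 0 <= Z k i j), (forall k, psd (S k)), 0 <= r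
      & u = (fun k => slack k y0 y Y (Z k) - S k - eta%:M,
             sdp_objective mu Sigma y0 y Y - v + r + eta)]].

Lemma symmx_slack k y0 y Y Z : symmx Y -> symmx (slack k y0 y Y Z).
Proof.
move=> sY; rewrite /symmx /slack linearB /= !symmx_quad_mx//.
by rewrite /symmx linearD linearZ /= linearD /= trmxK sY [Z^T + Z]addrC.
Qed.

Lemma slack_combination k t y0 y Y Z y0' y' Y' Z' :
  slack k ((1 - t) * y0 + t * y0') ((1 - t) *: y + t *: y')
    ((1 - t) *: Y + t *: Y') ((1 - t) *: Z + t *: Z') =
  (1 - t) *: slack k y0 y Y Z + t *: slack k y0' y' Y' Z'.
Proof.
rewrite /slack.
have -> : (1 - t) *: y + t *: y' - ((1 - t) *: Z + t *: Z')^T *m ones R n =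
   (1 - t) *: (y - Z^T *m ones R n) + t *: (y' - Z'^T *m ones R n).
  rewrite linearD !linearZ /= mulmxDl -!scalemxAl !scalerBr.
  by rewrite opprD addrACA.
have -> : (1 - t) *: Y + t *: Y' + 2^-1 *: ((1 - t) *: Z + t *: Z' +
     ((1 - t) *: Z + t *: Z')^T) =
   (1 - t) *: (Y + 2^-1 *: (Z + Z^T)) + t *: (Y' + 2^-1 *: (Z' + Z'^T)).
  by apply/matrixP => i j; rewrite !mxE; ring.
rewrite quad_mx_combination.
by rewrite !scalerBr addrACA -opprD -scalerDl subrK scale1r.
Qed.

Lemma objective_combination t y0 y Y y0' y' Y' :
  sdp_objective mu Sigma ((1 - t) * y0 + t * y0') ((1 - t) *: y + t *: y')
    ((1 - t) *: Y + t *: Y') =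
  (1 - t) * sdp_objective mu Sigma y0 y Y + t * sdp_objective mu Sigma y0' y' Y'.
Proof.
rewrite /sdp_objective /mxdot !mulmxDr -!scalemxAr mxtraceD !mxtraceZ.
have -> (B D : 'cV[R]_1) : ((1 - t) *: B + t *: D) 0 0 = (1 - t) * B 0 0 + t * D 0 0.
  by rewrite !mxE.
by ring.
Qed.

Lemma perturbed_convex v eta t p q : perturbed v eta p -> perturbed v eta q ->
  0 <= t <= 1 ->
  perturbed v eta (fun k => (1 - t) *: p.1 k + t *: q.1 k, (1 - t) * p.2 + t * q.2).
Proof.
move=> [y0 [y [Y [Z [S [r [sY Z0 S0 r0 ->]]]]]]].
move=> [y0' [y' [Y' [Z' [S' [r' [sY' Z0' S0' r0' ->]]]]]]] /andP[t0 t1].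
have t1' : 0 <= 1 - t by rewrite subr_ge0.
exists ((1 - t) * y0 + t * y0'), ((1 - t) *: y + t *: y'), ((1 - t) *: Y + t *: Y').
exists (fun k => (1 - t) *: Z k + t *: Z' k), (fun k => (1 - t) *: S k + t *: S' k).
exists ((1 - t) * r + t * r'); split.
- exact: submodular_combination.
- by move=> k i j; rewrite !mxE addr_ge0// mulr_ge0.
- by move=> k; exact: psd_combination.
- by rewrite addr_ge0// mulr_ge0.
congr pair => /=.
  apply/funext => k; rewrite slack_combination.
  by apply/matrixP => i j; rewrite !mxE; case: (i == j); rewrite ?mulr1n ?mulr0n; ring.
by rewrite objective_combination; ring.
Qed.

Definition sdp_lower_bound (v : R) : Prop :=
  forall (y0 : R) (y : 'cV[R]_n) (Y : 'M[R]_n) (Z : 'I_K.+1 -> 'M[R]_n),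
    submodular Y -> (forall k i j, 0 <= Z k i j) ->
    (forall k, psd (slack k y0 y Y (Z k))) -> v <= sdp_objective mu Sigma y0 y Y.

(** If every matrix entry is below e = eta / (1 + n), each slack is S + eta I up to a perturbation
    of entries at most e, hence psd because (1 + n) e = eta. The point is then feasible, its
    objective is at least v, and the scalar component is at least eta. *)
Lemma perturbed_away v eta : 0 < eta ->
  sdp_lower_bound v ->
  forall u, perturbed v eta u ->
  eta / (1 + n)%:R <= `|u.2| \/ exists k i j, eta / (1 + n)%:R <= `|u.1 k i j|.
Proof.
move=> eta0 vP u [y0 [y [Y [Z [S [r [sY Z0 S0 r0 ->]]]]]]] /=.
have n0 : 0 < (1 + n)%:R :> R by rewrite ltr0n.
set e := eta / _.
have e0 : 0 < e by rewrite divr_gt0.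
have ne : (1 + n)%:R * e = eta by rewrite /e mulrC divfK// gt_eqF.
have [|far] := pselect (exists k i j, e <= `|(slack k y0 y Y (Z k) - S k - eta%:M) i j|).
  by right.
left; have vobj : v <= sdp_objective mu Sigma y0 y Y.
  apply: (vP _ _ _ Z) => // k; apply: (psd_perturbation (ltW e0) _ (S0 k)).
    by apply: symmx_slack; case: sY.
  move=> i j; rewrite ne leNgt; apply/negP => /ltW h; apply: far.
  by exists k, i, j.
rewrite ger0_norm; last first.
  by apply: addr_ge0 (ltW eta0); apply: addr_ge0 => //; rewrite subr_ge0.
have : e <= eta.
  by rewrite ler_pdivrMr//; apply: ler_peMr; [exact: ltW|rewrite ler1n].
by have := vobj; lra.
Qed.

Lemma sdp_dual_moments v eta : 0 < eta ->
  sdp_lower_bound v ->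
  exists (L : 'I_K.+1 -> 'M[R]_(1 + n)) (l : R),
  [/\ 0 < l,
     forall k s (u : 'cV[R]_n), 0 <= s ^+ 2 * dmass (L k)
       + 2 * s * (\sum_i u i 0 * dmean (L k) i)
       + \sum_i \sum_j u i 0 * u j 0 * dmoment (L k) i j,
     forall k i j, dmoment (L k) i j <= dmean (L k) j,
     [/\ \sum_k dmass (L k) = l, forall i, \sum_k dmean (L k) i = l * mu i 0,
        forall i, \sum_k dmoment (L k) i i = l * Sigma i i
      & forall i j, l * Sigma i j <= \sum_k dmoment (L k) i j]
   & l * (v - (2 + n%:R) * eta) <= \sum_k dquad (L k) (c k) (b k) (A k)].
Proof.
move=> eta0 vP.
have [|L [l sep]] := @matrix_separation R K.+1 (1 + n) (perturbed v eta)
  (eta / (1 + n)%:R) (perturbed_convex (v:=v) (eta:=eta)) _ (perturbed_away eta0 vP).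
  by rewrite divr_gt0// ltr0n.
pose base := \sum_k dquad (L k) (c k) (b k) (A k)
  + eta * (\sum_k (dmass (L k) + \sum_i dmoment (L k) i i)) + l * (eta - v).
(* The separating inequality with terms grouped by primal variable; [base] is its value when all of
   these are 0. *)
have master (y0 : R) (y : 'cV[R]_n) (Y : 'M[R]_n) (Z : 'I_K.+1 -> 'M[R]_n)
    (S : 'I_K.+1 -> 'M[R]_(1 + n)) (r : R) : submodular Y -> (forall k i j, 0 <= Z k i j) ->
    (forall k, psd (S k)) -> 0 <= r ->
    0 < base + y0 * (l - \sum_k dmass (L k))
      + \sum_i y i 0 * (l * mu i 0 - \sum_k dmean (L k) i)
      + \sum_i \sum_j Y i j * (l * Sigma i j - \sum_k dmoment (L k) i j)
      + \sum_k \sum_i \sum_j Z k i j * (dmean (L k) j - dmoment (L k) i j)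
      - \sum_k pairing (L k) (S k) + l * r.
  move=> sY Z0 S0 r0.
  have := sep (fun k => slack k y0 y Y (Z k) - S k - eta%:M,
     sdp_objective mu Sigma y0 y Y - v + r + eta).
  have -> /= : \sum_k \sum_i \sum_j L k i j * (slack k y0 y Y (Z k) - S k - eta%:M) i j
    = \sum_k dquad (L k) (c k) (b k) (A k)
     - y0 * (\sum_k dmass (L k)) - \sum_i y i 0 * (\sum_k dmean (L k) i)
     - \sum_i \sum_j Y i j * (\sum_k dmoment (L k) i j)
     + \sum_k \sum_i \sum_j Z k i j * (dmean (L k) j - dmoment (L k) i j)
     - \sum_k pairing (L k) (S k)
     + eta * (\sum_k (dmass (L k) + \sum_i dmoment (L k) i i)).
    under [\sum_i y i 0 * _]eq_bigr do rewrite big_distrr /=.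
    rewrite [\sum_i \sum_k y i 0 * _]exchange_big /=.
    under [\sum_i \sum_j Y i j * _]eq_bigr do under eq_bigr do rewrite big_distrr /=.
    under [\sum_i \sum_j \sum_k Y i j * _]eq_bigr do rewrite exchange_big /=.
    rewrite [\sum_i \sum_k \sum_j Y i j * _]exchange_big /=.
    rewrite !big_distrr -!sumrN -!big_split /=; apply: eq_bigr => k _.
    have sYZ : symmx (Y + 2^-1 *: (Z k + (Z k)^T)).
      case: sY => sY _.
      by rewrite /symmx linearD linearZ /= linearD /= trmxK sY [_^T + _]addrC.
    rewrite -/(pairing _ _) 2!pairingB /slack pairingB /pairing.
    rewrite pairing_quad_mx// pairing_quad_mx// pairing_scalar dquad_multiplier.
    by ring.
  move=> /(_ _)/= h.
  have -> : base + y0 * (l - \sum_k dmass (L k))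
      + \sum_i y i 0 * (l * mu i 0 - \sum_k dmean (L k) i)
      + \sum_i \sum_j Y i j * (l * Sigma i j - \sum_k dmoment (L k) i j)
      + \sum_k \sum_i \sum_j Z k i j * (dmean (L k) j - dmoment (L k) i j)
      - \sum_k pairing (L k) (S k) + l * r =
     \sum_k dquad (L k) (c k) (b k) (A k)
     - y0 * (\sum_k dmass (L k)) - \sum_i y i 0 * (\sum_k dmean (L k) i)
     - \sum_i \sum_j Y i j * (\sum_k dmoment (L k) i j)
     + \sum_k \sum_i \sum_j Z k i j * (dmean (L k) j - dmoment (L k) i j)
     - \sum_k pairing (L k) (S k)
     + eta * (\sum_k (dmass (L k) + \sum_i dmoment (L k) i i))
     + l * (sdp_objective mu Sigma y0 y Y - v + r + eta).
    rewrite /sdp_objective dotE mxdotE /base.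
    have -> : \sum_i y i 0 * (l * mu i 0 - \sum_k dmean (L k) i) =
       l * (\sum_i mu i 0 * y i 0) - \sum_i y i 0 * (\sum_k dmean (L k) i).
      by rewrite big_distrr -sumrB; apply: eq_bigr => i _ /=; ring.
    have -> : \sum_i \sum_j Y i j * (l * Sigma i j - \sum_k dmoment (L k) i j) =
       l * (\sum_i \sum_j Y i j * Sigma i j)
       - \sum_i \sum_j Y i j * (\sum_k dmoment (L k) i j).
      rewrite big_distrr -sumrB; apply: eq_bigr => i _ /=.
      by rewrite big_distrr -sumrB; apply: eq_bigr => j _ /=; ring.
    by ring.
  by apply: h; exists y0, y, Y, Z, S, r.
have z3 : \sum_k \sum_i \sum_j (0 : 'M[R]_n) i j * (dmean (L k) j - dmoment (L k) i j) = 0.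
  by apply: big1 => k _; apply: big1 => i _; apply: big1 => j _; rewrite mxE mul0r.
have z2 : \sum_i \sum_j (0 : 'M[R]_n) i j * (l * Sigma i j - \sum_k dmoment (L k) i j) = 0.
  by apply: big1 => i _; apply: big1 => j _; rewrite mxE mul0r.
have z1 : \sum_i (0 : 'cV[R]_n) i 0 * (l * mu i 0 - \sum_k dmean (L k) i) = 0.
  by apply: big1 => i _; rewrite mxE mul0r.
have zS : \sum_k pairing (L k) (0 : 'M[R]_(1 + n)) = 0.
  by apply: big1 => k _; exact: pairing0.
have Z00 (k : 'I_K.+1) (i j : 'I_n) : 0 <= (0 : 'M[R]_n) i j by rewrite mxE.
have p0 (k : 'I_K.+1) := psd0 R (1 + n).
have base0 : 0 < base.
  have := master 0 0 0 (fun=> 0) (fun=> 0) 0 (submodular0 R n) Z00 p0 (lexx _).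
  by rewrite z1 z2 z3 zS; lra.
have l0 : 0 <= l.
  apply: (@affine_gt0_slope_ge0 _ _ base) => t t0.
  have := master 0 0 0 (fun=> 0) (fun=> 0) t (submodular0 R n) Z00 p0 t0.
  by rewrite z1 z2 z3 zS; lra.
have psdL k s (u : 'cV[R]_n) : 0 <= s ^+ 2 * dmass (L k)
     + 2 * s * (\sum_i u i 0 * dmean (L k) i)
     + \sum_i \sum_j u i 0 * u j 0 * dmoment (L k) i j.
  apply: (@affine_gt0_slope_ge0 _ _ base) => t t0.
  pose w := col_mx s%:M u; pose S h := if h == k then t *: (w *m w^T) else 0.
  have S0 h : psd (S h) by rewrite /S; case: eqP => _; [exact: psd_rank1|exact: psd0].
  have := master 0 0 0 (fun=> 0) S 0 (submodular0 R n) Z00 S0 (lexx _).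
  have -> : \sum_h pairing (L h) (S h) = - (t * (s ^+ 2 * dmass (L k)
     + 2 * s * (\sum_i u i 0 * dmean (L k) i)
     + \sum_i \sum_j u i 0 * u j 0 * dmoment (L k) i j)).
    rewrite (bigD1 k)//= [X in _ + X = _]big1 => [|h /negbTE hk]; last by rewrite /S hk pairing0.
    by rewrite addr0 /S eqxx; exact: pairing_rank1.
  by rewrite z1 z2 z3; lra.
have frechet k i j : dmoment (L k) i j <= dmean (L k) j.
  rewrite -subr_ge0; apply: (@affine_gt0_slope_ge0 _ _ base) => t t0.
  pose Z h : 'M[R]_n := if h == k then t *: delta_mx i j else 0.
  have Z0 h i' j' : 0 <= Z h i' j'.
    by rewrite /Z; case: eqP => _; rewrite !mxE// mulr_ge0.
  have := master 0 0 0 Z (fun=> 0) 0 (submodular0 R n) Z0 p0 (lexx _).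
  have -> : \sum_h \sum_i \sum_j Z h i j * (dmean (L h) j - dmoment (L h) i j) =
     t * (dmean (L k) j - dmoment (L k) i j).
    rewrite (bigD1 k)//= [X in _ + X = _]big1 => [|h /negbTE hk]; last first.
      by rewrite /Z hk; apply: big1 => ? _; apply: big1 => ? _; rewrite mxE mul0r.
    rewrite addr0 /Z eqxx.
    rewrite -(sum_mx_delta i j (fun i j => dmean (L k) j - dmoment (L k) i j)).
    rewrite big_distrr; apply: eq_bigr => i' _ /=; rewrite big_distrr.
    by apply: eq_bigr => j' _ /=; rewrite !mxE mulrA.
  by rewrite z1 z2 zS; lra.
have massE : \sum_k dmass (L k) = l.
  apply/le_anti/andP; split; rewrite -subr_ge0;
    apply: (@affine_gt0_slope_ge0 _ _ base) => t t0.
    have := master t 0 0 (fun=> 0) (fun=> 0) 0 (submodular0 R n) Z00 p0 (lexx _).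
    by rewrite z1 z2 z3 zS; lra.
  have := master (- t) 0 0 (fun=> 0) (fun=> 0) 0 (submodular0 R n) Z00 p0 (lexx _).
  by rewrite z1 z2 z3 zS; lra.
have meanE i : \sum_k dmean (L k) i = l * mu i 0.
  have al (t : R) : \sum_j (t *: delta_mx i 0 : 'cV[R]_n) j 0 *
      (l * mu j 0 - \sum_k dmean (L k) j) = t * (l * mu i 0 - \sum_k dmean (L k) i).
    exact: (sum_col_delta i t (fun i => l * mu i 0 - \sum_k dmean (L k) i)).
  apply/le_anti/andP; split; rewrite -subr_ge0;
    apply: (@affine_gt0_slope_ge0 _ _ base) => t t0.
    have := master 0 (t *: delta_mx i 0) 0 (fun=> 0) (fun=> 0) 0 (submodular0 R n) Z00 p0 (lexx _).
    by rewrite al z2 z3 zS; lra.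
  have := master 0 (- t *: delta_mx i 0) 0 (fun=> 0) (fun=> 0) 0 (submodular0 R n) Z00 p0 (lexx _).
  by rewrite al z2 z3 zS; lra.
have sumY (t : R) i j : \sum_k \sum_h (t *: delta_mx i j : 'M[R]_n) k h *
    (l * Sigma k h - \sum_q dmoment (L q) k h)
    = t * (l * Sigma i j - \sum_q dmoment (L q) i j).
  rewrite -(sum_mx_delta i j (fun k h => l * Sigma k h - \sum_q dmoment (L q) k h)).
  rewrite big_distrr; apply: eq_bigr => i' _ /=; rewrite big_distrr.
  by apply: eq_bigr => j' _ /=; rewrite !mxE mulrA.
have diagE i : \sum_k dmoment (L k) i i = l * Sigma i i.
  (* Diagonal directions are submodular for both signs of t, hence an equality. *)
  have sub (t : R) : submodular (t *: delta_mx i i : 'M[R]_n).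
    split=> [|j k jk]; first by rewrite /symmx linearZ /= trmx_delta.
    rewrite !mxE; have -> : (j == i) && (k == i) = false; last by rewrite mulr0.
    by apply/negP => /andP[/eqP ji /eqP ki]; rewrite ji ki eqxx in jk.
  apply/le_anti/andP; split; rewrite -subr_ge0;
    apply: (@affine_gt0_slope_ge0 _ _ base) => t t0.
    have := master 0 0 _ (fun=> 0) (fun=> 0) 0 (sub t) Z00 p0 (lexx _).
    by rewrite sumY z1 z3 zS; lra.
  have := master 0 0 _ (fun=> 0) (fun=> 0) 0 (sub (- t)) Z00 p0 (lexx _).
  by rewrite sumY z1 z3 zS; lra.
have momentG i j : l * Sigma i j <= \sum_k dmoment (L k) i j.
  have [<-|ij] := eqVneq i j; first by rewrite diagE.
  (* Off the diagonal only decreasing directions are allowed, and symmetry of Y moves (i, j) and (j,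
     i) together, by t / 2 each. *)
  have sub (t : R) : 0 <= t -> submodular (- t *: delta_mx i j + - t *: delta_mx j i : 'M[R]_n).
    move=> t0; split=> [|i' j' _].
      by rewrite /symmx linearD !linearZ /= !trmx_delta addrC.
    by rewrite !mxE -mulrDr mulNr oppr_le0 mulr_ge0// addr_ge0.
  rewrite -subr_ge0; apply: (@affine_gt0_slope_ge0 _ _ base) => t t0.
  have t2 : 0 <= 2^-1 * t by rewrite mulr_ge0// invr_ge0.
  have := master 0 0 _ (fun=> 0) (fun=> 0) 0 (sub _ t2) Z00 p0 (lexx _).
  have -> : \sum_k \sum_h (- (2^-1 * t) *: delta_mx i j + - (2^-1 * t) *: delta_mx j i : 'M[R]_n) k h *
    (l * Sigma k h - \sum_q dmoment (L q) k h)
    = - (2^-1 * t) * (l * Sigma i j - \sum_q dmoment (L q) i j)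
      + - (2^-1 * t) * (l * Sigma j i - \sum_q dmoment (L q) j i).
    rewrite -!sumY -big_split; apply: eq_bigr => k _ /=.
    by rewrite -big_split; apply: eq_bigr => h _ /=; rewrite mxE mulrDl.
  have -> : \sum_q dmoment (L q) j i = \sum_q dmoment (L q) i j.
    by apply: eq_bigr => q _; rewrite dmomentC.
  have -> : Sigma j i = Sigma i j by rewrite -[in LHS]symS mxE.
  by rewrite z1 z3 zS; lra.
have two k (s : R) i j (t : R) : 0 <= s ^+ 2 * dmass (L k)
     + 2 * s * (dmean (L k) i + t * dmean (L k) j)
     + (dmoment (L k) i i + 2 * t * dmoment (L k) i j + t ^+ 2 * dmoment (L k) j j).
  have key (F : 'I_n -> R) :
      \sum_h (delta_mx i 0 + t *: delta_mx j 0 : 'cV[R]_n) h 0 * F h = F i + t * F j.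
    rewrite -(sum_col_delta j) -[F i]mul1r -(sum_col_delta i) -big_split.
    by apply: eq_bigr => h _; rewrite /= scale1r [in LHS]mxE mulrDl.
  have := psdL k s (delta_mx i 0 + t *: delta_mx j 0); rewrite key.
  have -> : \sum_h \sum_q (delta_mx i 0 + t *: delta_mx j 0 : 'cV[R]_n) h 0 *
       (delta_mx i 0 + t *: delta_mx j 0 : 'cV[R]_n) q 0 * dmoment (L k) h q =
     dmoment (L k) i i + 2 * t * dmoment (L k) i j + t ^+ 2 * dmoment (L k) j j.
    under eq_bigr => h _.
      under eq_bigr do rewrite -mulrA.
      rewrite -big_distrr /= key.
    over.
    by rewrite /= key (dmomentC _ j i); ring.
  by [].
have mass0 k : 0 <= dmass (L k).
  have := psdL k 1 0; rewrite expr1n mul1r.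
  have -> : \sum_i (0 : 'cV[R]_n) i 0 * dmean (L k) i = 0.
    by apply: big1 => i _; rewrite mxE mul0r.
  have -> : \sum_i \sum_j (0 : 'cV[R]_n) i 0 * (0 : 'cV[R]_n) j 0 * dmoment (L k) i j = 0.
    by apply: big1 => i _; apply: big1 => j _; rewrite mxE !mul0r.
  by lra.
(* The form at 1 - xi_i gives mass - 2 mean + second moment >= 0, and the second moment is at most
   the mean. *)
have mean_le k i : dmean (L k) i <= dmass (L k).
  by have := two k (-1) i i 0; have := frechet k i i; lra.
have tr_le k : dmass (L k) + \sum_i dmoment (L k) i i <= (1 + n%:R) * dmass (L k).
  rewrite mulrDl mul1r lerD2l -[n in n%:R]card_ord -sumr_const big_distrl /=.
  by apply: ler_sum => i _; rewrite mul1r (le_trans (frechet k i i)).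
have tr_sum : \sum_k (dmass (L k) + \sum_i dmoment (L k) i i) <= (1 + n%:R) * l.
  by rewrite -massE big_distrr; exact: ler_sum.
(* If l = 0, all masses vanish; the Frechet bounds and positivity then annihilate every moment, and
   [base] would be 0. This replaces a constraint qualification. *)
have lp : 0 < l.
  rewrite lt_neqAle l0 andbT; apply/eqP => lz.
  have mz k : dmass (L k) = 0.
    have /eqP := massE; rewrite -lz psumr_eq0// => /allP/(_ k).
    by rewrite mem_index_enum => /(_ isT)/eqP.
  have mmz k i : dmoment (L k) i i = 0 /\ dmean (L k) i = 0.
    have h s := two k s i i 0; have := h 0; have := frechet k i i.
    have := mean_le k i; rewrite mz => h1 h2 h3.
    have := h (- (1 + dmoment (L k) i i)); have := h 1.
    by rewrite mz in h3 *; split; nra.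
  have moz k i j : dmoment (L k) i j = 0.
    have h t := two k 0 i j t; have := h 1; have := h (-1).
    by rewrite mz (mmz k i).1 (mmz k j).1; lra.
  move: base0; rewrite /base -lz mul0r addr0.
  have -> : \sum_k dquad (L k) (c k) (b k) (A k) = 0.
    apply: big1 => k _; rewrite /dquad mz mulr0 add0r.
    rewrite big1 => [|i _]; last by rewrite (mmz k i).2 mulr0.
    by rewrite add0r big1// => i _; apply: big1 => j _; rewrite moz mulr0.
  rewrite big1 ?mulr0 ?addr0 ?ltxx// => k _.
  by rewrite mz add0r; apply: big1 => i _; rewrite moz.
exists L, l; split=> //.
have := ler_wpM2l (ltW eta0) tr_sum; move: base0; rewrite /base; lra.
Qed.

End Duality.

(** * Exactness in dimension three *)

(** The value at (be, - al) is al (al ga - be^2). If al = 0 and be is nonzero, the form is linear in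
    u at v = 1, and u can be chosen to give the value -1. *)
Lemma binary_form_ge0 (R : realFieldType) (al be ga : R) :
  (forall u v, 0 <= al * u ^+ 2 + 2 * be * u * v + ga * v ^+ 2) ->
  [/\ 0 <= al, 0 <= ga & be ^+ 2 <= al * ga].
Proof.
move=> h.
have al0 : 0 <= al by have := h 1 0; lra.
have ga0 : 0 <= ga by have := h 0 1; lra.
split=> //; have [alp|aln] := ltP 0 al.
  rewrite -subr_ge0 -(pmulr_rge0 _ alp).
  by have := h be (- al); congr (_ <= _); ring.
have alE : al = 0 by apply/le_anti; rewrite aln al0.
have [->|ben] := eqVneq be 0; first by rewrite expr0n alE mul0r.
have := h (- (ga + 1) / (2 * be)) 1.
have -> : al * (- (ga + 1) / (2 * be)) ^+ 2 + 2 * be * (- (ga + 1) / (2 * be)) * 1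
   + ga * 1 ^+ 2 = - 1 by rewrite alE; field.
by lra.
Qed.

(** Minimizing over w, at w = - (e u + d v) / c, leaves the binary form of the Schur complement; its
    determinant times c is the 3 x 3 determinant. *)
Lemma ternary_form_ge0 (R : realFieldType) (a b c f e d : R) :
  (forall u v w, 0 <= a * u ^+ 2 + b * v ^+ 2 + c * w ^+ 2
     + 2 * (f * u * v + e * u * w + d * v * w)) ->
  [/\ f ^+ 2 <= a * b, e ^+ 2 <= a * c, d ^+ 2 <= b * c &
    0 <= a * b * c + 2 * d * e * f - a * d ^+ 2 - b * e ^+ 2 - c * f ^+ 2].
Proof.
move=> h.
have [|a0 b0 ab] := @binary_form_ge0 _ a f b.
  by move=> u v; have := h u v 0; lra.
have [|_ c0 ac] := @binary_form_ge0 _ a e c.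
  by move=> u v; have := h u 0 v; lra.
have [|_ _ bc] := @binary_form_ge0 _ b d c.
  by move=> u v; have := h 0 u v; lra.
split=> //.
have [cp|cn] := ltP 0 c.
  have cn0 : c != 0 by rewrite gt_eqF.
  have [|_ _] := @binary_form_ge0 _ (a - e ^+ 2 / c) (f - e * d / c) (b - d ^+ 2 / c).
    move=> u v; have := h u v (- (e * u + d * v) / c).
    by congr (_ <= _); field.
  rewrite -subr_ge0 => hh; rewrite -(pmulr_rge0 _ cp).
  have := mulr_ge0 (sqr_ge0 c) hh; congr (_ <= _).
  by field.
have cE : c = 0 by apply/le_anti; rewrite cn c0.
have eE : e = 0.
  by apply/eqP; rewrite -(sqrf_eq0 e) eq_le sqr_ge0 andbT; move: ac; rewrite cE mulr0.
have dE : d = 0.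
  by apply/eqP; rewrite -(sqrf_eq0 d) eq_le sqr_ge0 andbT; move: bc; rewrite cE mulr0.
by rewrite cE eE dE; lra.
Qed.

(** * From moment matrices to atoms *)

Section Three.
Variable R : realType.

Definition idx0 : 'I_3 := @Ordinal 3 0 isT.
Definition idx1 : 'I_3 := @Ordinal 3 1 isT.
Definition idx2 : 'I_3 := @Ordinal 3 2 isT.

Lemma ord3_ind (P : 'I_3 -> Prop) : P idx0 -> P idx1 -> P idx2 -> forall i, P i.
Proof.
move=> p0 p1 p2 [[|[|[|//]]] h].
- by rewrite (_ : Ordinal h = idx0)//; exact: val_inj.
- by rewrite (_ : Ordinal h = idx1)//; exact: val_inj.
- by rewrite (_ : Ordinal h = idx2)//; exact: val_inj.
Qed.

Lemma sum3 (F : 'I_3 -> R) : \sum_i F i = F idx0 + F idx1 + F idx2.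
Proof.
rewrite !big_ord_recl big_ord0 addr0 addrA.
by congr (_ + _ + _); congr F; exact: val_inj.
Qed.

Definition vec3 (u : R * R * R) : 'cV[R]_3 := \col_i [:: u.1.1; u.1.2; u.2]`_i.

(** After division by the mass p, symmetry turns the one-sided bounds M i j <= x j into both Frechet
    bounds on the covariances, and [dominated_admissible] applies. A zero mass forces all means and
    second moments to vanish, and the empty list serves. *)
Lemma moments_atoms (p : R) (x : 'I_3 -> R) (M : 'I_3 -> 'I_3 -> R) :
  (forall s (u : 'cV[R]_3), 0 <= s ^+ 2 * p + 2 * s * (\sum_i u i 0 * x i)
       + \sum_i \sum_j u i 0 * u j 0 * M i j) ->
  (forall i j, M i j = M j i) -> (forall i j, M i j <= x j) ->
  exists s : seq (R * 'cV[R]_3),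
  [/\ all (fun a => 0 <= a.1) s, forall a, a \in s -> unit_box a.2,
      \sum_(a <- s) a.1 = p, forall i, \sum_(a <- s) a.1 * a.2 i 0 = x i
    & (forall i, \sum_(a <- s) a.1 * (a.2 i 0 * a.2 i 0) = M i i) /\
      forall i j, M i j <= \sum_(a <- s) a.1 * (a.2 i 0 * a.2 j 0)].
Proof.
move=> psdM symM frechet.
have form s u v w : 0 <= s ^+ 2 * p + 2 * s * (u * x idx0 + v * x idx1 + w * x idx2)
   + (M idx0 idx0 * u ^+ 2 + M idx1 idx1 * v ^+ 2 + M idx2 idx2 * w ^+ 2
     + 2 * (M idx0 idx1 * u * v + M idx0 idx2 * u * w + M idx1 idx2 * v * w)).
  have := psdM s (vec3 (u, v, w)); rewrite !sum3 !mxE /=.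
  rewrite (symM idx1 idx0) (symM idx2 idx0) (symM idx2 idx1).
  by congr (_ <= _); ring.
have diag_ge0 : forall i, 0 <= M i i.
  apply: ord3_ind; [have := form 0 1 0 0|have := form 0 0 1 0|have := form 0 0 0 1]; lra.
have mean_le : forall i, x i <= p.
  have := frechet idx0 idx0; have := frechet idx1 idx1; have := frechet idx2 idx2.
  move=> h2 h1 h0; apply: ord3_ind;
    [have := form (-1) 1 0 0|have := form (-1) 0 1 0|have := form (-1) 0 0 1]; lra.
have mean_ge0 i : 0 <= x i by exact: le_trans (diag_ge0 i) (frechet i i).
have p0 : 0 <= p := le_trans (mean_ge0 idx0) (mean_le idx0).
have [pE|pn] := eqVneq p 0.
  have x0 i : x i = 0 by apply/le_anti; rewrite mean_ge0 -pE mean_le.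
  have M0 i : M i i = 0 by apply/le_anti; rewrite diag_ge0 -(x0 i) frechet.
  exists [::]; split=> //; rewrite ?big_nil//.
  - by move=> i; rewrite big_nil x0.
  - by split=> [i|i j]; rewrite big_nil ?M0// -(x0 j) frechet.
have pp : 0 < p by rewrite lt_neqAle eq_sym pn p0.
pose y i := x i / p.
pose cov i j := M i j / p - y i * y j.
have cform u v w : 0 <= cov idx0 idx0 * u ^+ 2 + cov idx1 idx1 * v ^+ 2
     + cov idx2 idx2 * w ^+ 2
     + 2 * (cov idx0 idx1 * u * v + cov idx0 idx2 * u * w + cov idx1 idx2 * v * w).
  (* Centring: with s equal to minus the mean of the linear form, the moment form divided by p is
     the covariance form. *)
  have := form (- (u * y idx0 + v * y idx1 + w * y idx2)) u v w.
  move=> h; have := mulr_ge0 h (_ : 0 <= p^-1); rewrite invr_ge0 p0 => /(_ isT).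
  by congr (_ <= _); rewrite /cov /y; field.
have [m1 m2 m3 m4] := ternary_form_ge0 cform.
have y01 i : 0 <= y i <= 1.
  by rewrite divr_ge0//= ler_pdivrMr// mul1r.
have fr i j : cov i j <= y j * (1 - y i).
  have : M i j / p <= y j by rewrite ler_pM2r ?invr_gt0.
  by rewrite /cov; lra.
have fr' i j : cov i j <= y i * (1 - y j).
  by have := fr j i; rewrite /cov symM [y j * y i]mulrC.
have adm : admissible (y idx0) (y idx1) (y idx2) (cov idx0 idx0) (cov idx1 idx1)
    (cov idx2 idx2) (cov idx0 idx1) (cov idx0 idx2) (cov idx1 idx2).
  split=> //.
  - by have := cform 1 0 0; lra.
  - by have := cform 0 1 0; lra.
  - by have := cform 0 0 1; lra.
have [s [oks s1 [e1 e2 e3] [v1 v2 v3] [c1 c2 c3]]] := dominated_admissible adm.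
exists [seq (p * a.1, vec3 a.2) | a <- s]; split.
- rewrite all_map; apply: sub_all oks => a /and4P[a0 _ _ _] /=.
  by rewrite mulr_ge0.
- move=> _ /mapP[a /(allP oks) /and4P[_ a1 a2 a3] ->].
  by apply: ord3_ind; rewrite /= mxE.
- by rewrite big_map -big_distrr /= s1 mulr1.
- apply: ord3_ind; rewrite big_map; under eq_bigr do rewrite /= mxE /= -mulrA;
    by rewrite -big_distrr /= ?e1 ?e2 ?e3 /y mulrC divfK.
have E i j : p * (cov i j + y i * y j) = M i j.
  by rewrite /cov /y; field.
split.
  apply: ord3_ind; rewrite big_map; under eq_bigr do rewrite /= !mxE /= -mulrA -expr2;
    by rewrite -big_distrr /= ?v1 ?v2 ?v3 expr2 E.
have sym (P : 'I_3 -> 'I_3 -> Prop) : (forall i j, P i j -> P j i) ->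
    P idx0 idx0 -> P idx1 idx1 -> P idx2 idx2 -> P idx0 idx1 -> P idx0 idx2 -> P idx1 idx2 ->
    forall i j, P i j.
  by move=> Ps h1 h2 h3 h4 h5 h6; apply: ord3_ind; apply: ord3_ind => //; apply: Ps.
apply: sym => [i j||||||].
  rewrite symM; congr (_ <= _); apply: eq_bigr => a _.
  by rewrite [X in _ * X]mulrC.
all: rewrite big_map; under eq_bigr do rewrite /= !mxE /= -mulrA;
  rewrite -E -big_distrr /= ler_pM2l//.
- by under eq_bigr do rewrite -expr2; rewrite v1 expr2.
- by under eq_bigr do rewrite -expr2; rewrite v2 expr2.
- by under eq_bigr do rewrite -expr2; rewrite v3 expr2.
Qed.

End Three.

(** * Gluing the atoms of all pieces *)

Section Exactness.
Variables (R : realType) (m K : nat) (X : set 'cV[R]_m).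
Variable A : 'I_K.+1 -> 'cV[R]_m -> 'M[R]_3.
Variable b : 'I_K.+1 -> 'cV[R]_m -> 'cV[R]_3.
Variable c : 'I_K.+1 -> 'cV[R]_m -> R^o.
Variables (mu : 'cV[R]_3) (Sigma : 'M[R]_3).
Hypothesis symA : forall k x, symmx (A k x).
Hypothesis symS : symmx Sigma.

Lemma atoms_ambiguity (s : seq (R * 'cV[R]_3)) :
  all (fun a => 0 <= a.1) s -> (forall a, a \in s -> unit_box a.2) ->
  \sum_(a <- s) a.1 = 1 ->
  (forall i, \sum_(a <- s) a.1 * a.2 i 0 = mu i 0) ->
  (forall i, \sum_(a <- s) a.1 * (a.2 i 0 * a.2 i 0) = Sigma i i) ->
  (forall i j, Sigma i j <= \sum_(a <- s) a.1 * (a.2 i 0 * a.2 j 0)) ->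
  exists2 P, ambiguity_set mu Sigma P &
    forall f : 'cV[R]_3 -> R, continuous f ->
      ('E_P[f : borel_vec R 3 -> R] = (\sum_(a <- s) a.1 * f a.2)%R%:E)%E.
Proof.
move=> s0 sbox s1 smean sdiag smoment.
have [P [P0 PE]] := discrete_probability s0 s1; exists P => //.
have c1 i : continuous (fun v : 'cV[R]_3 => v i 0) by exact: coord_continuous.
have c2 i j : continuous (fun v : 'cV[R]_3 => v i 0 * v j 0).
  by apply: continuousM; exact: coord_continuous.
split.
- move=> x suppx; apply: contrapT => xbox.
  have obox : open (~` @unit_box R 3).
    apply: closed_openC; apply: compact_closed; last exact: unit_box_compact.
    exact: norm_hausdorff.
  have := suppx _ obox xbox; rewrite P0 ?ltxx//; first exact: open_measurable_vec.
  by move=> a /sbox ?; apply.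
- apply/matrixP => i j; rewrite !mxE (ord1 j).
  by rewrite (PE _ (c1 i)) smean.
- apply/matrixP => i j; rewrite !mxE.
  under [X in expectation _ X]eq_fun do rewrite mxE outerE.
  by rewrite (PE _ (c2 i i)) sdiag.
- move=> i j; rewrite !mxE.
  under [X in expectation _ X]eq_fun do rewrite outerE.
  by rewrite (PE _ (c2 i j)) lee_fin.
Qed.

(** Approximate dual moments for the fixed x are realized piece by piece, and the mixture of these
    measures comes within e of v. Letting e tend to 0 removes the gap. *)
Lemma exact_at (x : 'cV[R]_m) (v : R) : X x ->
  (forall k, submodular (- A k x)) ->
  (v%:E <= sdp_value X A b c mu Sigma)%E ->
  (v%:E <= ereal_sup [set 'E_P[max_piece A b c x : borel_vec R 3 -> R]
                     | P in ambiguity_set mu Sigma])%E.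
Proof.
move=> Xx subA vsdp; apply/lee_addgt0Pr => e e0.
(* For n = 3 the loss (2 + n) eta equals e. *)
have eta0 : 0 < e / 5 by rewrite divr_gt0.
have lb : sdp_lower_bound (fun k => A k x) (fun k => b k x) (fun k => c k x) mu Sigma v.
  move=> y0 y Y Z sY Z0 psdk; rewrite -lee_fin (le_trans vsdp)//.
  apply: ereal_inf_lbound; exists (x, y0, y, Y, [ffun k => Z k]) => //.
  by split=> // k; rewrite ffunE //; exact: psdk.
have [L [l [l0 psdL frechet [massE meanE diagE momentG] val]]] :=
  sdp_dual_moments (fun k => symA k x) symS eta0 lb.
have /choice[s sP] : forall k, exists s : seq (R * 'cV[R]_3),
  [/\ all (fun a => 0 <= a.1) s, forall a, a \in s -> unit_box a.2,
      \sum_(a <- s) a.1 = dmass (L k),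
      forall i, \sum_(a <- s) a.1 * a.2 i 0 = dmean (L k) i
    & (forall i, \sum_(a <- s) a.1 * (a.2 i 0 * a.2 i 0) = dmoment (L k) i i) /\
      forall i j, dmoment (L k) i j <= \sum_(a <- s) a.1 * (a.2 i 0 * a.2 j 0)].
  by move=> k; apply: moments_atoms; [exact: psdL|exact: dmomentC|exact: frechet].
(* The mixture: piece k contributes its atoms, of total mass [dmass (L k)], and these masses add up
   to l. *)
pose S := flatten [seq [seq (l^-1 * a.1, a.2) | a <- s k] | k <- index_enum 'I_K.+1].
have sumS (F : 'cV[R]_3 -> R) : \sum_(a <- S) a.1 * F a.2 =
    l^-1 * \sum_k \sum_(a <- s k) a.1 * F a.2.
  rewrite /S big_flatten big_map big_distrr /=; apply: eq_bigr => k _.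
  by rewrite big_map big_distrr; apply: eq_bigr => a _; rewrite /= mulrA.
have SP a : a \in S -> exists k a', [/\ a' \in s k, a.1 = l^-1 * a'.1 & a.2 = a'.2].
  move=> /flattenP[_ /mapP[k _ ->] /mapP[a' a's ->]].
  by exists k, a'.
have lV0 : 0 <= l^-1 by rewrite invr_ge0 ltW.
have ln : l != 0 by rewrite gt_eqF.
have [||||||P aP PE] := @atoms_ambiguity S.
- apply/allP => a /SP[k [a' [a's -> _]]]; rewrite mulr_ge0//.
  by have [/allP s0 _ _ _ _] := sP k; exact: s0.
- by move=> a /SP[k [a' [a's _ ->]]]; have [_ sb _ _ _] := sP k; exact: sb.
- transitivity (\sum_(a <- S) a.1 * (fun=> 1 : R) a.2).
    by apply: eq_bigr => a _; rewrite mulr1.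
  rewrite (sumS (fun=> 1)).
  have -> : \sum_k \sum_(a <- s k) a.1 * 1 = l.
    rewrite -massE; apply: eq_bigr => k _.
    by have [_ _ <- _ _] := sP k; apply: eq_bigr => a _; rewrite mulr1.
  by rewrite mulVf.
- move=> i; rewrite (sumS (fun v => v i 0)).
  have -> : \sum_k \sum_(a <- s k) a.1 * a.2 i 0 = l * mu i 0.
    by rewrite -meanE; apply: eq_bigr => k _; have [_ _ _ -> _] := sP k.
  by rewrite mulKf.
- move=> i; rewrite (sumS (fun v => v i 0 * v i 0)).
  have -> : \sum_k \sum_(a <- s k) a.1 * (a.2 i 0 * a.2 i 0) = l * Sigma i i.
    by rewrite -diagE; apply: eq_bigr => k _; have [_ _ _ _ [-> _]] := sP k.
  by rewrite mulKf.
- move=> i j; rewrite (sumS (fun v => v i 0 * v j 0)) mulrC ler_pdivlMr// mulrC.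
  apply: le_trans (momentG i j) _; apply: ler_sum => k _.
  by have [_ _ _ _ [_ h]] := sP k; exact: h.
apply: (@le_trans _ _ ('E_P[max_piece A b c x : borel_vec R 3 -> R] + e%:E)%E); last first.
  by apply: leeD2r; apply: ereal_sup_ubound; exists P.
rewrite PE; last exact: max_piece_continuous.
rewrite -EFinD lee_fin sumS -lerBlDr mulrC ler_pdivlMr// mulrC.
have -> : v - e = v - (2 + 3%:R) * (e / 5) by lra.
apply: le_trans val _; apply: ler_sum => k _.
have [/allP s0 sb sm smean [sdiag smoment]] := sP k.
(* On the atoms belonging to k the maximum is bounded below by piece k alone. *)
apply: (@le_trans _ _ (\sum_(a <- s k) a.1 * quadratic (c k x) (b k x) (A k x) a.2)); last first.
  rewrite !big_seq; apply: ler_sum => a a_s; rewrite ler_wpM2l//; first exact: s0.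
  by rewrite -pieceE; exact: le_bigmax_cond.
have -> : \sum_(a <- s k) a.1 * quadratic (c k x) (b k x) (A k x) a.2 =
  c k x * dmass (L k) + \sum_i b k x i 0 * dmean (L k) i
  + \sum_i \sum_j A k x i j * (\sum_(a <- s k) a.1 * (a.2 i 0 * a.2 j 0)).
  under [X in _ = _ + X]eq_bigr do under eq_bigr do rewrite big_distrr /=.
  under [X in _ = _ + X]eq_bigr do rewrite exchange_big /=.
  rewrite [X in _ = _ + X]exchange_big /=.
  under [X in _ = _ + X + _]eq_bigr => i _.
    rewrite -smean big_distrr /=; over.
  rewrite [X in _ = _ + X + _]exchange_big /=.
  rewrite -sm big_distrr -!big_split /=; apply: eq_bigr => a _.
  rewrite /quadratic !mulrDr; congr (_ + _ + _).
  - by rewrite mulrC.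
  - by rewrite big_distrr; apply: eq_bigr => i _ /=; ring.
  - rewrite big_distrr; apply: eq_bigr => i _ /=.
    by rewrite big_distrr; apply: eq_bigr => j _ /=; ring.
rewrite /dquad lerD2l; apply: ler_sum => i _; apply: ler_sum => j _.
(* Here submodularity of [- A k x] enters: off-diagonal weights are nonnegative, so replacing the
   moments by larger ones is favourable, while the diagonal moments agree. *)
have [<-|ij] := eqVneq i j; first by rewrite sdiag.
rewrite ler_wpM2l//; have [_ /(_ i j ij)] := subA k.
by rewrite mxE oppr_le0.
Qed.

Lemma sdp_le_dro : (forall x k, X x -> submodular (- A k x)) ->
  (sdp_value X A b c mu Sigma <= dro_value X A b c mu Sigma)%E.
Proof.
move=> subA; apply: le_ereal_inf_tmp => _ [x Xx <-].
have ex := fun v => @exact_at x v Xx (fun k => subA x k Xx).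
case sE : (sdp_value X A b c mu Sigma) => [v| |].
- by apply: ex; rewrite sE.
- rewrite leye_eq; apply/eqP/eq_infty => v.
  by apply: ex; rewrite sE leey.
- exact: leNye.
Qed.

End Exactness.

(** * Semidefinite representability *)

Section AffineMaps.
Variable R : realType.

(** Affinity without naming the linear part, which is necessarily f - f 0; stability under
    composition and block assembly becomes rewriting. *)
Definition affine_eq (V W : lmodType R) (f : V -> W) : Prop :=
  forall a u v, f (a *: u + v) = a *: (f u - f 0) + f v.

Lemma affine_mapP (V W : lmodType R) (f : V -> W) : affine_map f <-> affine_eq f.
Proof.
split=> [[L [w fE]] a u v|af].
  by rewrite !fE linear0 linearP add0r addrK addrA.
have lin : linear (fun v => f v - f 0).
  by move=> a u v; rewrite af addrA.
pose m := GRing.isLinear.Build R V W _ (fun v => f v - f 0) lin.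
pose L : {linear V -> W} := HB.pack (fun v => f v - f 0) m.
by exists L, (f 0) => v; rewrite subrK.
Qed.

Lemma affine_eq_linear (V W : lmodType R) (f : V -> W) :
  (forall a u v, f (a *: u + v) = a *: f u + f v) -> affine_eq f.
Proof.
move=> lf; have f0 : f 0 = 0.
  by have := lf (-1) 0 0; rewrite !scaleN1r oppr0 addr0 addNr.
by move=> a u v; rewrite f0 subr0.
Qed.

Lemma affine_eq_comp (U V W : lmodType R) (f : U -> V) (g : V -> W) :
  affine_eq f -> affine_eq g -> affine_eq (fun u => g (f u)).
Proof.
move=> af ag a u v; rewrite af ag; congr (_ *: _ + _).
by have := ag 1 (f u - f 0) (f 0); rewrite !scale1r subrK => ->; rewrite addrK.
Qed.

Lemma affine_eq_fst (V W : lmodType R) : affine_eq (fun z : V * W => z.1).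
Proof. exact: affine_eq_linear. Qed.

Lemma affine_eq_snd (V W : lmodType R) : affine_eq (fun z : V * W => z.2).
Proof. exact: affine_eq_linear. Qed.

Lemma affine_eq_pair (U V W : lmodType R) (f : U -> V) (g : U -> W) :
  affine_eq f -> affine_eq g -> affine_eq (fun z => (f z, g z)).
Proof. by move=> af ag a u v; rewrite af ag. Qed.

Lemma affine_eq_cst (V W : lmodType R) (w : W) : affine_eq (fun _ : V => w).
Proof. by move=> a u v; rewrite subrr scaler0 add0r. Qed.

Lemma affine_eqD (V W : lmodType R) (f g : V -> W) :
  affine_eq f -> affine_eq g -> affine_eq (fun v => f v + g v).
Proof. by move=> af ag a u v; rewrite af ag opprD addrACA -scalerDr addrACA. Qed.

Lemma affine_eqN (V W : lmodType R) (f : V -> W) :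
  affine_eq f -> affine_eq (fun v => - f v).
Proof. by move=> af a u v; rewrite af opprD -scalerN !opprD. Qed.

Lemma affine_eqZ (V W : lmodType R) (t : R) (f : V -> W) :
  affine_eq f -> affine_eq (fun v => t *: f v).
Proof. by move=> af a u v; rewrite af scalerDr -!scalerBr !scalerA mulrC. Qed.

Lemma affine_eq_block (V : lmodType R) p q (F : V -> 'M[R]_p) (G : V -> 'M[R]_(p, q))
    (H : V -> 'M[R]_(q, p)) (T : V -> 'M[R]_q) :
  affine_eq F -> affine_eq G -> affine_eq H -> affine_eq T ->
  affine_eq (fun v => block_mx (F v) (G v) (H v) (T v)).
Proof.
move=> aF aG aH aT a u v; rewrite aF aG aH aT.
by rewrite opp_block_mx add_block_mx scale_block_mx add_block_mx.
Qed.

End AffineMaps.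

(** * Calculus of linear matrix inequalities *)

Section LinearMatrixInequalities.
Variables (R : realType) (W : lmodType R).

Definition lmi (p : nat) (S : set W) : Prop :=
  exists F : W -> 'M[R]_p,
    [/\ affine_eq F, forall z, symmx (F z) & S = [set z | psd (F z)]].

Lemma psd_block (p q : nat) (A : 'M[R]_p) (B : 'M[R]_q) :
  psd (block_mx A 0 0 B) <-> psd A /\ psd B.
Proof.
have form (u : 'cV[R]_p) (v : 'cV[R]_q) :
    ((col_mx u v)^T *m block_mx A 0 0 B *m col_mx u v) 0 0 =
    (u^T *m A *m u) 0 0 + (v^T *m B *m v) 0 0.
  by rewrite tr_col_mx mul_row_block mul_row_col !mulmx0 addr0 add0r mxE.
split=> [[sAB pAB]|[[sA pA] [sB pB]]].
  move: sAB; rewrite /symmx tr_block_mx !trmx0 => /eq_block_mx[sA _ _ sB].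
  split; split=> // v.
    by have := pAB (col_mx v 0); rewrite form trmx0 !mul0mx [in X in _ + X]mxE addr0.
  by have := pAB (col_mx 0 v); rewrite form trmx0 !mul0mx [in X in X + _]mxE add0r.
split; first by rewrite /symmx tr_block_mx !trmx0 sA sB.
by move=> v; rewrite -(vsubmxK v) form addr_ge0.
Qed.

Lemma lmi_setI p q (S T : set W) : lmi p S -> lmi q T -> lmi (p + q) (S `&` T).
Proof.
move=> [F [aF sF ->]] [G [aG sG ->]].
exists (fun z => block_mx (F z) 0 0 (G z)); split.
- by apply: affine_eq_block => //; exact: affine_eq_cst.
- by move=> z; rewrite /symmx tr_block_mx !trmx0 sF sG.
- by apply/seteqP; split=> z /= /psd_block.
Qed.

Lemma lmi_setT : lmi 0 (@setT W).
Proof.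
exists (fun=> 0); split; first exact: affine_eq_cst.
  by move=> z; rewrite /symmx trmx0.
by apply/seteqP; split=> // z _; exact: psd0.
Qed.

Lemma lmi_forall (I : finType) p (S : I -> set W) : (forall i, lmi p (S i)) ->
  lmi (#|I| * p) [set z | forall i, S i z].
Proof.
move=> lS; have H (s : seq I) : lmi (size s * p) [set z | forall i, i \in s -> S i z].
  elim: s => [|i s IH] /=.
    have -> : [set z | forall i, i \in [::] -> S i z] = setT by apply/seteqP.
    exact: lmi_setT.
  have -> : [set z | forall j, j \in i :: s -> S j z] =
     S i `&` [set z | forall j, j \in s -> S j z].
    apply/seteqP; split=> z /=.
      by move=> h; split=> [|j js]; apply: h; rewrite in_cons ?eqxx ?js ?orbT.
    by move=> [Si h] j; rewrite in_cons => /orP[/eqP->|/h].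
  exact: lmi_setI.
have := H (enum I); rewrite -cardE; congr lmi.
by apply/seteqP; split=> z /= h i *; apply: h; rewrite ?mem_enum.
Qed.

Lemma lmi_ge0 (g : W -> R^o) : affine_eq g -> lmi 1 [set z | 0 <= g z].
Proof.
move=> ag; exists (fun z => (g z)%:M); split.
- move=> a u v; rewrite ag; apply/matrixP => i j.
  by rewrite !mxE !ord1 /= !mulr1n.
- by move=> z; exact: tr_scalar_mx.
- apply/seteqP; split=> z /=.
    move=> gz; split=> [|v]; first exact: tr_scalar_mx.
    rewrite mul_mx_scalar -scalemxAl mxE mulr_ge0// mxE big_ord1 mxE.
    by rewrite -expr2 sqr_ge0.
  by move=> [_ /(_ 1)]; rewrite trmx1 mul1mx mulmx1 mxE eqxx mulr1n.
Qed.

Lemma lmi_eq0 (g : W -> R^o) : affine_eq g -> lmi 2 [set z | g z = 0].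
Proof.
move=> ag; have := lmi_setI (lmi_ge0 ag) (lmi_ge0 (affine_eqN ag)).
congr (lmi _ _); apply/seteqP; split=> z /=.
  by rewrite oppr_ge0 => -[? ?]; apply/le_anti/andP.
by move=> ->; rewrite oppr0.
Qed.

Lemma half_double (V : lmodType R) (v : V) : 2^-1 *: (v + v) = v.
Proof.
by rewrite scalerDr -scalerDl (_ : 2^-1 + 2^-1 = 1) ?scale1r//; field.
Qed.

(** An inequality must have a symmetric matrix at every point, including those where Y is not
    symmetric, hence the symmetrization. *)
Lemma lmi_psd p (F : W -> 'M[R]_p) : affine_eq F ->
  lmi p [set z | psd (2^-1 *: (F z + (F z)^T))].
Proof.
move=> aF; exists (fun z => 2^-1 *: (F z + (F z)^T)); split=> //.
  apply: affine_eqZ; apply: affine_eqD => //.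
  apply: (@affine_eq_comp _ _ _ _ F trmx) => //.
  by apply: affine_eq_linear => a u v; rewrite linearP.
by move=> z; rewrite /symmx linearZ /= linearD /= trmxK addrC.
Qed.

End LinearMatrixInequalities.

(** * The feasible set as one linear matrix inequality *)

Section FeasibleSet.
Variables (R : realType) (m n K : nat).
Variable A : 'I_K.+1 -> 'cV[R]_m -> 'M[R]_n.
Variable b : 'I_K.+1 -> 'cV[R]_m -> 'cV[R]_n.
Variable c : 'I_K.+1 -> 'cV[R]_m -> R^o.
Hypothesis affA : forall k, affine_map (A k).
Hypothesis affb : forall k, affine_map (b k).
Hypothesis affc : forall k, affine_map (c k).
Hypothesis symA : forall k x, symmx (A k x).

Section Lifted.
Variable q : nat.
Let W : lmodType R := (sdp_var R m n K * 'cV[R]_q)%type.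

Let vx (z : W) : 'cV[R]_m := z.1.1.1.1.1.
Let vy0 (z : W) : R^o := z.1.1.1.1.2.
Let vy (z : W) : 'cV[R]_n := z.1.1.1.2.
Let vY (z : W) : 'M[R]_n := z.1.1.2.
Let vZ (k : 'I_K.+1) (z : W) : 'M[R]_n := z.1.2 k.

Let W0 : lmodType R := ('cV[R]_m * R^o)%type.
Let W1 : lmodType R := (W0 * 'cV[R]_n)%type.
Let W2 : lmodType R := (W1 * 'M[R]_n)%type.
Let W3 : lmodType R := (W2 * {ffun 'I_K.+1 -> 'M[R]_n})%type.

Let affine_W3 : affine_eq (fun z : W => z.1 : W3).
Proof. exact: (@affine_eq_fst R W3). Qed.

Let affine_W2 : affine_eq (fun z : W => z.1.1 : W2).
Proof. exact: affine_eq_comp affine_W3 (@affine_eq_fst R W2 _). Qed.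

Let affine_W1 : affine_eq (fun z : W => z.1.1.1 : W1).
Proof. exact: affine_eq_comp affine_W2 (@affine_eq_fst R W1 _). Qed.

Let affine_W0 : affine_eq (fun z : W => z.1.1.1.1 : W0).
Proof. exact: affine_eq_comp affine_W1 (@affine_eq_fst R W0 _). Qed.

Let affine_vx : affine_eq vx.
Proof. exact: affine_eq_comp affine_W0 (@affine_eq_fst R _ _). Qed.

Let affine_vy0 : affine_eq vy0.
Proof. exact: affine_eq_comp affine_W0 (@affine_eq_snd R _ _). Qed.

Let affine_vy : affine_eq vy.
Proof. exact: affine_eq_comp affine_W1 (@affine_eq_snd R _ _). Qed.

Let affine_vY : affine_eq vY.
Proof. exact: affine_eq_comp affine_W2 (@affine_eq_snd R _ _). Qed.

Let affine_vZ k : affine_eq (vZ k).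
Proof.
have ag : affine_eq (fun f : {ffun 'I_K.+1 -> 'M[R]_n} => f k).
  by apply: affine_eq_linear => a u v; rewrite !ffunE.
exact: affine_eq_comp (affine_eq_comp affine_W3 (@affine_eq_snd R W2 _)) ag.
Qed.

Let affine_entry (F : W -> 'M[R]_n) i j : affine_eq F ->
  affine_eq (fun z => F z i j : R^o).
Proof.
move=> aF; apply: (affine_eq_comp aF (g := fun M : 'M[R]_n => M i j : R^o)).
by apply: affine_eq_linear => a u v; rewrite !mxE.
Qed.

Let affine_trmx p r (F : W -> 'M[R]_(p, r)) : affine_eq F ->
  affine_eq (fun z => (F z)^T).
Proof.
move=> aF; apply: (affine_eq_comp aF (g := trmx)).
by apply: affine_eq_linear => a u v; rewrite linearP.
Qed.

Let affine_quad (g : W -> R^o) (h : W -> 'cV[R]_n) (F : W -> 'M[R]_n) :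
  affine_eq g -> affine_eq h -> affine_eq F ->
  affine_eq (fun z => quad_mx (g z) (h z) (F z)).
Proof.
move=> ag ah aF; apply: affine_eq_block => //; last exact: affine_eqZ.
  apply: (affine_eq_comp ag (g := fun t : R^o => t%:M : 'M[R]_1)).
  by apply: affine_eq_linear => a u v; rewrite rmorphD /= scale_scalar_mx.
by apply: affine_eqZ; exact: affine_trmx.
Qed.

Let vslack k (z : W) : 'M[R]_(1 + n) :=
  slack (fun k => A k (vx z)) (fun k => b k (vx z)) (fun k => c k (vx z))
    k (vy0 z) (vy z) (vY z) (vZ k z).

Let affine_vslack k : affine_eq (vslack k).
Proof.
have aZ := affine_vZ k.
apply: affine_eqD.
  apply: affine_quad => //.
    apply: affine_eqD => //; apply: affine_eqN.
    apply: (affine_eq_comp (affine_trmx aZ) (g := fun M => M *m ones R n)).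
    by apply: affine_eq_linear => a u v; rewrite mulmxDl -scalemxAl.
  apply: affine_eqD => //; apply: affine_eqZ; apply: affine_eqD => //.
  exact: affine_trmx.
apply: affine_eqN; apply: affine_quad.
- by apply: (affine_eq_comp affine_vx (g := c k)); apply/affine_mapP.
- by apply: (affine_eq_comp affine_vx (g := b k)); apply/affine_mapP.
- by apply: (affine_eq_comp affine_vx (g := A k)); apply/affine_mapP.
Qed.

Let IJ : finType := ('I_n * 'I_n)%type.
Let KIJ : finType := ('I_K.+1 * ('I_n * 'I_n))%type.

(** The summands of the order are, in turn: the inequality lifting X, the symmetry of Y with two
    inequalities per equation, its off-diagonal signs, the signs of the multipliers, and the
    semidefinite constraints. *)
Lemma lmi_feasible p (F : ('cV[R]_m * 'cV[R]_q)%type -> 'M[R]_p) :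
  affine_map F -> (forall z, symmx (F z)) ->
  lmi (p + (n * n * 2 + (n * n * 1 + (K.+1 * (n * n) * 1 + K.+1 * (1 + n)))))
    [set z : W | psd (F (vx z, z.2)) /\ sdp_constraints [set: 'cV[R]_m] A b c
       (vx z) (vy0 z) (vy z) (vY z) (vZ ^~ z)].
Proof.
move=> /affine_mapP aF sF.
have lF : lmi p [set z : W | psd (F (vx z, z.2))].
  exists (fun z => F (vx z, z.2)); split=> //.
  exact: affine_eq_comp (affine_eq_pair affine_vx (@affine_eq_snd R W3 _)) aF.
have lsym : lmi (n * n * 2) [set z : W | forall ij : IJ, vY z ij.1 ij.2 - vY z ij.2 ij.1 = 0].
  rewrite -[X in (X * X * 2)%N]card_ord -card_prod; apply: lmi_forall => -[i j].
  apply: lmi_eq0; apply: affine_eqD; first exact: affine_entry.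
  by apply: affine_eqN; exact: affine_entry.
(* Diagonal positions carry the trivial constraint 0 >= 0, so that the index set is all pairs. *)
have loff : lmi (n * n * 1) [set z : W | forall ij : IJ,
    0 <= (if ij.1 == ij.2 then 0 else - vY z ij.1 ij.2 : R^o)].
  rewrite -[X in (X * X * 1)%N]card_ord -card_prod; apply: lmi_forall => -[i j] /=.
  apply: lmi_ge0; case: eqP => _; first exact: affine_eq_cst.
  by apply: affine_eqN; exact: affine_entry.
have lZ : lmi (K.+1 * (n * n) * 1) [set z : W | forall t : KIJ, 0 <= vZ t.1 z t.2.1 t.2.2].
  rewrite -[X in (_ * (X * X) * 1)%N]card_ord -[X in (X * _ * 1)%N]card_ord -!card_prod.
  by apply: lmi_forall => -[k [i j]]; apply: lmi_ge0; exact: affine_entry.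
have lpsd : lmi (K.+1 * (1 + n)) [set z : W | forall k : 'I_K.+1,
    psd (2^-1 *: (vslack k z + (vslack k z)^T))].
  rewrite -[X in (X * _)%N]card_ord; apply: lmi_forall => k.
  exact: lmi_psd.
have := lmi_setI lF (lmi_setI lsym (lmi_setI loff (lmi_setI lZ lpsd))).
congr lmi; apply/seteqP; split=> z /=.
  move=> [Fz [Ysym [Yoff [Z0 pz]]]]; split=> //.
  have sY : symmx (vY z).
    by apply/matrixP => i j; rewrite mxE; have /eqP := Ysym (j, i); rewrite subr_eq0 => /eqP.
  split=> //; last 1 first.
  - move=> k; have := pz k.
    have -> : 2^-1 *: (vslack k z + (vslack k z)^T) = vslack k z.
      have -> : (vslack k z)^T = vslack k z by exact: symmx_slack.
      exact: half_double.
    by [].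
  - by split=> // i j ij; have := Yoff (i, j); rewrite /= (negbTE ij) oppr_ge0.
  - by move=> k i j; exact: (Z0 (k, (i, j))).
move=> [Fz [_ [sY Yoff] Z0 pz]]; split; first exact: Fz.
split; first by move=> [i j] /=; rewrite -[in X in X - _]sY mxE subrr.
split; first by move=> [i j] /=; case: eqP => // /eqP ij; rewrite oppr_ge0 Yoff.
split; first by move=> [k [i j]]; exact: Z0.
move=> k; have -> : (vslack k z)^T = vslack k z by case: (pz k).
by rewrite half_double; exact: pz.
Qed.

End Lifted.
End FeasibleSet.

Lemma dim_sdp_var (R : realType) (m n K : nat) :
  \dim {: sdp_var R m n K} = (m + 1 + n + n * n + K.+1 * (n * n))%N.
Proof.
rewrite dimvf.
transitivity (m * 1 + 1 + n * 1 + n * n + #|'I_K.+1| * (n * n))%N; first by [].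
by rewrite card_ord !muln1.
Qed.

(** The decision variables, then s, which covers the lifting variables and the inequality of X, then
    the order of the remaining blocks. *)
Definition sdp_size (m n K s : nat) : nat :=
  (m + 1 + n + n * n + K.+1 * (n * n) + s +
   (n * n * 2 + (n * n * 1 + (K.+1 * (n * n) * 1 + K.+1 * (1 + n)))))%N.

(** The constant 8 counts terms of size at most N^3: one for m + 1 + n + s, four for n^2, two for
    K.+1 n^2, one for K.+1 (1 + n). *)
Lemma sdp_size_le (m n K s : nat) :
  (sdp_size m n K s <= ((8 : nat) *: 'X^3 : {poly nat}).[(m + n + K.+1 + s)%N])%N.
Proof.
rewrite hornerZ hornerXn /sdp_size.
set N := (m + n + K.+1 + s)%N.
rewrite -[leqRHS]/(8 * (N * (N * N)))%N.
have nN : (n <= N)%N by rewrite /N; lia.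
have n1N : (1 + n <= N)%N by rewrite /N; lia.
have kN : (K.+1 <= N)%N by rewrite /N; lia.
have N1 : (0 < N)%N by rewrite /N; lia.
have NN : (N * N <= N * (N * N))%N by rewrite leq_pmull.
have N3 : (N <= N * (N * N))%N by rewrite leq_pmulr// muln_gt0 N1.
have h1 : (n * n <= N * N)%N by exact: leq_mul.
have h2 : (K.+1 * (n * n) <= N * (N * N))%N by exact: leq_mul.
have h3 : (K.+1 * (1 + n) <= N * N)%N by exact: leq_mul.
have h4 : (m + 1 + n + s <= N)%N by rewrite /N; lia.
move: NN N3 h1 h2 h3 h4; generalize (N * (N * N))%N (N * N)%N (n * n)%N.
move=> T Q S; generalize (K.+1 * S)%N (K.+1 * (1 + n))%N; lia.
Qed.

Lemma sdp_feasible_representable (R : realType) (m n K s : nat) (X : set 'cV[R]_m)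
    (A : 'I_K.+1 -> 'cV[R]_m -> 'M[R]_n) (b : 'I_K.+1 -> 'cV[R]_m -> 'cV[R]_n)
    (c : 'I_K.+1 -> 'cV[R]_m -> R^o) :
  (forall k, affine_map (A k)) -> (forall k, affine_map (b k)) ->
  (forall k, affine_map (c k)) -> (forall k x, symmx (A k x)) ->
  semidefinite_representable s X ->
  semidefinite_representable (sdp_size m n K s) (sdp_feasible X A b c).
Proof.
move=> affA affb affc symA [q [p [F [affF sF XE size]]]].
have [G [aG sG GE]] := lmi_feasible affA affb affc symA affF sF.
exists q, (p + (n * n * 2 + (n * n * 1 + (K.+1 * (n * n) * 1 + K.+1 * (1 + n)))))%N, G.
split=> //.
- exact/affine_mapP.
- apply/seteqP; split=> -[[[[x y0] y] Y] Z].
    rewrite /sdp_feasible /= => -[Xx sY Z0 pz].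
    have [u Fu] : exists u, psd (F (x, u)) by move: Xx; rewrite XE.
    exists u; have : [set z | psd (G z)] ((x, y0, y, Y, Z), u).
      by rewrite -GE /=; split.
    by [].
  move=> [u Gu]; have : [set z | psd (G z)] ((x, y0, y, Y, Z), u) by [].
  rewrite -GE /= => -[Fu [_ sY Z0 pz]]; split=> //.
  by rewrite XE; exists u.
- move: size; rewrite dimvf /dim /= dim_sdp_var /sdp_size.
  lia.
Qed.

(** The claim on polynomial time is rendered by one polynomial, chosen before all data, that bounds
    the size of a linear matrix inequality describing the feasible set. *)
Theorem proposition8 :
  exists bound : {poly nat},
  forall (R : realType) (m n K : nat)
    (X : set 'cV[R]_m)
    (A : 'I_K.+1 -> 'cV[R]_m -> 'M[R]_n)
    (b : 'I_K.+1 -> 'cV[R]_m -> 'cV[R]_n)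
    (c : 'I_K.+1 -> 'cV[R]_m -> R^o)
    (mu : 'cV[R]_n) (Sigma : 'M[R]_n) (s : nat),
    (forall k, affine_map (A k)) -> (forall k x, symmx (A k x)) ->
    (forall k, affine_map (b k)) -> (forall k, affine_map (c k)) ->
    symmx Sigma ->
    semidefinite_representable s X ->
    (forall x k, X x -> submodular (- A k x)) ->
    [/\ (dro_value X A b c mu Sigma <= sdp_value X A b c mu Sigma)%E,
        semidefinite_representable bound.[(m + n + K.+1 + s)%N]
          (sdp_feasible X A b c)
      & n = 3%N -> dro_value X A b c mu Sigma = sdp_value X A b c mu Sigma].
Proof.
exists ((8 : nat) *: 'X^3) => R m n K X A b c mu Sigma s.
move=> affA symA affb affc symS reprX subA; split.
- exact: dro_le_sdp.
- have [q [p [F [affF sF FE size]]]] :=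
    sdp_feasible_representable affA affb affc symA reprX.
  exists q, p, F; split=> //.
  exact: leq_trans size (sdp_size_le m n K s).
- move=> n3; subst n; apply/le_anti; rewrite dro_le_sdp.
  exact: sdp_le_dro.
Qed.
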